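(* Suppose the structural, smoothness and noise assumptions stated in the context hold, and let $x_\epsilon$ be a given (possibly random) point which is $\epsilon$-stationary in expectation for the $\gamma$-weakly convex function $\phi(\cdot)=\max_{y\in\mathcal Y}\mathcal L(\cdot,y)$, in the sense that $\mathbb E[\|\nabla\phi_\lambda(x_\epsilon)\|]\le\frac{\epsilon}{2}$ for some fixed $\lambda\in(0,\gamma^{-1})$. Then there exist parameters $\tau,\sigma,\theta$ of the form $$\tau=\frac{1-\theta}{\mu_x},\qquad \sigma=\frac{1-\theta}{\mu_y\theta},\qquad \theta\in[\bar\theta(\beta),1),$$ for some $\mu_x>0$ and some $\beta\in(0,1]$ (with $\beta<1$ if $L_{yy}>0$), such that SAPD initialized from $x_\epsilon$ can generate a point $\tilde x$ satisfying $\mathbb E[\|G_\lambda(\tilde x)\|]\le\epsilon$ within $\tilde{\mathcal O}(\epsilon^{-2})$ stochastic first-order oracle calls, where $$G_\lambda(\tilde x)=\frac1\lambda\Big[\tilde x-\mathrm{prox}_{\lambda f}\big(\tilde x-\lambda\nabla\phi^s(\tilde x)\big)\Big],\qquad \phi^s(x)=\max_{y\in\mathcal Y}\Phi(x,y)-g(y),$$ so that $\phi=f+\phi^s$.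
   Context: Let $\mathcal X=\mathbb R^n$, $\mathcal Y=\mathbb R^m$ with Euclidean norm $\|\cdot\|$, and $\mathrm{prox}_{\lambda h}(x)=\arg\min_w\{h(w)+\frac{1}{2\lambda}\|w-x\|^2\}$. Let $\mathcal L(x,y)=f(x)+\Phi(x,y)-g(y)$. Structural assumption: $f:\mathcal X\to\mathbb R\cup\{+\infty\}$, $g:\mathcal Y\to\mathbb R\cup\{+\infty\}$ are proper, closed, convex; $\Phi:\mathcal X\times\mathcal Y\to\mathbb R$ is such that (i) for any $y\in\operatorname{dom} g$, $\Phi(\cdot,y)$ is $\gamma$-weakly convex (i.e. $x\mapsto\Phi(x,y)+\frac{\gamma}{2}\|x\|^2$ is convex), with $\gamma>0$, and bounded from below; (ii) for any $x\in\operatorname{dom} f$, $\Phi(x,\cdot)$ is $\mu_y$-strongly concave with $\mu_y>0$; (iii) $\Phi$ is differentiable on an open set containing $\operatorname{dom} f\times\operatorname{dom} g$. Smoothness assumption: there are $L_{xx},L_{yy}\ge0$, $L_{xy},L_{yx}>0$ with $\|\nabla_x\Phi(x,y)-\nabla_x\Phi(\bar x,\bar y)\|\le L_{xx}\|x-\bar x\|+L_{xy}\|y-\bar y\|$ and $\|\nabla_y\Phi(x,y)-\nabla_y\Phi(\bar x,\bar y)\|\le L_{yx}\|x-\bar x\|+L_{yy}\|y-\bar y\|$ for all $x,\bar x\in\operatorname{dom} f$, $y,\bar y\in\operatorname{dom} g$. SAPD with parameters $\tau,\sigma,\theta,\mu_x$, started at $(x_0,y_0)\in\operatorname{dom} f\times\operatorname{dom}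 g$ (here $x_0=x_\epsilon$): set $\tilde q_0=0$; for $k=0,1,\dots$: $\tilde s_k=\tilde\nabla_y\Phi(x_k,y_k;\omega_k^y)+\theta\tilde q_k$; $y_{k+1}=\mathrm{prox}_{\sigma g}(y_k+\sigma\tilde s_k)$; $x_{k+1}=\mathrm{prox}_{\tau f}\big(x_k-\tau[\tilde\nabla_x\Phi(x_k,y_{k+1};\omega_k^x)+(\mu_x+\gamma)(x_k-x_0)]\big)$; $\tilde q_{k+1}=\tilde\nabla_y\Phi(x_{k+1},y_{k+1};\omega_{k+1}^y)-\tilde\nabla_y\Phi(x_k,y_k;\omega_k^y)$. Here $\tilde\nabla_x\Phi(\cdot,\cdot;\omega)$, $\tilde\nabla_y\Phi(\cdot,\cdot;\omega)$ are stochastic gradient estimates; one evaluation is one stochastic first-order oracle call. (SAPD targets $\min_x\max_y\mathcal L(x,y)+\frac{\mu_x+\gamma}{2}\|x-x_0\|^2$.) Noise assumption: for arbitrary starting point and $\mu_x>0$, there are $\delta_x,\delta_y\ge0$ such that along SAPD iterates, for all $k\ge0$: $\mathbb E[\tilde\nabla_x\Phi(x_k,y_{k+1};\omega_k^x)\mid x_k,y_{k+1}]=\nabla_x\Phi(x_k,y_{k+1})$; $\mathbb E[\tilde\nabla_y\Phi(x_k,y_k;\omega_k^y)\mid x_k,y_k]=\nabla_y\Phi(x_k,y_k)$; $\mathbb E[\|\tilde\nabla_x\Phi(x_k,y_{k+1};\omega_k^x)-\nabla_x\Phi(x_k,y_{k+1})\|^2\mid x_k,y_{k+1}]\le\delta_x^2$;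 $\mathbb E[\|\tilde\nabla_y\Phi(x_k,y_k;\omega_k^y)-\nabla_y\Phi(x_k,y_k)\|^2\mid x_k,y_k]\le\delta_y^2$. For $\lambda\in(0,\gamma^{-1})$, $\phi_\lambda(x)=\min_w\phi(w)+\frac1{2\lambda}\|w-x\|^2$ is the Moreau envelope of $\phi$, with $\nabla\phi_\lambda(x)=\lambda^{-1}(x-\mathrm{prox}_{\lambda\phi}(x))$. Since $\mu_y>0$, $\phi^s$ is differentiable on $\operatorname{dom} f$ with $\nabla\phi^s(x)=\nabla_x\Phi(x,y_*(x))$, $y_*(x)=\arg\max_y\mathcal L(x,y)$. With $L'_{xx}=L_{xx}+\gamma+\mu_x$, define $\bar\theta(\beta)=\max\{\bar\theta_1(\beta),\bar\theta_2(\beta)\}$, $\bar\theta_1(\beta)=1-\frac{\beta\mu_yL'_{xx}}{2L_{yx}^2}\Big(\sqrt{1+\frac{4L_{yx}^2\mu_x}{\beta (L'_{xx})^2\mu_y}}-1\Big)$, and $\bar\theta_2(\beta)=1-\frac{(1-\beta)^2}{8}\frac{\mu_y^2}{L_{yy}^2}\Big(\sqrt{1+\frac{16L_{yy}^2}{(1-\beta)^2\mu_y^2}}-1\Big)$ if $L_{yy}>0$, $\bar\theta_2(\beta)=0$ if $L_{yy}=0$. $\tilde{\mathcal O}$ hides factors logarithmic in $1/\epsilon$ and constants independent of $\epsilon$. *)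

(* Defs.v *)
(* MathComp-Analysis, over an arbitrary realType R *)
From HB Require Import structures.
From mathcomp Require Import all_boot all_order all_algebra.
From mathcomp Require Import all_classical all_reals all_analysis.

Set Implicit Arguments.
Unset Strict Implicit.
Unset Printing Implicit Defensive.

Import Order.TTheory GRing.Theory Num.Theory.
Import numFieldNormedType.Exports.

Local Open Scope classical_set_scope.
Local Open Scope ring_scope.

Section euclidean.
Context {R : realType}.

(* The library norm on 'rV[R]_n is the sup norm; it induces the same topology
   and the same derivatives as the Euclidean norm. *)
Definition enorm n (x : 'rV[R]_n) : R := Num.sqrt (\sum_(i < n) x 0 i ^+ 2).

Definition grad n (h : 'rV[R]_n -> R) (x : 'rV[R]_n) : 'rV[R]_n :=
  \row_(i < n) 'D_(delta_mx 0 i) h x.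

Definition borel n := g_sigma_algebraType (@open 'rV[R]_n).

End euclidean.

Section convex_analysis.
Context {R : realType} {n : nat}.
Local Open Scope convex_scope.
Implicit Types (h : 'rV[R]_n -> \bar R) (u : 'rV[R]_n -> R) (x : 'rV[R]_n).

Definition edom h : set 'rV[R]_n := [set x | (h x < +oo)%E].

Definition proper h := (forall x, (-oo < h x)%E) /\ edom h !=set0.

(* In \bar R one has 0 * +oo = 0, so the cases t = 0 and t = 1 are harmless. *)
Definition econvex h := forall (t : {i01 R}) (x y : convex_lmodType 'rV[R]_n),
  (h (x <| t |> y) <= t%:num%:E * h x + (1 - t%:num)%:E * h y)%E.

Definition proper_closed_convex h :=
  [/\ proper h, lower_semicontinuous h & econvex h].

Definition weakly_convex (gamma : R) u :=
  convex_function [set: 'rV[R]_n] (fun x => u x + gamma / 2 * enorm x ^+ 2).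

Definition strongly_concave (mu : R) u :=
  convex_function [set: 'rV[R]_n] (fun x => - (u x + mu / 2 * enorm x ^+ 2)).

Definition prox_obj (lambda : R) h x (w : 'rV[R]_n) : \bar R :=
  (h w + ((2 * lambda)^-1 * enorm (w - x) ^+ 2)%:E)%E.

(* [xget 0 A] is an element of A when A is nonempty, and 0 otherwise. *)
Definition prox (lambda : R) h x : 'rV[R]_n :=
  xget 0 [set w | forall v, (prox_obj lambda h x w <= prox_obj lambda h x v)%E].

Definition moreau (lambda : R) h x : \bar R :=
  ereal_inf (range (prox_obj lambda h x)).

Definition grad_moreau (lambda : R) h x : 'rV[R]_n :=
  grad (fine \o moreau lambda h) x.

End convex_analysis.

Section conditional_expectation.
Context {R : realType} {d} {Omega : measurableType d} (P : probability Omega R).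

(* V is a version of the conditional expectation of Z given the
   sub-sigma-algebra F *)
Definition cond_exp (F : set (set Omega)) (Z V : Omega -> R) :=
  [/\ P.-integrable setT (EFin \o Z),
      P.-integrable setT (EFin \o V),
      (forall B : set R, measurable B -> F (V @^-1` B)) &
      forall A, F A -> (\int[P]_(w in A) (Z w)%:E = \int[P]_(w in A) (V w)%:E)%E].

Definition cond_exp_vec n (F : set (set Omega)) (Z V : Omega -> 'rV[R]_n) :=
  forall i, cond_exp F (fun w => Z w 0 i) (fun w => V w 0 i).

Definition cond_exp_le (F : set (set Omega)) (Z : Omega -> R) (c : R) :=
  exists2 V, cond_exp F Z V & {ae P, forall w, V w <= c}.

Definition sigma2 n m (X : Omega -> 'rV[R]_n) (Y : Omega -> 'rV[R]_m) :
    set (set Omega) :=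
  g_sigma_preimageU (X : Omega -> borel n) (Y : Omega -> borel m).

End conditional_expectation.

Section minimax.
Context {R : realType} {n m : nat}.
Variables (f : 'rV[R]_n -> \bar R) (g : 'rV[R]_m -> \bar R).
Variable Phi : 'rV[R]_n -> 'rV[R]_m -> R.

Definition gradx (x : 'rV[R]_n) (y : 'rV[R]_m) : 'rV[R]_n := grad (Phi^~ y) x.
Definition grady (x : 'rV[R]_n) (y : 'rV[R]_m) : 'rV[R]_m := grad (Phi x) y.

(* When f x = g y = +oo the library convention gives L x y = -oo; the supremum
   over y is nevertheless +oo at every x outside dom f, since dom g is
   nonempty. *)
Definition lagrangian (x : 'rV[R]_n) (y : 'rV[R]_m) : \bar R :=
  (f x + (Phi x y)%:E - g y)%E.

Definition phi (x : 'rV[R]_n) : \bar R := ereal_sup (range (lagrangian x)).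

Definition phis (x : 'rV[R]_n) : \bar R :=
  ereal_sup (range (fun y => ((Phi x y)%:E - g y)%E)).

Lemma phiE x : proper f -> proper g -> phi x = (f x + phis x)%E.
Proof.
move=> [f_gt _] [g_gt [y1 gy1]]; rewrite /phi /phis /lagrangian.
have ub y : ((Phi x y)%:E - g y <= phis x)%E by apply: ereal_sup_ubound; exists y.
case Efx: (f x) (f_gt x) => [r| |] // _.
- apply/eqP; rewrite eq_le; apply/andP; split.
    apply: ge_ereal_sup => _ [y _ <-].
    by rewrite -addeA leeD2l// ub.
  rewrite addeC -leeBrDr//; apply: ge_ereal_sup => _ [y _ <-].
  rewrite leeBrDr// addeC addeA; apply: ereal_sup_ubound.
  by exists y.
- have fing : g y1 \is a fin_num by rewrite fin_numElt g_gt.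
  have -> : (+oo + phis x = +oo)%E.
    rewrite addye// -ltNye (lt_le_trans _ (ub y1))//.
    by rewrite -(fineK fing) ltNyr.
  apply/eqP; rewrite -leye_eq; apply: ereal_sup_ubound; exists y1 => //.
  by rewrite -(fineK fing).
Qed.

Definition ystar (x : 'rV[R]_n) : 'rV[R]_m :=
  xget 0 [set y | forall y', (lagrangian x y' <= lagrangian x y)%E].

(* The gradient on dom f of phis, in Danskin's form.
   Off dom f strong concavity may fail and phis may be +oo, so at boundary
   points of dom f it has no two-sided derivative in general. *)
Definition grad_phis (x : 'rV[R]_n) : 'rV[R]_n := gradx x (ystar x).

Definition Gmap (lambda : R) (x : 'rV[R]_n) : 'rV[R]_n :=
  lambda^-1 *: (x - prox lambda f (x - lambda *: grad_phis x)).

Definition structural_assumption (gamma muy : R) :=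
  [/\ proper_closed_convex f, proper_closed_convex g & 0 < gamma] /\
  [/\ 0 < muy,
      (forall y, edom g y -> weakly_convex gamma (Phi^~ y) /\
                             exists c, forall x, c <= Phi x y),
      (forall x, edom f x -> strongly_concave muy (Phi x)) &
      exists O : set ('rV[R]_n * 'rV[R]_m),
        [/\ open O, edom f `*` edom g `<=` O &
            forall z, O z ->
              differentiable (fun z' : 'rV[R]_n * 'rV[R]_m => Phi z'.1 z'.2) z]].

Definition smoothness_assumption (Lxx Lxy Lyx Lyy : R) :=
  [/\ 0 <= Lxx, 0 <= Lyy, 0 < Lxy & 0 < Lyx] /\
  forall x x' y y', edom f x -> edom f x' -> edom g y -> edom g y' ->
    enorm (gradx x y - gradx x' y') <=
      Lxx * enorm (x - x') + Lxy * enorm (y - y') /\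
    enorm (grady x y - grady x' y') <=
      Lyx * enorm (x - x') + Lyy * enorm (y - y').

Section sapd.
Context {dS dO : measure_display}.
Context {S : measurableType dS} {Omega : measurableType dO}.
Variable P : probability Omega R.
Variables (oraclex : 'rV[R]_n -> 'rV[R]_m -> S -> 'rV[R]_n).
Variables (oracley : 'rV[R]_n -> 'rV[R]_m -> S -> 'rV[R]_m).
Variables (omegax omegay : nat -> Omega -> S).

Definition measurable_oracle :=
  [/\ measurable_fun [set: borel n * borel m * S]
        (fun z => oraclex z.1.1 z.1.2 z.2 : borel n),
      measurable_fun [set: borel n * borel m * S]
        (fun z => oracley z.1.1 z.1.2 z.2 : borel m),
      (forall k, measurable_fun setT (omegax k)) &
      (forall k, measurable_fun setT (omegay k))].

Section iterates.
Variables (gamma mux tau sigma theta : R).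
Variables (x0 : 'rV[R]_n) (y0 : 'rV[R]_m) (w : Omega).

(* the state (x_k, y_k, q_k) of the algorithm *)
Fixpoint sapd (k : nat) : 'rV[R]_n * 'rV[R]_m * 'rV[R]_m :=
  match k with
  | 0 => (x0, y0, 0)
  | k'.+1 =>
    let: (x, y, q) := sapd k' in
    let s := oracley x y (omegay k' w) + theta *: q in
    let y' := prox sigma g (y + sigma *: s) in
    let x' := prox tau f
      (x - tau *: (oraclex x y' (omegax k' w) + (mux + gamma) *: (x - x0))) in
    let q' := oracley x' y' (omegay k'.+1 w) - oracley x y (omegay k' w) in
    (x', y', q')
  end.

Definition sapd_x k := (sapd k).1.1.
Definition sapd_y k := (sapd k).1.2.

End iterates.

(* Each of the N steps leading to x_N evaluates oraclex once and oracley once: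
   the value at (x_k, y_k) enters s_k and is reused in q_k and q_(k+1). *)
Definition sapd_calls (N : nat) : nat := (2 * N)%N.

(* The starting point is deterministic; the bounds deltax and deltay do not
   depend on it, nor on the step sizes and the momentum parameter. *)
Definition noise_assumption (gamma : R) :=
  forall mux, 0 < mux -> exists deltax deltay : R,
  [/\ 0 <= deltax, 0 <= deltay &
  forall x0 y0 tau sigma theta, edom f x0 -> edom g y0 ->
    0 < tau -> 0 < sigma -> 0 <= theta ->
  forall k,
    let x j w := sapd_x gamma mux tau sigma theta x0 y0 w j in
    let y j w := sapd_y gamma mux tau sigma theta x0 y0 w j in
    let ox w := oraclex (x k w) (y k.+1 w) (omegax k w) in
    let oy w := oracley (x k w) (y k w) (omegay k w) in
    let gx w := gradx (x k w) (y k.+1 w) in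
    let gy w := grady (x k w) (y k w) in
    [/\ cond_exp_vec P (sigma2 (x k) (y k.+1)) ox gx,
        cond_exp_vec P (sigma2 (x k) (y k)) oy gy,
        cond_exp_le P (sigma2 (x k) (y k.+1))
          (fun w => enorm (ox w - gx w) ^+ 2) (deltax ^+ 2) &
        cond_exp_le P (sigma2 (x k) (y k))
          (fun w => enorm (oy w - gy w) ^+ 2) (deltay ^+ 2)]].

End sapd.

End minimax.

Section momentum.
Context {R : realType}.
Variables (gamma muy Lxx Lyx Lyy mux beta : R).

Definition Lxx' : R := Lxx + gamma + mux.

Definition theta_bar1 : R :=
  1 - beta * muy * Lxx' / (2 * Lyx ^+ 2) *
      (Num.sqrt (1 + 4 * Lyx ^+ 2 * mux / (beta * Lxx' ^+ 2 * muy)) - 1).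

Definition theta_bar2 : R :=
  if 0 < Lyy then
    1 - (1 - beta) ^+ 2 / 8 * (muy ^+ 2 / Lyy ^+ 2) *
        (Num.sqrt (1 + 16 * Lyy ^+ 2 / ((1 - beta) ^+ 2 * muy ^+ 2)) - 1)
  else 0.

Definition theta_bar : R := Num.max theta_bar1 theta_bar2.

End momentum.

(* Main.v *)
Require Import Defs.
From HB Require Import structures.
From mathcomp Require Import all_boot all_order all_algebra.
From mathcomp Require Import all_classical all_reals all_analysis.
From mathcomp Require Import measurable_realfun.
From mathcomp Require Import ring lra zify.

(* Take [mux = lambda^-1 - gamma], so that the regularised problem solved by
   SAPD has the saddle point [(xs, ys)] with [xs] the proximal point of [phi] at
   [xeps] and [ys] the maximiser at [xs].  The optimality condition for [xs] gives
   [enorm (Gmap xs) <= enorm (grad_moreau xeps)], and [Gmap] is Lipschitz on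
   [dom f], so it suffices to bring the last iterate within O(eps) of [xs] in
   mean.

   Put [theta = 1 - h] with [h] of order [eps ^+ 2].  One SAPD step contracts
   a weighted squared distance to the saddle point by [(1 + h)^-1], up to noise
   of order [h ^+ 2] in the same scaling, so [h^-1 * ln eps^-1] steps suffice.
   The noise of the momentum term is paired by Young's inequality with the
   differences of successive iterates, which the proximal inequalities control;
   the noise then enters only through its variance and its inner product with
   the current iterate, and the latter vanishes because the noise is centred
   given the current iterate.  No martingale structure is needed. *)

Set Implicit Arguments.
Unset Strict Implicit.
Unset Printing Implicit Defensive.

Import Order.TTheory GRing.Theory Num.Theory.
Import numFieldNormedType.Exports.

Local Open Scope classical_set_scope.
Local Open Scope ring_scope.

(** * Euclidean geometry *)

(** Two obstacles shape the proof. The start is random, and only first moments of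
    [enorm (grad_moreau xeps)] and of the distance from [y0] to [ystar xeps] are bounded, so a
    mean-square estimate, quadratic in the initial distances, cannot be integrated over the start.
    The square root is therefore taken for each fixed start: [2 * M] steps give the factor
    [(1 + h) ^- (2 * M)] on squared distances, hence [(1 + h) ^- M] on distances, and the resulting
    affine bound is integrated afterwards. The number of steps and the step sizes are the same for
    all starts. The other obstacle is regularity: gradients are controlled only on [dom f] times
    [dom g], and [phis] may have no two-sided derivative at the boundary of [dom f]. Optimality is
    therefore always stated as a variational inequality, obtained through Minty's lemma. The order
    of [h] comes from the noise floor: the mean-square distance stalls at order [h], the distance at
    order [sqrt h], and this must be of order [eps]. *)

Section dot.
Context {R : realType}.

Definition dot n (u v : 'rV[R]_n) : R := \sum_(i < n) u 0 i * v 0 i.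

Variable n : nat.
Implicit Types (u v w x y : 'rV[R]_n) (a c : R).

Lemma dotC u v : dot u v = dot v u.
Proof. by apply: eq_bigr => i _; rewrite mulrC. Qed.

Lemma dotDl u v w : dot (u + v) w = dot u w + dot v w.
Proof. by rewrite /dot -big_split; apply: eq_bigr => i _; rewrite mxE mulrDl. Qed.

Lemma dotZl a u v : dot (a *: u) v = a * dot u v.
Proof. by rewrite /dot big_distrr /=; apply: eq_bigr => i _; rewrite mxE mulrA. Qed.

Lemma dotNl u v : dot (- u) v = - dot u v.
Proof. by rewrite -scaleN1r dotZl mulN1r. Qed.

Lemma dotDr u v w : dot w (u + v) = dot w u + dot w v.
Proof. by rewrite !(dotC w) dotDl. Qed.

Lemma dotZr a u v : dot v (a *: u) = a * dot v u.
Proof. by rewrite !(dotC v) dotZl. Qed.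

Lemma dotNr u v : dot v (- u) = - dot v u.
Proof. by rewrite !(dotC v) dotNl. Qed.

Lemma dotr0 u : dot u 0 = 0.
Proof. by rewrite -(scale0r 0) dotZr mul0r. Qed.

Definition dotE := (dotDl, dotDr, dotNl, dotNr, dotZl, dotZr).

Lemma dot_ge0 u : 0 <= dot u u.
Proof. by apply: sumr_ge0 => i _; rewrite -expr2 sqr_ge0. Qed.

Lemma enorm_sqr u : enorm u ^+ 2 = dot u u.
Proof.
rewrite /enorm sqr_sqrtr; first by apply: eq_bigr => i _; rewrite expr2.
by apply: sumr_ge0 => i _; exact: sqr_ge0.
Qed.

Lemma enorm_ge0 u : 0 <= enorm u. Proof. exact: sqrtr_ge0. Qed.

Lemma dot_eq0 u : dot u u = 0 -> u = 0.
Proof.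
move/eqP; rewrite psumr_eq0 => [/allP u0|i _]; last by rewrite -expr2 sqr_ge0.
apply/rowP => i; rewrite mxE; apply/eqP.
by move: (u0 i (mem_index_enum i)); rewrite /= mulf_eq0 orbb.
Qed.

Lemma enorm_eq0 u : enorm u = 0 -> u = 0.
Proof. by move=> u0; apply: dot_eq0; rewrite -enorm_sqr u0 expr0n. Qed.

Lemma dot_le_enorm u v : dot u v <= enorm u * enorm v.
Proof.
have [->|v0] := eqVneq v 0.
  rewrite dotr0.
  by rewrite mulr_ge0 ?enorm_ge0.
apply: le_trans (ler_norm _) _.
rewrite -ler_sqr ?nnegrE ?mulr_ge0 ?enorm_ge0 //.
rewrite real_normK ?num_real // exprMn !enorm_sqr.
have vv : 0 < dot v v.
  by rewrite lt_neqAle dot_ge0 andbT eq_sym; apply: contraNneq v0 => /dot_eq0 ->.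
have := dot_ge0 (dot v v *: u - dot u v *: v).
rewrite !dotE (dotC v u) => H.
have : 0 <= dot v v * (dot u u * dot v v - dot u v ^+ 2) by lra.
by rewrite pmulr_rge0 // subr_ge0.
Qed.

Lemma enormD u v : enorm (u + v) <= enorm u + enorm v.
Proof.
rewrite -ler_sqr ?nnegrE ?addr_ge0 ?enorm_ge0 //.
rewrite sqrrD !enorm_sqr !dotE (dotC v u).
by have := dot_le_enorm u v; lra.
Qed.

Lemma enormZ a u : enorm (a *: u) = `|a| * enorm u.
Proof.
apply/eqP; rewrite -(@eqrXn2 _ 2) ?enorm_ge0 ?mulr_ge0 ?enorm_ge0 //.
by rewrite exprMn !enorm_sqr !dotE real_normK ?num_real // expr2 mulrA.
Qed.

Lemma enormN u : enorm (- u) = enorm u.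
Proof. by rewrite -scaleN1r enormZ normrN1 mul1r. Qed.

Lemma enormB u v : enorm (u - v) = enorm (v - u).
Proof. by rewrite -enormN opprB. Qed.

Lemma enorm0 : enorm (0 : 'rV[R]_n) = 0.
Proof. by rewrite -(scale0r (0 : 'rV[R]_n)) enormZ normr0 mul0r. Qed.

Lemma enormD3 w u v : enorm (u - v) <= enorm (u - w) + enorm (w - v).
Proof. have -> : u - v = (u - w) + (w - v) by rewrite addrA subrK.
exact: enormD. Qed.

Lemma dot_young c u v : 0 < c -> 2 * dot u v <= c * dot u u + c^-1 * dot v v.
Proof.
move=> c0; have := dot_ge0 (c *: u - v); rewrite !dotE (dotC v u) => H.
have : 0 <= c * (c * dot u u + c^-1 * dot v v - 2 * dot u v).
  have cc : c * c^-1 = 1 by rewrite mulfV // gt_eqF.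
  rewrite !mulrDr mulrA -mulrN [c * (c^-1 * _)]mulrA cc; lra.
by rewrite pmulr_rge0 // subr_ge0.
Qed.

Lemma enormD_sqr u v : dot (u + v) (u + v) <= 2 * dot u u + 2 * dot v v.
Proof. by have := dot_ge0 (u - v); rewrite !dotE (dotC v u); lra. Qed.

Lemma coord_le_enorm u i : `|u 0 i| <= enorm u.
Proof.
rewrite -ler_sqr ?nnegrE ?enorm_ge0 // enorm_sqr real_normK ?num_real //.
rewrite /dot (bigD1 i) //= -expr2 lerDl; apply: sumr_ge0 => j _.
by rewrite -expr2 sqr_ge0.
Qed.

Lemma norm_le_enorm u : `|u| <= enorm u.
Proof.
rewrite /Num.norm /= mx_normrE; apply: bigmax_le => [|[i j] _ /=]; first exact: enorm_ge0.
by rewrite ord1 coord_le_enorm.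
Qed.

Lemma coord_le_norm u i : `|u 0 i| <= `|u|.
Proof.
by rewrite [leRHS]/Num.norm /= mx_normrE; apply/bigmax_geP; right => /=; exists (0, i).
Qed.

Lemma enorm_le_norm u : enorm u <= n.+1%:R * `|u|.
Proof.
rewrite -ler_sqr ?nnegrE ?enorm_ge0 ?mulr_ge0 // enorm_sqr exprMn /dot.
apply: (@le_trans _ _ (\sum_(i < n) `|u| ^+ 2)).
  apply: ler_sum => i _; rewrite -expr2 -[leLHS]real_normK ?num_real //.
  by rewrite ler_sqr ?nnegrE // coord_le_norm.
rewrite sumr_const card_ord -[leLHS]mulr_natl ler_wpM2r ?sqr_ge0 // -natrX ler_nat.
by rewrite -mulnn; lia.
Qed.

End dot.

(** * Limits along small positive step lengths *)

Section real_lemmas.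
Context {R : realType}.

(** Replaces the limit [t -> 0] in the first-order optimality arguments. If [B < A], a [t] with
    [C * t] at most half the gap is a contradiction. *)
Lemma le_of_linear_error (A B C r : R) : 0 < r ->
  (forall t, 0 < t <= r -> A <= B + C * t) -> A <= B.
Proof.
move=> r0 H; rewrite leNgt; apply/negP => BA.
have D0 : 0 < A - B by rewrite subr_gt0.
have C0 : 0 < 2 * (`|C| + 1) by rewrite mulr_gt0 // ltr_wpDl.
pose t := Num.min r ((A - B) / (2 * (`|C| + 1))).
have t0 : 0 < t by rewrite lt_min r0 divr_gt0.
have tr : t <= r by rewrite ge_min lexx.
have := H t; rewrite t0 tr => /(_ isT).
have t2 : t * (2 * (`|C| + 1)) <= A - B by rewrite -ler_pdivlMr // ge_min lexx orbT.
have : C * t <= `|C| * t by rewrite ler_wpM2r ?ler_norm // ltW.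
lra.
Qed.

(** Derivatives are limits over punctured neighbourhoods, while convexity gives information for
    positive step lengths only. *)
Lemma cvg_dnbhs_right (F : R -> R) (l e : R) :
  F h @[h --> 0^'] --> l -> 0 < e ->
  exists2 d, 0 < d & forall h, 0 < h < d -> `|l - F h| < e.
Proof.
move=> /cvgrPdist_lt Fl e0; have := Fl _ e0.
rewrite near_withinE => -[d /= d0 dF]; exists d => // h /andP[h0 hd].
by apply: dF; [rewrite /ball_ /= sub0r normrN gtr0_norm|rewrite gt_eqF].
Qed.

End real_lemmas.

(** * Weakly convex functions *)

Section first_order.
Context {R : realType} {n : nat}.
Implicit Types (u : 'rV[R]_n -> R) (x y v : 'rV[R]_n).

(** Interpolation form of the convexity of [u] plus [c / 2] times the squared norm: the convexity
    gap of the squared norm is exactly [t * (1 - t) * dot (x - y) (x - y)]. A negative [c] encodes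
    strong convexity, so minus a strongly concave function is covered too. *)
Definition wcvx (c : R) u := forall t x y, 0 <= t <= 1 ->
  u (t *: x + (1 - t) *: y) <=
  t * u x + (1 - t) * u y + c / 2 * (t * (1 - t)) * dot (x - y) (x - y).

Lemma convex_functionP u (t : R) x y : convex_function setT u -> 0 <= t <= 1 ->
  u (t *: x + (1 - t) *: y) <= t * u x + (1 - t) * u y.
Proof.
move=> cu /andP[t0 t1]; have := cu (Itv01 t0 t1) x y.
by rewrite !inE => /(_ Logic.I Logic.I); exact.
Qed.

Lemma wcvx_convex c u :
  convex_function setT (fun x => u x + c / 2 * enorm x ^+ 2) -> wcvx c u.
Proof.
move=> cu t x y t01; have := convex_functionP x y cu t01.
rewrite !enorm_sqr !dotE (dotC y x) => H.
have : u (t *: x + (1 - t) *: y) <= t * u x + (1 - t) * u y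
 + (c / 2) * (t * dot x x + (1 - t) * dot y y -
    (t * (t * dot x x) + t * ((1 - t) * dot x y) +
     ((1 - t) * (t * dot x y) + (1 - t) * ((1 - t) * dot y y)))).
  lra.
move=> /le_trans; apply; rewrite le_eqVlt; apply/orP; left; apply/eqP; ring.
Qed.

Lemma weakly_convex_wcvx c u : weakly_convex c u -> wcvx c u.
Proof. exact: wcvx_convex. Qed.

Lemma strongly_concave_wcvx c u :
  strongly_concave c u -> wcvx (- c) (fun x => - u x).
Proof.
move=> cu; apply: wcvx_convex; move: cu; rewrite /strongly_concave.
by under eq_fun do rewrite opprD -mulNr -mulNr.
Qed.

Lemma derive_grad u x v : differentiable u x -> 'D_v u x = dot (grad u x) v.
Proof.
move=> du; rewrite deriveE // {1}[v]row_sum_delta linear_sum /=.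
apply: eq_bigr => i _; rewrite linearZ /= mxE deriveE //.
by rewrite mulrC.
Qed.

Lemma grad_opp u x : differentiable u x -> grad (fun z => - u z) x = - grad u x.
Proof.
move=> du; apply/rowP => i; rewrite !mxE.
by apply: deriveN; exact: diff_derivable.
Qed.

(** Weak convexity bounds the difference quotient from [x] towards [y] by
    [u y - u x + c / 2 * (1 - t) * d]; then [t] tends to zero. *)
Lemma wcvx_first_order c u x y : wcvx c u -> differentiable u x ->
  u x + dot (grad u x) (y - x) - c / 2 * dot (y - x) (y - x) <= u y.
Proof.
move=> cu du; set d := dot (y - x) (y - x).
suff : dot (grad u x) (y - x) <= u y - u x + c / 2 * d by lra.
rewrite -derive_grad //; apply/ler_addgt0Pr => e e0.
have [_/posnumP[r] rF] : exists2 r, 0 < r & forall h, 0 < h < r ->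
    `|'D_(y - x) u x - h^-1 * (u (h *: (y - x) + x) - u x)| < e.
  exact: cvg_dnbhs_right (diff_derivable (v := y - x) du) e0.
apply: (@le_of_linear_error _ _ _ (- (c / 2 * d)) (Num.min (r%:num / 2) 1)).
  by rewrite lt_min ltr01 andbT.
move=> t /andP[t0]; rewrite le_min => /andP[tr t1].
have tr' : 0 < t < r%:num.
  by rewrite t0 (le_lt_trans tr) // gtr_pMr // invf_lt1 // ltr1n.
have := rF t tr'; rewrite ltr_norml => /andP[_].
move=> H.
have t01 : 0 <= t <= 1 by rewrite ltW.
have := cu t y x t01; rewrite -/d.
have -> : t *: y + (1 - t) *: x = t *: (y - x) + x.
  by rewrite scalerBr scalerBl scale1r addrA -addrA [x - _]addrC addrA.
move=> H2.
have : t^-1 * (u (t *: (y - x) + x) - u x) <= u y - u x + c / 2 * (1 - t) * d.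
  by rewrite ler_pdivrMl //; lra.
lra.
Qed.

End first_order.

(** * Closed convex functions and proximal maps *)

Section lsc_min.
Context {T : ptopologicalType} {R : realType}.
Implicit Types (K : set T) (F : T -> \bar R).

Lemma seq_argmin F (x0 : T) (s : seq T) : x0 \in s ->
  exists2 p, p \in s & forall x, x \in s -> (F p <= F x)%E.
Proof.
elim: s x0 => // y [|z s] IH x0 _.
  by exists y; rewrite ?mem_seq1 // => x; rewrite mem_seq1 => /eqP ->.
have [|p ps pmin] := IH z; first by rewrite mem_head.
have [Fpy|/ltW Fyp] := leP (F p) (F y).
  exists p; first by rewrite inE ps orbT.
  by move=> x; rewrite inE => /orP[/eqP ->|/pmin].
exists y; first by rewrite mem_head.
move=> x; rewrite inE => /orP[/eqP -> //|/pmin].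
exact: le_trans.
Qed.

Lemma lsc_open_gt F (e : \bar R) : lower_semicontinuous F ->
  (forall x, (-oo < F x)%E) -> open [set x | (e < F x)%E].
Proof.
move=> lF F_gt; case: e => [a| |].
- by move/lower_semicontinuousP: lF; exact.
- rewrite (_ : [set _ | _] = set0); first exact: open0.
  by rewrite -subset0 => x /=; rewrite ltNge leey.
- rewrite (_ : [set _ | _] = setT); first exact: openT.
  by rewrite -subTset => x _ /=.
Qed.

(** Without a minimiser, the open sets where [F] exceeds [F y], for [y] in [K], cover [K]. Among the
    finitely many [y] of a subcover, one with the smallest value is itself left uncovered. *)
Lemma lsc_compact_min K F : compact K -> K !=set0 ->
  lower_semicontinuous F -> (forall x, (-oo < F x)%E) ->
  exists2 p, K p & forall x, K x -> (F p <= F x)%E.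
Proof.
move=> cK [k0 Kk0] lF F_gt; apply: contrapT => nomin.
have cov y : K y -> exists2 x, K x & (F x < F y)%E.
  move=> Ky; apply: contrapT => H; apply: nomin; exists y => // x Kx.
  by rewrite leNgt; apply/negP => xy; apply: H; exists x.
move: cK; rewrite compact_cover => /(_ T K (fun y => [set x | (F y < F x)%E])).
case=> [y _|y /cov[x Kx xy]|D' sD' cD']; first exact: lsc_open_gt.
  by exists x.
have [y0 y0D _] := cD' _ Kk0.
have [p pD pmin] := seq_argmin F y0D.
have Kp : K p by have := sD' _ pD; rewrite inE.
have [y /= yD] := cD' _ Kp.
by rewrite ltNge pmin.
Qed.

End lsc_min.

Section closed_convex.
Context {R : realType} {n : nat}.
Implicit Types (h : 'rV[R]_n -> \bar R) (u q : 'rV[R]_n -> R).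
Implicit Types (x y w p : 'rV[R]_n).

Lemma edom_fineK h x : Defs.proper h -> edom h x -> h x = (fine (h x))%:E.
Proof.
by move=> [h_gt _] hx; rewrite fineK // fin_numElt h_gt hx.
Qed.

Lemma edom_fin h x (a : R) : h x = a%:E -> edom h x.
Proof. by rewrite /edom /= => ->; rewrite ltry. Qed.

Lemma not_edom h x : ~ edom h x -> h x = +oo%E.
Proof. by move=> /negP; rewrite -leNgt leye_eq => /eqP. Qed.

Lemma econvex_fine h (t : R) x y : Defs.proper h -> econvex h -> 0 <= t <= 1 ->
  edom h x -> edom h y ->
  edom h (t *: x + (1 - t) *: y) /\
  fine (h (t *: x + (1 - t) *: y)) <= t * fine (h x) + (1 - t) * fine (h y).
Proof.
move=> ph ch /andP[t0 t1] hx hy.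
have : (h (t *: x + (1 - t) *: y)%R <= t%:E * h x + (1 - t)%:E * h y)%E.
  exact: (ch (Itv01 t0 t1) x y).
rewrite {1}(edom_fineK ph hx) {1}(edom_fineK ph hy) -!EFinM -EFinD => H.
have D : edom h (t *: x + (1 - t) *: y) by rewrite /edom /= (le_lt_trans H) // ltry.
by split => //; move: H; rewrite (edom_fineK ph D) lee_fin.
Qed.

(** Reduces convexity to points of the domain. The endpoints [t = 0] and [t = 1] are separated out
    because the product of [0] and [+oo] is [0]; for other [t] a point off the domain makes the
    right-hand side [+oo]. *)
Lemma fine_econvex h : (forall x, (-oo < h x)%E) ->
  (forall (t : R) x y, 0 <= t <= 1 -> edom h x -> edom h y ->
     (h (t *: x + (1 - t) *: y)%R <= (t * fine (h x) + (1 - t) * fine (h y))%:E)%E) ->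
  econvex h.
Proof.
move=> h_gt H t x y.
have xtyE : conv t x y = (t%:num *: x + (1 - t%:num) *: y : 'rV[R]_n) by [].
rewrite xtyE; have t01 : 0 <= t%:num <= 1 by rewrite ge0 le1.
move: (t%:num) t01 => {t xtyE} t t01; have /andP[t0 t1] := t01.
have fin z : edom h z -> h z = (fine (h z))%:E.
  by move=> hz; rewrite fineK // fin_numElt h_gt hz.
have [->|tn0] := eqVneq t 0.
  by rewrite !subr0 mul0e add0e mul1e scale0r add0r scale1r.
have [->|tn1] := eqVneq t 1.
  by rewrite !subrr mul0e adde0 mul1e scale0r addr0 scale1r.
have tp : (0 < t%:E)%E by rewrite lte_fin lt_neqAle eq_sym tn0.
have tq : (0 < (1 - t)%:E)%E by rewrite lte_fin subr_gt0 lt_neqAle tn1.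
have gtM (s : R) z : (0 < s%:E)%E -> (s%:E * h z != -oo)%E.
  move=> s0; have := h_gt z; case: (h z) => [r| |] // _.
  by rewrite gt0_muley.
have [hx|/not_edom hx] := pselect (edom h x); last first.
  by rewrite hx gt0_muley // addye ?leey // gtM.
have [hy|/not_edom hy] := pselect (edom h y); last first.
  by rewrite hy gt0_muley // addey ?leey // gtM.
rewrite (fin _ hx) (fin _ hy) -!EFinM -EFinD; exact: H.
Qed.

(** Off the domain [h] is [+oo], so there a local lower bound on [q] replaces continuity. This form
    suits [Phi], whose differentiability is assumed only near [dom f] times [dom g]. *)
Lemma lsc_add h q : lower_semicontinuous h -> (forall x, (-oo < h x)%E) ->
  (forall x, edom h x -> {for x, continuous q}) ->
  (forall x, exists c : R, \forall y \near x, c <= q y) ->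
  lower_semicontinuous (fun x => h x + (q x)%:E)%E.
Proof.
move=> lh h_gt qc qb x a axq.
suff [b [c [bhx ac qc']]] : exists b c : R,
    [/\ (b%:E < h x)%E, a <= b + c & \forall y \near x, c <= q y].
  have [V xV Vh] := lh x b bhx.
  exists (V `&` [set y | c <= q y]); first exact: filterI.
  move=> y [/Vh by_ /= cy]; rewrite (@le_lt_trans _ _ (b + c)%:E) ?lee_fin //.
  by rewrite EFinD lte_leD ?lee_fin.
have [hx|/not_edom hx] := pselect (edom h x); last first.
  have [c cq] := qb x; exists (a - c), c; split=> //.
    by rewrite hx ltry.
  by rewrite subrK.
have hxE : h x = (fine (h x))%:E by rewrite fineK // fin_numElt h_gt hx.
move: axq; rewrite hxE -EFinD lte_fin; set r := fine (h x) => axq.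
pose e := (r + q x - a) / 2.
exists (r - e), (q x - e); split; rewrite /e ?lte_fin; [lra|lra|].
have /cvgrPdist_lt /(_ e) := qc x hx.
rewrite divr_gt0 ?subr_gt0 // => /(_ isT); apply: filterS => y.
by rewrite ltr_norml /e => /andP[]; lra.
Qed.

Lemma ball_enorm x (e : R) : 0 < e -> \forall y \near x, enorm (x - y) < e.
Proof.
move=> e0; have e1 : 0 < n.+1%:R^-1 * e by rewrite mulr_gt0 // invr_gt0 ltr0n.
apply: (@filterS _ (nbhs x) (nbhs_filter x) _ _ _ (nbhsx_ballx x _ e1)) => y; rewrite -ball_normE /= => xy.
apply: le_lt_trans (enorm_le_norm _) _.
by rewrite -ltr_pdivlMl ?ltr0n.
Qed.

Lemma continuous_dist p : continuous (fun w => enorm (w - p)).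
Proof.
move=> x; apply/(cvgrPdist_lt (FF := nbhs_filter x)) => e e0.
apply: (@filterS _ (nbhs x) (nbhs_filter x) _ _ _ (ball_enorm x e0)) => y.
apply: le_lt_trans; rewrite ler_norml; apply/andP; split.
  by have := enormD3 x y p; rewrite (enormB y x); lra.
by have := enormD3 y x p; lra.
Qed.

Lemma compact_eball (p : 'rV[R]_n) (r : R) : compact [set w | enorm (w - p) <= r].
Proof.
apply: bounded_closed_compact.
  exists (`|p| + r); split; first exact: num_real.
  move=> M Mr w /= wp; apply: (le_trans _ (ltW Mr)).
  have -> : w = p + (w - p) by rewrite addrC subrK.
  apply: le_trans (ler_normD _ _) _; rewrite lerD2l.
  exact: le_trans (norm_le_enorm _) wp.
rewrite (_ : [set _ | _] = (fun w => enorm (w - p)) @^-1` [set z | z <= r]) //.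
by apply: preimage_closed; [move=> w _; exact: continuous_dist|exact: closed_le].
Qed.

Lemma continuous_sqdist (c : R) x : continuous (fun w => c * enorm (w - x) ^+ 2).
Proof.
move=> w; apply: (@cvgMr _ _ (nbhs w) (nbhs_filter w)).
under eq_fun do rewrite expr2.
rewrite expr2.
by apply: (@cvgM _ _ (nbhs w) (nbhs_filter w)); exact: continuous_dist.
Qed.

(* Convexity propagates the minimum of [h] on a unit ball to a lower bound of
   linear growth. *)
Lemma pcc_linear_lb h p : proper_closed_convex h -> edom h p ->
  exists2 A : R, 0 <= A & forall w, edom h w ->
    fine (h p) - A * (1 + enorm (w - p)) <= fine (h w).
Proof.
move=> [ph lh ch] hp.
have [q /= qB qmin] : exists2 q, enorm (q - p) <= 1 &
    forall w, enorm (w - p) <= 1 -> (h q <= h w)%E.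
  have := @lsc_compact_min _ _ _ h (@compact_eball p 1).
  apply => //; last by case: ph.
  by exists p => /=; rewrite subrr enorm0.
have hq : edom h q.
  by rewrite /edom /= (le_lt_trans _ hp) // qmin // subrr enorm0.
have qmin' w : edom h w -> enorm (w - p) <= 1 -> fine (h q) <= fine (h w).
  by move=> hw /qmin; rewrite (edom_fineK ph hq) (edom_fineK ph hw) lee_fin.
have qp : fine (h q) <= fine (h p) by apply: qmin'; rewrite ?subrr ?enorm0.
exists (fine (h p) - fine (h q)); first by rewrite subr_ge0.
move=> w hw; set r := enorm (w - p).
have r0 : 0 <= r by exact: enorm_ge0.
have A0 : 0 <= fine (h p) - fine (h q) by rewrite subr_ge0.
have [r1|r1] := leP r 1.
  have := qmin' w hw r1; have := mulr_ge0 A0 r0; lra.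
have ri : 0 < r by exact: lt_trans r1.
have t01 : 0 <= r^-1 <= 1 by rewrite invr_ge0 r0 invf_le1 // ltW.
have [D] := econvex_fine ph ch t01 hw hp.
have E : r^-1 *: w + (1 - r^-1) *: p - p = r^-1 *: (w - p).
  by rewrite scalerBl scale1r scalerBr addrCA addrAC subrr add0r addrC.
have := qmin' _ D; rewrite E enormZ ger0_norm ?invr_ge0 // mulVf ?gt_eqF // lexx.
move=> /(_ isT) /le_trans /[apply].
rewrite -(ler_pM2l ri) => H.
have : r * (r^-1 * fine (h w) + (1 - r^-1) * fine (h p)) =
  fine (h w) + (r - 1) * fine (h p).
  by rewrite mulrDr !mulrA mulfV ?gt_eqF // mul1r mulrBr mulr1 mulfV ?gt_eqF.
lra.
Qed.

End closed_convex.

(** * Existence, characterisation and nonexpansiveness of proximal points *)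

Section prox_theory.
Context {R : realType} {n : nat}.
Variables (h : 'rV[R]_n -> \bar R) (lambda : R).
Hypotheses (hh : proper_closed_convex h) (l0 : 0 < lambda).
Implicit Types (x y w p : 'rV[R]_n).

Let ph : Defs.proper h. Proof. by case: hh. Qed.
Let ch : econvex h. Proof. by case: hh. Qed.
Let c := (2 * lambda)^-1.
Let c0 : 0 < c. Proof. by rewrite invr_gt0 mulr_gt0. Qed.

Lemma prox_obj_fine x w : edom h w ->
  prox_obj lambda h x w = (fine (h w) + c * enorm (w - x) ^+ 2)%:E.
Proof. by move=> hw; rewrite /prox_obj {1}(edom_fineK ph hw) EFinD. Qed.

Lemma prox_obj_gt x w : (-oo < prox_obj lambda h x w)%E.
Proof.
rewrite /prox_obj; case: ph => /(_ w) + _.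
by case: (h w) => // r _; rewrite -EFinD ltNyr.
Qed.

(** [h] may be unbounded below, but at most linearly, so the quadratic term makes the objective
    coercive and a minimum over a large ball is global. *)
Lemma prox_exists x :
  exists p, forall v, (prox_obj lambda h x p <= prox_obj lambda h x v)%E.
Proof.
have [p0 hp0] := ph.2.
have [A A0 lb] := pcc_linear_lb hh hp0.
pose d := enorm (p0 - x).
have d0 : 0 <= d by exact: enorm_ge0.
(* Beyond this radius [c * (r - d) ^+ 2 - A * (1 + r)] is at least [c * d ^+ 2], so [p0] already
   does better. *)
pose r0 := 1 + (2 * c * d + 2 * A) / c.
have r0_ge1 : 1 <= r0.
  by rewrite lerDl divr_ge0 ?addr_ge0 ?mulr_ge0 // ltW.
have [p pB pmin] : exists2 p, enorm (p - p0) <= r0 &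
    forall w, enorm (w - p0) <= r0 ->
      (prox_obj lambda h x p <= prox_obj lambda h x w)%E.
  apply: lsc_compact_min (@compact_eball _ _ p0 r0) _ _ (prox_obj_gt x).
    by exists p0 => /=; rewrite subrr enorm0 (le_trans ler01).
  apply: lsc_add; [by case: hh|by case: ph| |].
    by move=> w _; exact: continuous_sqdist.
  move=> w; exists 0; near=> y; by rewrite mulr_ge0 ?sqr_ge0 // ltW.
exists p => v; have [vB|vB] := leP (enorm (v - p0)) r0; first exact: pmin.
apply: le_trans (pmin p0 _) _; first by rewrite subrr enorm0 (le_trans ler01).
have [hv|/not_edom hv] := pselect (edom h v); last first.
  by rewrite [in leRHS]/prox_obj hv addye // leey.
rewrite !prox_obj_fine // lee_fin -/d.
set r := enorm (v - p0) in vB.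
have := lb v hv; rewrite -/r => lbv.
have dv : r - d <= enorm (v - x).
  by have := enormD3 x v p0; rewrite (enormB x p0) -/d -/r; lra.
have dr : r * c > c + 2 * c * d + 2 * A.
  by move: vB; rewrite /r0 -(ltr_pM2r c0) mulrDl mul1r mulfVK ?gt_eqF // addrA.
have r1 : 1 < r by exact: le_lt_trans vB.
have rd : 0 <= r - d.
  have : 0 <= (r - d) * c by have := mulr_ge0 d0 (ltW c0); have := c0; lra.
  by rewrite pmulr_lge0.
have : c * (r - d) ^+ 2 <= c * enorm (v - x) ^+ 2.
  by rewrite ler_pM2l // ler_sqr ?nnegrE ?enorm_ge0.
have : A <= A * r by rewrite ler_peMr // ltW.
have : 0 <= c * r by rewrite mulr_ge0 // ltW // (lt_trans ltr01).
have : (c + 2 * c * d + 2 * A) * r <= r * c * r.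
  by rewrite ler_pM2r ?(lt_trans ltr01) // ltW.
lra.
Unshelve. all: by end_near. Qed.

Lemma prox_min x v :
  (prox_obj lambda h x (prox lambda h x) <= prox_obj lambda h x v)%E.
Proof.
rewrite /prox; case: xgetP => [p _ /(_ v) //|H].
by have [p pm] := prox_exists x; have /= := H p.
Qed.

Lemma prox_edom x : edom h (prox lambda h x).
Proof.
have [p0 hp0] := ph.2; have := prox_min x p0.
rewrite [leRHS]prox_obj_fine // => H.
apply: contrapT => /not_edom hp; move: H.
by rewrite /prox_obj hp addye.
Qed.

(** The minimiser is compared with [p + t * (w - p)]; convexity allows division by [t], and [t]
    tends to zero. *)
Lemma argmin_vi x p w : edom h p -> edom h w ->
  (forall v, (prox_obj lambda h x p <= prox_obj lambda h x v)%E) ->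
  fine (h p) <= fine (h w) + lambda^-1 * dot (p - x) (w - p).
Proof.
move=> hp hw pmin.
apply: (@le_of_linear_error _ _ _ (c * dot (w - p) (w - p)) 1) => //.
move=> t /andP[t0 t1]; have t01 : 0 <= t <= 1 by rewrite ltW.
have [D H] := econvex_fine ph ch t01 hw hp.
have := pmin (t *: w + (1 - t) *: p).
rewrite !prox_obj_fine // lee_fin !enorm_sqr.
have -> : t *: w + (1 - t) *: p - x = (p - x) + t *: (w - p).
  by apply/rowP => i; rewrite !mxE; ring.
move: (p - x) (w - p) => q d; rewrite !dotE (dotC d q) => H2.
have cE : lambda^-1 = 2 * c by rewrite /c invfM mulrA mulfV ?mul1r // pnatr_eq0.
rewrite cE -(ler_pM2l t0); lra.
Qed.

Lemma prox_vi x w : edom h w ->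
  fine (h (prox lambda h x)) <= fine (h w) +
    lambda^-1 * dot (prox lambda h x - x) (w - prox lambda h x).
Proof. by move=> hw; apply: argmin_vi => //; [exact: prox_edom|exact: prox_min]. Qed.

(** Adding the two inequalities cancels the values of [h]; Cauchy-Schwarz finishes. Stating it for
    arbitrary points obeying the inequalities yields both nonexpansiveness and uniqueness. *)
Lemma vi_prox_nonexpansive x1 x2 p1 p2 :
  fine (h p1) <= fine (h p2) + lambda^-1 * dot (p1 - x1) (p2 - p1) ->
  fine (h p2) <= fine (h p1) + lambda^-1 * dot (p2 - x2) (p1 - p2) ->
  enorm (p1 - p2) <= enorm (x1 - x2).
Proof.
move=> H1 H2.
have H : 0 <= lambda^-1 * (dot (x1 - x2) (p1 - p2) - dot (p1 - p2) (p1 - p2)).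
  by move: H1 H2; rewrite !dotE (dotC p2 p1); lra.
have {}H : dot (p1 - p2) (p1 - p2) <= dot (x1 - x2) (p1 - p2).
  by move: H; rewrite pmulr_rge0 ?invr_gt0 // subr_ge0.
have := le_trans H (dot_le_enorm _ _).
rewrite -enorm_sqr expr2 => {}H.
have [->|p0] := eqVneq (enorm (p1 - p2)) 0; first exact: enorm_ge0.
by move: H; rewrite ler_pM2r // lt_neqAle eq_sym p0 enorm_ge0.
Qed.

(** [p] and the chosen minimiser obey inequalities with the same centre, so their distance is at
    most zero. *)
Lemma vi_prox x p : edom h p ->
  (forall w, edom h w ->
    fine (h p) <= fine (h w) + lambda^-1 * dot (p - x) (w - p)) ->
  prox lambda h x = p.
Proof.
move=> hp pvi; have := vi_prox_nonexpansive (pvi _ (prox_edom x)) (prox_vi x hp).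
rewrite subrr enorm0 => H; apply/esym/eqP; rewrite -subr_eq0.
by apply/eqP/enorm_eq0/eqP; rewrite eq_le H enorm_ge0.
Qed.

Lemma prox_nonexpansive x1 x2 :
  enorm (prox lambda h x1 - prox lambda h x2) <= enorm (x1 - x2).
Proof. by apply: vi_prox_nonexpansive; apply: prox_vi; exact: prox_edom. Qed.

End prox_theory.

Section pcc_add.
Context {R : realType} {n : nat}.
Variables (h : 'rV[R]_n -> \bar R) (u : 'rV[R]_n -> R) (c : R).
Hypotheses (hh : proper_closed_convex h) (cu : wcvx c u).
Hypothesis du : forall x, edom h x -> differentiable u x.

(** Lower semicontinuity on the domain comes from continuity of [u] there. Elsewhere the gradient
    inequality at one domain point [p] gives an affine minorant of [u] plus the quadratic, which is
    locally bounded below. *)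
Lemma proper_closed_convex_add :
  proper_closed_convex (fun x => h x + (u x + c / 2 * enorm x ^+ 2)%:E)%E.
Proof.
have [ph lh ch] := hh.
have domE x : edom (fun x => h x + (u x + c / 2 * enorm x ^+ 2)%:E)%E x <-> edom h x.
  rewrite /edom /=; split; last by move=> hx; rewrite (edom_fineK ph hx) -EFinD ltry.
  by case: (h x) => [r _||_]; rewrite ?ltry ?ltNyr ?addye ?ltxx.
have gt x : (-oo < h x + (u x + c / 2 * enorm x ^+ 2)%:E)%E.
  by have := ph.1 x; case: (h x) => // r _; rewrite -EFinD ltNyr.
split.
- by split => //; have [p hp] := ph.2; exists p; apply/domE.
- apply: lsc_add => //; first by case: ph.
    move=> x hx; have cs : {for x, continuous (fun w => c / 2 * enorm w ^+ 2)}.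
      rewrite (_ : (fun w => _) = fun w => c / 2 * enorm (w - 0) ^+ 2).
        exact: continuous_sqdist.
      by apply/funext => w; rewrite subr0.
    by have := differentiable_continuous (du hx) => cu'; have := @cvgD _ _ _ _ _ u _ _ _ cu' cs; apply.
  move=> x; have [p hp] := ph.2.
  pose G := enorm (grad u p + c *: p).
  exists (u p + c / 2 * enorm p ^+ 2 - G * (1 + enorm (x - p))).
  apply: (@filterS _ (nbhs x) (nbhs_filter x) _ _ _ (ball_enorm x ltr01)) => y xy.
  have := wcvx_first_order y cu (du hp).
  have : - dot (grad u p + c *: p) (y - p) <= G * (1 + enorm (x - p)).
    rewrite -dotNr; apply: le_trans (dot_le_enorm _ _) _; rewrite enormN.
    apply: ler_wpM2l; first exact: enorm_ge0.
    by have := enormD3 x y p; rewrite (enormB y x); lra.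
  by rewrite !enorm_sqr !dotE (dotC y p); lra.
- apply: fine_econvex => // t x y t01 /domE hx /domE hy.
  have [D H] := econvex_fine ph ch t01 hx hy.
  rewrite (edom_fineK ph D) (edom_fineK ph hx) (edom_fineK ph hy) -!EFinD /=.
  rewrite lee_fin.
  have := cu x y t01; rewrite !enorm_sqr !dotE (dotC y x); lra.
Qed.

End pcc_add.

Section minty.
Context {R : realType} {n : nat}.

(** Meant for the Moreau envelope, whose smoothness is not assumed but follows from two-sided
    quadratic estimates. *)
Lemma derive_of_quadratic_error (F : 'rV[R]_n -> R) (a v : 'rV[R]_n) (l C : R) :
  (forall s : R, `|F (s *: v + a) - F a - s * l| <= C * s ^+ 2) -> 'D_v F a = l.
Proof.
move=> H; apply: cvg_lim => //.
apply/cvgrPdist_le => e e0.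
near=> s.
have s0 : s != 0 by near: s; exact: nbhs_dnbhs_neq.
rewrite /= /GRing.scale /= distrC.
have -> : s^-1 * (F (s *: v + a) - F a) - l = s^-1 * (F (s *: v + a) - F a - s * l).
  by rewrite [RHS]mulrBr mulrA mulVf // mul1r.
rewrite normrM normfV ler_pdivrMl ?normr_gt0 //.
apply: le_trans (H s) _.
rewrite -[s ^+ 2]real_normK ?num_real // expr2 mulrA [C * _]mulrC -mulrA.
apply: ler_wpM2l => //.
apply: (@le_trans _ _ ((`|C| + 1) * `|s|)).
  by apply: ler_wpM2r => //; rewrite (le_trans (ler_norm _)) // lerDl.
rewrite -ler_pdivlMl ?ltr_wpDl //; near: s; apply: dnbhs0_le.
by rewrite mulr_gt0 // invr_gt0 ltr_wpDl.
Unshelve. all: by end_near. Qed.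

(* Minty's lemma: the variational inequality may be tested at [z] with the
   gradient at [z], which is then moved to [p] along segments. *)
Lemma minty_vi (h : 'rV[R]_n -> \bar R) (G : 'rV[R]_n -> 'rV[R]_n) (c L : R) p w :
  proper_closed_convex h -> edom h p -> edom h w ->
  (forall z, edom h z ->
     fine (h p) <= fine (h z) + dot (G z) (z - p) + c / 2 * dot (z - p) (z - p)) ->
  (forall z, edom h z -> enorm (G z - G p) <= L * enorm (z - p)) ->
  fine (h p) <= fine (h w) + dot (G p) (w - p).
Proof.
move=> [ph _ ch] hp hw H HL; set d := w - p.
apply: (@le_of_linear_error _ _ _ ((L + c / 2) * dot d d) 1) => //.
move=> t /andP[t0 t1]; have t01 : 0 <= t <= 1 by rewrite ltW.
have [D Hz] := econvex_fine ph ch t01 hw hp.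
have zE : t *: w + (1 - t) *: p - p = t *: d.
  by apply/rowP => i; rewrite /d !mxE; ring.
have := H _ D; have := HL _ D; rewrite zE enormZ gtr0_norm //.
set z := _ + _ in Hz *.
rewrite !dotZl !dotZr => Lz Hpz.
have : dot (G z - G p) d <= L * t * dot d d.
  apply: le_trans (dot_le_enorm _ _) _; rewrite -enorm_sqr expr2 !mulrA.
  by apply: ler_wpM2r; [exact: enorm_ge0|rewrite -mulrA].
rewrite dotDl dotNl -(ler_pM2l t0) => {}Lz.
rewrite -(ler_pM2l t0); lra.
Qed.

End minty.

(** * The regularised saddle-point problem *)

Section saddle.
Context {R : realType} {n m : nat}.
Variables (f : 'rV[R]_n -> \bar R) (g : 'rV[R]_m -> \bar R).
Variable Phi : 'rV[R]_n -> 'rV[R]_m -> R.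
Variables gamma muy Lxx Lxy Lyx Lyy lambda : R.
Hypothesis Hstruct : structural_assumption f g Phi gamma muy.
Hypothesis Hsmooth : smoothness_assumption f g Phi Lxx Lxy Lyx Lyy.
Hypothesis Hlambda : 0 < lambda < gamma^-1.
Implicit Types (x w z : 'rV[R]_n) (y : 'rV[R]_m).

Let fcc : proper_closed_convex f. Proof. by case: Hstruct => -[]. Qed.
Let gcc : proper_closed_convex g. Proof. by case: Hstruct => -[]. Qed.
Let pf : Defs.proper f. Proof. by case: fcc. Qed.
Let pg : Defs.proper g. Proof. by case: gcc. Qed.
Let gamma0 : 0 < gamma. Proof. by case: Hstruct => -[]. Qed.
Let muy0 : 0 < muy. Proof. by case: Hstruct => _ []. Qed.
Let lambda0 : 0 < lambda. Proof. by case/andP: Hlambda. Qed.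

Definition mux_of : R := lambda^-1 - gamma.

Lemma mux_of_gt0 : 0 < mux_of.
Proof.
case/andP: Hlambda => _; rewrite -ltf_pV2 ?posrE ?invr_gt0 // invrK => H.
by rewrite subr_gt0.
Qed.

Lemma wcvx_Phi_l y : edom g y -> wcvx gamma (Phi^~ y).
Proof. by move=> gy; case: Hstruct => _ [_ /(_ y gy)[H _] _ _]; exact: weakly_convex_wcvx. Qed.

Lemma wcvx_Phi_r x : edom f x -> wcvx (- muy) (fun y => - Phi x y).
Proof. by move=> fx; case: Hstruct => _ [_ _ /(_ x fx) H _]; exact: strongly_concave_wcvx. Qed.

Lemma differentiable_Phi_l x y : edom f x -> edom g y -> differentiable (Phi^~ y) x.
Proof.
move=> fx gy; case: Hstruct => _ [_ _ _ [U [_ sU dU]]].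
have dxy := dU (x, y) (sU (x, y) (conj fx gy)).
apply: (@differentiable_comp _ _ _ _ (fun x' => (x', y))
  (fun z : 'rV[R]_n * 'rV[R]_m => Phi z.1 z.2) x _ dxy).
apply: differentiable_pair; [exact: ex_diff|exact: differentiable_cst].
Qed.

Lemma differentiable_Phi_r x y : edom f x -> edom g y -> differentiable (Phi x) y.
Proof.
move=> fx gy; case: Hstruct => _ [_ _ _ [U [_ sU dU]]].
have dxy := dU (x, y) (sU (x, y) (conj fx gy)).
apply: (@differentiable_comp _ _ _ _ (fun y' => (x, y'))
  (fun z : 'rV[R]_n * 'rV[R]_m => Phi z.1 z.2) y _ dxy).
apply: differentiable_pair; [exact: differentiable_cst|exact: ex_diff].
Qed.

Lemma Phi_lower x x' y : edom f x -> edom g y ->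
  Phi x y + dot (gradx Phi x y) (x' - x) - gamma / 2 * dot (x' - x) (x' - x)
    <= Phi x' y.
Proof.
move=> fx gy; apply: (wcvx_first_order x' (wcvx_Phi_l gy)).
exact: differentiable_Phi_l.
Qed.

Lemma Phi_upper x y y' : edom f x -> edom g y ->
  Phi x y' <= Phi x y + dot (grady Phi x y) (y' - y)
              - muy / 2 * dot (y' - y) (y' - y).
Proof.
move=> fx gy; have d := differentiable_Phi_r fx gy.
have := wcvx_first_order y' (wcvx_Phi_r fx) (differentiableN d).
by rewrite grad_opp // dotNl -/(grady Phi x y); lra.
Qed.

(** Sum of the four gradient inequalities, at each point in each variable; all values of [Phi]
    cancel. *)
Lemma grad_mono x x' y y' : edom f x -> edom f x' -> edom g y -> edom g y' ->
  muy * dot (y - y') (y - y') - gamma * dot (x - x') (x - x') <=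
  dot (gradx Phi x y - gradx Phi x' y') (x - x')
  - dot (grady Phi x y - grady Phi x' y') (y - y').
Proof.
move=> fx fx' gy gy'.
have := Phi_lower x' fx gy; have := Phi_lower x fx' gy'.
have := Phi_upper y' fx gy; have := Phi_upper y fx' gy'.
by rewrite !dotE (dotC x' x) (dotC y' y); lra.
Qed.

(** The part of minus the Lagrangian that depends on [y], less the quadratic granted by strong
    concavity. It is still convex, and the proximal objective at [0] with parameter [muy^-1]
    restores that quadratic. *)
Definition neg_payoff x : 'rV[R]_m -> \bar R := fun y =>
  (g y + (- Phi x y + - muy / 2 * enorm y ^+ 2)%:E)%E.

Lemma neg_payoff_pcc x : edom f x -> proper_closed_convex (neg_payoff x).
Proof.
move=> fx; apply: proper_closed_convex_add => //; first exact: wcvx_Phi_r.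
by move=> y gy; apply: differentiableN; exact: differentiable_Phi_r.
Qed.

Lemma lagrangian_fine x y : edom f x -> edom g y ->
  lagrangian f g Phi x y = (fine (f x) + Phi x y - fine (g y))%:E.
Proof.
by move=> fx gy; rewrite /lagrangian (edom_fineK pf fx) (edom_fineK pg gy) /=.
Qed.

Lemma prox_obj_neg_payoff x y : edom f x ->
  prox_obj muy^-1 (neg_payoff x) 0 y = ((fine (f x))%:E - lagrangian f g Phi x y)%E.
Proof.
move=> fx; rewrite /prox_obj /neg_payoff subr0 invfM invrK.
have [gy|/not_edom gy] := pselect (edom g y).
  rewrite lagrangian_fine // (edom_fineK pg gy) -!EFinD.
  by congr _%:E; rewrite /=; lra.
by rewrite /lagrangian gy (edom_fineK pf fx) /=.
Qed.

(** Both sides choose from the same set of optima. The existence of a maximiser in [y] is thereby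
    inherited from the theory of proximal points. *)
Lemma ystar_prox x : edom f x -> ystar f g Phi x = prox muy^-1 (neg_payoff x) 0.
Proof.
move=> fx; rewrite /ystar /prox; congr xget; apply/funext => y; apply/propext.
by split => H v; have := H v; rewrite !prox_obj_neg_payoff // (edom_fineK pf fx);
  rewrite leeD2lE // leeN2.
Qed.

Lemma ystar_edom x : edom f x -> edom g (ystar f g Phi x).
Proof.
move=> fx; have := prox_edom (neg_payoff_pcc fx) (_ : 0 < muy^-1) 0.
rewrite invr_gt0 => /(_ muy0); rewrite -ystar_prox // /edom /neg_payoff /=.
by case: (g _) => [r _||_]; rewrite ?ltry ?ltNyr ?addye ?ltxx.
Qed.

Lemma ystar_max x y : edom f x ->
  (lagrangian f g Phi x y <= lagrangian f g Phi x (ystar f g Phi x))%E.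
Proof.
move=> fx; have := prox_min (neg_payoff_pcc fx) (_ : 0 < muy^-1) 0 y.
rewrite invr_gt0 => /(_ muy0); rewrite -ystar_prox // !prox_obj_neg_payoff //.
by rewrite (edom_fineK pf fx) leeD2lE // leeN2.
Qed.

Lemma grady_lip x x' y y' : edom f x -> edom f x' -> edom g y -> edom g y' ->
  enorm (grady Phi x y - grady Phi x' y') <= Lyx * enorm (x - x') + Lyy * enorm (y - y').
Proof. by move=> *; apply: (Hsmooth.2 _ _ _ _ _ _ _ _).2. Qed.

Lemma gradx_lip x x' y y' : edom f x -> edom f x' -> edom g y -> edom g y' ->
  enorm (gradx Phi x y - gradx Phi x' y') <= Lxx * enorm (x - x') + Lxy * enorm (y - y').
Proof. by move=> *; apply: (Hsmooth.2 _ _ _ _ _ _ _ _).1. Qed.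

(** Maximality together with concavity at the test point [z] gives the inequality with the gradient
    taken at [z]; Minty's lemma moves it to the maximiser. *)
Lemma ystar_vi x y : edom f x -> edom g y ->
  fine (g (ystar f g Phi x)) <=
    fine (g y) - dot (grady Phi x (ystar f g Phi x)) (y - ystar f g Phi x).
Proof.
move=> fx gy; rewrite -dotNl.
have gs := ystar_edom fx; set ys := ystar _ _ _ x in gs *.
apply: (@minty_vi _ _ g (fun y => - grady Phi x y) (- muy) Lyy) => //.
  move=> z gz; have := ystar_max z fx; rewrite -/ys !lagrangian_fine // lee_fin.
  have := Phi_upper ys fx gz.
  by rewrite !dotE (dotC ys z); lra.
move=> z gz; rewrite opprK addrC enormB.
by have := grady_lip fx fx gs gz; rewrite subrr enorm0 mulr0 add0r.
Qed.

(** The two variational inequalities are added; strong concavity bounds the squared distance of the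
    maximisers by the change of [grady] in [x] times that distance. *)
Lemma ystar_lip x x' : edom f x -> edom f x' ->
  enorm (ystar f g Phi x - ystar f g Phi x') <= Lyx / muy * enorm (x - x').
Proof.
move=> fx fx'.
have gs := ystar_edom fx; have gs' := ystar_edom fx'.
have := ystar_vi fx gs'; have := ystar_vi fx' gs.
set y := ystar _ _ _ x in gs *; set y' := ystar _ _ _ x' in gs' *.
have := grad_mono fx fx gs gs'; rewrite subrr.
rewrite !dotr0 mulr0 subr0 sub0r => M H1 H2.
have {}H1 : muy * dot (y - y') (y - y') <=
    dot (grady Phi x' y' - grady Phi x y') (y' - y).
  by move: M H1 H2; rewrite !dotE (dotC y' y); lra.
have := le_trans H1 (dot_le_enorm _ _).
have := grady_lip fx' fx gs' gs'; rewrite subrr enorm0 mulr0 addr0 => H3.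
rewrite -enorm_sqr (enormB y' y); set e := enorm (y - y').
have [->|e0] := eqVneq e 0.
  move=> _; rewrite mulr_ge0 ?enorm_ge0 // divr_ge0 ?(ltW muy0) //.
  by case: Hsmooth => -[_ _ _ /ltW].
have {}e0 : 0 < e by rewrite lt_neqAle eq_sym e0 enorm_ge0.
rewrite expr2 mulrA ler_pM2r // => H4.
rewrite mulrAC ler_pdivlMr // mulrC (le_trans H4) // (le_trans H3) //.
by rewrite enormB.
Qed.

Lemma phi_ystar x : edom f x ->
  phi f g Phi x = lagrangian f g Phi x (ystar f g Phi x).
Proof.
move=> fx; apply/eqP; rewrite eq_le; apply/andP; split.
  by apply/ereal_supP => _ [y _ <-]; exact: ystar_max.
by apply: ereal_sup_ubound; exists (ystar f g Phi x).
Qed.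

Lemma phi_gt x : (-oo < phi f g Phi x)%E.
Proof.
have [y gy] := pg.2.
apply: (@lt_le_trans _ _ (lagrangian f g Phi x y)).
  have [fx|/not_edom fx] := pselect (edom f x).
    by rewrite lagrangian_fine // ltNyr.
  by rewrite /lagrangian fx (edom_fineK pg gy).
by apply: ereal_sup_ubound; exists y.
Qed.

Lemma phi_edom x : edom (phi f g Phi) x <-> edom f x.
Proof.
split=> [|fx]; last first.
  by rewrite /edom /= phi_ystar // lagrangian_fine ?ltry //; exact: ystar_edom.
have [//|/not_edom fx] := pselect (edom f x).
have [y gy] := pg.2; rewrite /edom /= => H; exfalso.
have : (lagrangian f g Phi x y <= phi f g Phi x)%E.
  by apply: ereal_sup_ubound; exists y.
rewrite /lagrangian fx (edom_fineK pg gy) /= leye_eq => /eqP E.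
by move: H; rewrite E ltxx.
Qed.

Definition phi_shift x : \bar R :=
  (phi f g Phi x + (gamma / 2 * enorm x ^+ 2)%:E)%E.

(** A pointwise supremum over [y] in [dom g] of closed convex slices. For semicontinuity, a slice
    exceeding the given level at [x] does so nearby. *)
Lemma phi_shift_pcc : proper_closed_convex phi_shift.
Proof.
have sl y : edom g y ->
    proper_closed_convex (fun x => f x + (Phi x y + gamma / 2 * enorm x ^+ 2)%:E)%E.
  move=> gy; apply: (proper_closed_convex_add fcc (wcvx_Phi_l gy)) => x fx.
  exact: differentiable_Phi_l.
have shift_gt x : (-oo < phi_shift x)%E.
  by rewrite /phi_shift; have := phi_gt x; case: phi => // r _; rewrite -EFinD ltNyr.
have domE x : edom phi_shift x <-> edom f x.
  rewrite -phi_edom /phi_shift /edom /=.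
  by case: phi => [r||]; rewrite -?EFinD ?ltry ?addye ?ltxx.
have shift_fine x : edom f x -> phi_shift x =
    (fine (f x) + Phi x (ystar f g Phi x) - fine (g (ystar f g Phi x))
      + gamma / 2 * enorm x ^+ 2)%:E.
  move=> fx; rewrite /phi_shift phi_ystar // lagrangian_fine //.
  exact: ystar_edom.
have shift_ge x y : edom f x -> edom g y ->
    fine (f x) + Phi x y - fine (g y) + gamma / 2 * enorm x ^+ 2 <= fine (phi_shift x).
  move=> fx gy; rewrite shift_fine //= lerD2r -lee_fin -!lagrangian_fine //.
    exact: ystar_max.
  exact: ystar_edom.
split.
- by split => //; have [x fx] := pf.2; exists x; apply/domE.
- move=> x a; rewrite /phi_shift => H.
  have : ((a - gamma / 2 * enorm x ^+ 2)%:E < phi f g Phi x)%E.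
    by rewrite EFinB lteBlDr.
  move=> /ereal_sup_gt[_ [y _ <-]] Ly.
  have gy : edom g y.
    apply: contrapT => /not_edom gy; move: Ly; rewrite /lagrangian gy.
    by case: (f x).
  have [_ ly _] := sl y gy.
  have [|V xV VH] := ly x (a + fine (g y)).
    move: Ly; rewrite /lagrangian (edom_fineK pg gy).
    case: (f x) => [r| |] //; rewrite -?EFinD -?EFinB ?lte_fin ?ltry ?addye //; lra.
  exists V => // z /VH Vz.
  apply: (@lt_le_trans _ _ (lagrangian f g Phi z y + (gamma / 2 * enorm z ^+ 2)%:E)%E).
    move: Vz; rewrite /lagrangian (edom_fineK pg gy).
    case: (f z) => [r| |] //; rewrite -?EFinD -?EFinB ?lte_fin ?ltry ?addye //; lra.
  by rewrite leeD2r //; apply: ereal_sup_ubound; exists y.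
- apply: fine_econvex => // t x x' t01 /domE fx /domE fx'.
  (* The supremum is attained at the interpolated point [z], so the single slice at its maximiser
     suffices: exact at [z], a lower bound at [x] and [x']. *)
  have [_ _ cf] := fcc; have [fz _] := econvex_fine pf cf t01 fx fx'.
  set z := _ + _ in fz *; have gy := ystar_edom fz.
  set y := ystar f g Phi z in gy.
  have [py _ cy] := sl y gy.
  have dom w : edom f w ->
      (f w + (Phi w y + gamma / 2 * enorm w ^+ 2)%:E)%E =
      (fine (f w) + (Phi w y + gamma / 2 * enorm w ^+ 2))%:E.
    by move=> fw; rewrite (edom_fineK pf fw).
  have [_] := econvex_fine py cy t01 (edom_fin (dom _ fx)) (edom_fin (dom _ fx')).
  rewrite -/z !dom //= shift_fine // lee_fin -/y => H.
  have := shift_ge x y fx gy; have := shift_ge x' y fx' gy.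
  case/andP: t01 => t0 t1; have t1' : 0 <= 1 - t by rewrite subr_ge0.
  move=> /(ler_wpM2l t1') H1 /(ler_wpM2l t0) H2; lra.
Qed.

End saddle.

(** * Proximal points and the Moreau envelope of the weakly convex primal function *)

Section proximal_point.
Context {R : realType} {n m : nat}.
Variables (f : 'rV[R]_n -> \bar R) (g : 'rV[R]_m -> \bar R).
Variable Phi : 'rV[R]_n -> 'rV[R]_m -> R.
Variables gamma muy Lxx Lxy Lyx Lyy lambda : R.
Hypothesis Hstruct : structural_assumption f g Phi gamma muy.
Hypothesis Hsmooth : smoothness_assumption f g Phi Lxx Lxy Lyx Lyy.
Hypothesis Hlambda : 0 < lambda < gamma^-1.
Implicit Types (x w z : 'rV[R]_n) (y : 'rV[R]_m).

Let fcc : proper_closed_convex f. Proof. by case: Hstruct => -[]. Qed.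
Let lambda0 : 0 < lambda. Proof. by case/andP: Hlambda. Qed.

Let kappa := lambda^-1.
Let mux := mux_of gamma lambda.
Let kappa0 : 0 < kappa. Proof. by rewrite invr_gt0. Qed.
Let mux0 : 0 < mux. Proof. exact: (mux_of_gt0 Hstruct Hlambda). Qed.
Let ratio := kappa / mux.
Let shift_pcc := phi_shift_pcc Hstruct.
Let imux0 : 0 < mux^-1. Proof. by rewrite invr_gt0. Qed.
Local Notation phi := (phi f g Phi).
Local Notation ystar := (ystar f g Phi).

(** Completing the square: removing [gamma / 2] times the squared norm from the proximal term leaves
    curvature [mux] and centre [ratio *: x]. The weakly convex problem becomes a convex one, up to a
    constant independent of [w]. *)
Lemma prox_obj_phi_shift x w : prox_obj lambda phi x w =
  (prox_obj mux^-1 (phi_shift f g Phi gamma) (ratio *: x) w +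
    (kappa / 2 * dot x x - mux / 2 * ratio ^+ 2 * dot x x)%:E)%E.
Proof.
rewrite /prox_obj /phi_shift -!addeA -!EFinD; congr (_ + _%:E)%E.
rewrite !invfM invrK !enorm_sqr !dotE (dotC x w) -/kappa.
have -> : gamma = kappa - mux by rewrite /mux /mux_of opprB addrC subrK.
have -> : kappa = mux * ratio by rewrite /ratio mulrC mulfVK // gt_eqF.
by field.
Qed.

Lemma prox_phi x :
  prox lambda phi x = prox mux^-1 (phi_shift f g Phi gamma) (ratio *: x).
Proof.
rewrite {1}/prox /prox; congr xget; apply/funext => p; apply/propext.
by split => H v; have := H v; rewrite !prox_obj_phi_shift leeD2rE.
Qed.

Lemma prox_phi_min x v :
  (prox_obj lambda phi x (prox lambda phi x) <= prox_obj lambda phi x v)%E.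
Proof. by rewrite !prox_obj_phi_shift leeD2rE // prox_phi; exact: prox_min. Qed.

Lemma prox_phi_edom x : edom f (prox lambda phi x).
Proof.
apply/(phi_edom Hstruct); have := prox_edom shift_pcc imux0 (ratio *: x).
rewrite -prox_phi /edom /phi_shift /=.
by case: Defs.phi => [r _||_]; rewrite ?ltry ?ltNyr ?addye ?ltxx.
Qed.

Lemma prox_phi_lip x x' :
  enorm (prox lambda phi x - prox lambda phi x') <= ratio * enorm (x - x').
Proof.
rewrite !prox_phi; apply: le_trans (prox_nonexpansive shift_pcc imux0 _ _) _.
by rewrite -scalerBr enormZ gtr0_norm ?divr_gt0.
Qed.

Lemma phi_fineK x : edom f x -> phi x = (fine (phi x))%:E.
Proof.
move=> fx; rewrite fineK // fin_numElt (phi_gt Hstruct).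
exact/(phi_edom Hstruct).
Qed.

Lemma prox_obj_phi x w : edom f w -> prox_obj lambda phi x w =
  (fine (phi w) + kappa / 2 * dot (w - x) (w - x))%:E.
Proof.
move=> fw; rewrite /prox_obj {1}(phi_fineK fw) -EFinD enorm_sqr.
by rewrite invfM mulrC [2^-1 * _]mulrC mulrC.
Qed.

Lemma fine_moreau_phi x : fine (moreau lambda phi x) =
  fine (phi (prox lambda phi x)) +
  kappa / 2 * dot (prox lambda phi x - x) (prox lambda phi x - x).
Proof.
rewrite -[RHS]/(fine _%:E) -prox_obj_phi; last exact: prox_phi_edom.
congr fine; apply/eqP; rewrite eq_le; apply/andP; split.
  by apply: ereal_inf_lbound; exists (prox lambda phi x).
by apply/ereal_infP => _ [v _ <-]; exact: prox_phi_min.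
Qed.

(** The proximal point of [x] is used as a competitor in the problem centred at [x']. *)
Lemma moreau_phi_upper x x' :
  fine (moreau lambda phi x') <= fine (moreau lambda phi x)
   + kappa * dot (x' - x) (x - prox lambda phi x) + kappa / 2 * dot (x' - x) (x' - x).
Proof.
have := prox_phi_min x' (prox lambda phi x).
rewrite !prox_obj_phi; try exact: prox_phi_edom.
rewrite lee_fin !fine_moreau_phi.
move: (prox _ _ x) (prox _ _ x') => p p'.
move: (fine (phi p)) (fine (phi p')) => a b.
by rewrite !dotE (dotC p x) (dotC p x') (dotC p' x') (dotC x' x); lra.
Qed.

(** [moreau_phi_upper] is applied in both directions. The two linear terms differ by the
    displacement of the proximal point, which is at most [ratio * |s|], so the error is quadratic in
    [s]. *)
Lemma grad_moreau_phi x :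
  grad_moreau lambda phi x = kappa *: (x - prox lambda phi x).
Proof.
apply/rowP => i; rewrite !mxE.
apply: (@derive_of_quadratic_error _ _ _ _ _ _ (kappa * (1 / 2 + ratio))) => s.
set e := delta_mx 0 i; set F := fine \o _; rewrite /F /=.
have ee v : dot e v = v 0 i.
  rewrite /dot (bigD1 i) //= big1 ?addr0; first by rewrite mxE !eqxx mul1r.
  by move=> j ji; rewrite mxE (negbTE ji) andbF mul0r.
have := moreau_phi_upper x (s *: e + x); have := moreau_phi_upper (s *: e + x) x.
have -> : x - (s *: e + x) = - (s *: e) by rewrite opprD addrCA subrr addr0.
have := prox_phi_lip (s *: e + x) x; rewrite addrK.
move: (fine (moreau lambda phi x)) (fine (moreau lambda phi (s *: e + x)))
  (prox lambda phi x) (prox lambda phi (s *: e + x)) => M M' p p' Hlip.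
rewrite !dotNl !dotNr opprK !dotZl !dotZr !ee [e 0 i]mxE !eqxx mulr1 => H1 H2.
have Hp : `|s| * `|(p' - p) 0 i| <= ratio * s ^+ 2.
  rewrite -[s ^+ 2]real_normK ?num_real // expr2 mulrCA ler_wpM2l //.
  apply: le_trans (coord_le_enorm _ _) _.
  apply: le_trans Hlip _; rewrite enormZ.
  have -> : enorm e = 1.
    by apply/eqP; rewrite -(@eqrXn2 _ 2) ?enorm_ge0 // enorm_sqr ee mxE !eqxx expr1n.
  by rewrite mulr1.
have : 0 <= kappa * ratio * s ^+ 2.
  by rewrite mulr_ge0 ?sqr_ge0 // mulr_ge0 ?divr_ge0 // ltW.
have : 0 <= kappa * s ^+ 2 by rewrite mulr_ge0 ?sqr_ge0 // ltW.
move: H1 H2 Hp; rewrite -normrM !mxE !eqxx /= => H1 H2 /ler_normlP[].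
rewrite -(ler_pM2l kappa0) => Hp1; rewrite -(ler_pM2l kappa0) => Hp2 S1 S2.
by rewrite ler_norml; apply/andP; split; lra.
Qed.

Lemma grad_phis_lip x x' : edom f x -> edom f x' ->
  enorm (grad_phis f g Phi x - grad_phis f g Phi x') <=
    (Lxx + Lxy * (Lyx / muy)) * enorm (x - x').
Proof.
move=> fx fx'; have gy := ystar_edom Hstruct fx; have gy' := ystar_edom Hstruct fx'.
apply: le_trans (gradx_lip Hsmooth fx fx' gy gy') _.
rewrite mulrDl lerD2l -mulrA ler_wpM2l ?(ystar_lip Hstruct Hsmooth) //.
by case: Hsmooth => -[_ _ /ltW].
Qed.

(** First-order optimality of the proximal point in Danskin's form, derived from values and
    [Phi_lower] alone, without differentiating [phis]. *)
Lemma prox_phi_vi x0 w : edom f w ->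
  fine (f (prox lambda phi x0)) <= fine (f w) +
    dot (grad_phis f g Phi (prox lambda phi x0) + kappa *: (prox lambda phi x0 - x0))
        (w - prox lambda phi x0).
Proof.
move=> fw; have fp := prox_phi_edom x0; set p := prox _ _ x0 in fp *.
apply: (@minty_vi _ _ f (fun z => grad_phis f g Phi z + kappa *: (z - x0)) gamma
  (Lxx + Lxy * (Lyx / muy) + kappa)) => //.
  move=> z fz; have gz := ystar_edom Hstruct fz.
  have := prox_phi_min x0 z; rewrite -/p !prox_obj_phi // lee_fin => H1.
  (* The payoff at [p] is tested with the maximiser of [z]: weak convexity of [Phi] in its first
     argument, expanded at [z], then produces [grad_phis] at [z]. *)
  have H2 : fine (f p) + Phi p (ystar z) - fine (g (ystar z)) <= fine (phi p).
    rewrite -lee_fin -(phi_fineK fp) -(lagrangian_fine Hstruct) //.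
    by apply: ereal_sup_ubound; exists (ystar z).
  have H3 : fine (phi z) = fine (f z) + Phi z (ystar z) - fine (g (ystar z)).
    by rewrite (phi_ystar Hstruct) // (lagrangian_fine Hstruct).
  have := Phi_lower Hstruct p fz gz.
  rewrite -/(grad_phis f g Phi z).
  have : 0 <= kappa / 2 * dot (z - p) (z - p).
    by rewrite mulr_ge0 ?dot_ge0 // divr_ge0 // ltW.
  move: H1; rewrite !dotE (dotC p z) (dotC x0 z) (dotC x0 p); lra.
move=> z fz; rewrite mulrDl.
have -> : grad_phis f g Phi z + kappa *: (z - x0) -
    (grad_phis f g Phi p + kappa *: (p - x0)) =
    (grad_phis f g Phi z - grad_phis f g Phi p) + kappa *: (z - p).
  by apply/rowP => i; rewrite !mxE; ring.
apply: le_trans (enormD _ _) _; rewrite enormZ gtr0_norm // lerD2r.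
exact: grad_phis_lip.
Qed.

(** By its variational inequality, [p] is the proximal point for [f] of [x0 - lambda *: G]. [Gmap]
    at [p] compares it with that of [p - lambda *: G], and the two centres differ by [p - x0]. *)
Lemma Gmap_prox_phi x0 :
  enorm (Gmap f g Phi lambda (prox lambda phi x0)) <=
    enorm (grad_moreau lambda phi x0).
Proof.
have fp := prox_phi_edom x0; rewrite grad_moreau_phi /Gmap.
set p := prox _ phi x0 in fp *; set G := grad_phis f g Phi p.
have pE : prox lambda f (p - lambda *: G - (p - x0)) = p.
  apply: vi_prox => // w /(prox_phi_vi x0); rewrite -/p -/G => /le_trans; apply.
  rewrite lerD2l -dotZl opprB addrA -/kappa le_eqVlt; apply/orP; left; apply/eqP.
  congr dot; apply/rowP => i; rewrite !mxE /kappa; field.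
  by rewrite gt_eqF.
rewrite !enormZ; apply: ler_wpM2l; first exact: normr_ge0.
rewrite -[X in enorm (X - _)]pE.
apply: le_trans (prox_nonexpansive fcc lambda0 _ _) _.
by rewrite addrAC subrr add0r enormN enormB.
Qed.

Lemma Gmap_lip x x' : edom f x -> edom f x' ->
  enorm (Gmap f g Phi lambda x) <= enorm (Gmap f g Phi lambda x') +
    (2 * kappa + (Lxx + Lxy * (Lyx / muy))) * enorm (x - x').
Proof.
move=> fx fx'; set L := Lxx + _.
rewrite -[Gmap _ _ _ _ x](subrK (Gmap f g Phi lambda x')).
apply: le_trans (enormD _ _) _; rewrite addrC lerD2l.
rewrite /Gmap -scalerBr enormZ gtr0_norm // -/kappa.
have aux q q' : enorm (q - q') <= (1 + lambda * L) * enorm (x - x') ->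
    enorm (x - q - (x' - q')) <= (1 + (1 + lambda * L)) * enorm (x - x').
  move=> H; rewrite mulrDl mul1r.
  have -> : x - q - (x' - q') = (x - x') - (q - q').
    by apply/rowP => i; rewrite !mxE; ring.
  by apply: le_trans (enormD _ _) _; rewrite enormN lerD2l.
set G := grad_phis f g Phi x; set G' := grad_phis f g Phi x'.
have H : enorm (prox lambda f (x - lambda *: G) - prox lambda f (x' - lambda *: G'))
    <= (1 + lambda * L) * enorm (x - x').
  apply: le_trans (prox_nonexpansive fcc lambda0 _ _) _.
  have -> : x - lambda *: G - (x' - lambda *: G') = (x - x') - lambda *: (G - G').
    by apply/rowP => i; rewrite !mxE; ring.
  apply: le_trans (enormD _ _) _.
  rewrite enormN enormZ gtr0_norm // mulrDl mul1r lerD2l -mulrA ler_wpM2l ?(ltW lambda0) //.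
  exact: grad_phis_lip.
have -> : 2 * kappa + L = kappa * (1 + (1 + lambda * L)).
  by rewrite /kappa; field; rewrite gt_eqF.
rewrite -mulrA (ler_pM2l kappa0); move: H; apply: aux.
Qed.

End proximal_point.

(** * One step of SAPD *)

Section prox_step.
Context {R : realType} {n : nat}.
Variables (h : 'rV[R]_n -> \bar R) (s : R).
Hypotheses (hh : proper_closed_convex h) (s0 : 0 < s).

(** [q] is the target coordinate of the saddle point and [G] its gradient in a variational
    inequality. That inequality is added to the proximal one tested at [q], and [z - q] is expanded
    around [p]. *)
Lemma prox_step (z r p q G : 'rV[R]_n) : edom h q ->
  p = prox s h (z + s *: r) ->
  fine (h q) <= fine (h p) - dot G (p - q) ->
  s^-1 * dot (p - q) (p - q) + s^-1 * dot (p - z) (p - z) <=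
    s^-1 * dot (z - q) (z - q) + 2 * dot (r - G) (p - q).
Proof.
move=> hq pE qG; have := prox_vi hh s0 (z + s *: r) hq; rewrite -pE.
have -> : q - p = - (p - q) by rewrite opprB.
have -> : p - (z + s *: r) = (p - z) - s *: r by rewrite opprD addrA.
rewrite dotNr (dotDl (p - z)) dotNl dotZl opprB mulrBr mulrA mulVf ?gt_eqF // mul1r => H.
have -> : z - q = (p - q) - (p - z) by apply/rowP => i; rewrite !mxE; ring.
move: (p - q) (p - z) qG H => a b.
by rewrite !dotE (dotC b a); lra.
Qed.

End prox_step.

Section one_step.
Context {R : realType} {n m : nat}.
Variables (f : 'rV[R]_n -> \bar R) (g : 'rV[R]_m -> \bar R).
Variable Phi : 'rV[R]_n -> 'rV[R]_m -> R.
Variables gamma muy Lxx Lxy Lyx Lyy lambda : R.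
Hypothesis Hstruct : structural_assumption f g Phi gamma muy.
Hypothesis Hsmooth : smoothness_assumption f g Phi Lxx Lxy Lyx Lyy.
Hypothesis Hlambda : 0 < lambda < gamma^-1.
Implicit Types (x w z : 'rV[R]_n) (y : 'rV[R]_m).

Let fcc : proper_closed_convex f. Proof. by case: Hstruct => -[]. Qed.
Let gcc : proper_closed_convex g. Proof. by case: Hstruct => -[]. Qed.
Let muy0 : 0 < muy. Proof. by case: Hstruct => _ []. Qed.
Let lambda0 : 0 < lambda. Proof. by case/andP: Hlambda. Qed.
Variables (x0 : 'rV[R]_n) (tau sigma theta : R).
Hypotheses (tau0 : 0 < tau) (sigma0 : 0 < sigma) (theta01 : 0 <= theta <= 1).

Let kappa := lambda^-1.
Let mux := mux_of gamma lambda.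
Let kappa0 : 0 < kappa. Proof. by rewrite invr_gt0. Qed.
Let mux0 : 0 < mux. Proof. exact: (mux_of_gt0 Hstruct Hlambda). Qed.

Let xs := prox lambda (phi f g Phi) x0.
Let ys := ystar f g Phi xs.
Let fxs : edom f xs. Proof. exact: (prox_phi_edom Hstruct Hlambda). Qed.
Let gys : edom g ys. Proof. exact: (ystar_edom Hstruct). Qed.

(** A common bound for the weights with which squared increments of the iterates appear once the
    gradient differences have been split by Young's inequality. *)
Definition step_const : R :=
  4 * Lyx ^+ 2 / muy + 4 * Lyy ^+ 2 / muy + (Lxx + lambda^-1) ^+ 2 / mux_of gamma lambda.

Lemma sqr_le_add (a b c : R) : 0 <= a -> a <= b + c -> a ^+ 2 <= 2 * b ^+ 2 + 2 * c ^+ 2.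
Proof.
move=> a0 abc; apply: (@le_trans _ _ ((b + c) ^+ 2)).
  by rewrite ler_sqr ?nnegrE ?(le_trans a0).
by have := sqr_ge0 (b - c); lra.
Qed.

Lemma grady_lip_sqr x x' y y' : edom f x -> edom f x' -> edom g y -> edom g y' ->
  dot (grady Phi x y - grady Phi x' y') (grady Phi x y - grady Phi x' y') <=
  2 * Lyx ^+ 2 * dot (x - x') (x - x') + 2 * Lyy ^+ 2 * dot (y - y') (y - y').
Proof.
move=> fx fx' gy gy'.
have := sqr_le_add (enorm_ge0 _) (grady_lip Hsmooth fx fx' gy gy').
by rewrite !exprMn !enorm_sqr !mulrA.
Qed.

Lemma young_scaled k (t : R) (c : R) (u v : 'rV[R]_k) : 0 < c -> 0 <= t <= 1 ->
  2 * t * dot u v <= c * dot u u + c^-1 * dot v v.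
Proof.
move=> c0 /andP[t0 t1].
have H := dot_young u v c0.
have H0 : 0 <= c * dot u u + c^-1 * dot v v.
  by rewrite addr_ge0 // mulr_ge0 ?dot_ge0 // ?invr_ge0 ltW.
have -> : 2 * t * dot u v = t * (2 * dot u v) by ring.
have [d0|/ltW d0] := leP 0 (2 * dot u v); first exact: le_trans (ler_piMl d0 t1) H.
exact: le_trans (mulr_ge0_le0 t0 d0) H0.
Qed.

(** [D] and [Dp] are the oracle errors at the current and the previous iterate. Each must end up
    paired with the iterate at which it was drawn, so that its mean vanishes; the rest of the
    pairing goes into increments. *)
Lemma step_y x y xp yp (D Dp : 'rV[R]_m) x' y' :
  edom f x -> edom f xp -> edom f x' -> edom g y -> edom g yp ->
  y' = prox sigma g (y + sigma *: (grady Phi x y + D + theta *: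
         (grady Phi x y + D - (grady Phi xp yp + Dp)))) ->
  sigma^-1 * dot (y' - ys) (y' - ys) + (2 * sigma)^-1 * dot (y' - y) (y' - y) <=
    sigma^-1 * dot (y - ys) (y - ys)
    + 2 * dot (grady Phi x' y' - grady Phi xs ys) (y' - ys)
    + muy * dot (y' - ys) (y' - ys)
    + 4 / muy * (Lyx ^+ 2 * dot (x' - x) (x' - x) + Lyy ^+ 2 * dot (y' - y) (y' - y))
    + 4 / muy * (Lyx ^+ 2 * dot (x - xp) (x - xp) + Lyy ^+ 2 * dot (y - yp) (y - yp))
    + (4 * sigma)^-1 * dot (y - yp) (y - yp)
    + 2 * (1 + theta) * dot D (y - ys) - 2 * theta * dot Dp (yp - ys)
    + 16 * sigma * dot D D + 8 * sigma * dot Dp Dp.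
Proof.
move=> fx fxp fx' gy gyp y'E.
have gy' : edom g y' by rewrite y'E; exact: prox_edom.
have := prox_step gcc sigma0 gys y'E (ystar_vi Hstruct Hsmooth fxs gy').
rewrite -/ys.
have L1 := grady_lip_sqr fx fx' gy gy'.
have L2 := grady_lip_sqr fx fxp gy gyp.
move: (grady Phi xs ys) (grady Phi x y) (grady Phi xp yp) (grady Phi x' y') L1 L2.
move=> Gs G0 Gp G1 L1 L2.
(* The two gradient differences spend [muy / 2] each on [y' - ys]. The weights [8 * sigma], twice,
   and [4 * sigma] use up exactly half of the [sigma^-1] available on [y' - y]. *)
have c0 : 0 < 2 / muy by rewrite divr_gt0.
have one01 : 0 <= (1 : R) <= 1 by rewrite lexx ler01.
have s8 : 0 < 8 * sigma by rewrite mulr_gt0.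
have s4 : 0 < 4 * sigma by rewrite mulr_gt0.
have Y1 := young_scaled (G0 - G1) (y' - ys) c0 one01.
have Y2 := young_scaled (G0 - Gp) (y' - ys) c0 theta01.
have N1 := young_scaled D (y' - y) s8 one01.
have N1' := young_scaled D (y' - y) s8 theta01.
have N2 := young_scaled (- Dp) (y' - y) s4 theta01.
have N3 := young_scaled (- Dp) (y - yp) s4 theta01.
have -> : G0 + D + theta *: (G0 + D - (Gp + Dp)) - Gs =
  (G1 - Gs) + (G0 - G1) + theta *: (G0 - Gp) + (1 + theta) *: D - theta *: Dp.
  by apply/rowP => i; rewrite !mxE; ring.
have eD : dot D (y' - ys) = dot D (y' - y) + dot D (y - ys).
  by rewrite -dotDr addrA subrK.
(* The previous error is moved back two iterates; the increment [y - yp] was controlled in the step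
   before. *)
have eDp : dot Dp (y' - ys) = dot Dp (y' - y) + dot Dp (y - yp) + dot Dp (yp - ys).
  by rewrite -!dotDr; congr dot; rewrite !addrA !subrK.
have cs : dot (x - x') (x - x') = dot (x' - x) (x' - x).
  by rewrite -!enorm_sqr enormB.
have ds : dot (y - y') (y - y') = dot (y' - y) (y' - y).
  by rewrite -!enorm_sqr enormB.
rewrite !(dotDl _ _ (y' - ys)) !dotNl !dotZl eD eDp.
move: L1 L2 Y1 Y2 N1 N1' N2 N3; rewrite cs ds !dotNl !dotNr !opprK !mulr1.
rewrite !(dotDl _ (- _) (y' - ys)) !dotNl.
move: (y' - ys) (y - ys) (yp - ys) (y' - y) (y - yp) (x' - x) (x - xp) =>
  e' e ep v vp u up.
move: (G1 - Gs) (G0 - G1) (G0 - Gp) => a b c.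
rewrite -(ler_pM2l c0) => L1; rewrite -(ler_pM2l c0) => L2.
move: L1 L2; rewrite !invfM !invrK; move: (sigma^-1) (muy^-1) => i k L1 L2; lra.
Qed.

Lemma step_x x (Dx : 'rV[R]_n) x' y' : edom f x -> edom g y' ->
  x' = prox tau f (x - tau *: (gradx Phi x y' + Dx + kappa *: (x - x0))) ->
  tau^-1 * dot (x' - xs) (x' - xs) + (2 * tau)^-1 * dot (x' - x) (x' - x) <=
    tau^-1 * dot (x - xs) (x - xs)
    - 2 * dot (gradx Phi x' y' - gradx Phi xs ys) (x' - xs)
    - 2 * kappa * dot (x' - xs) (x' - xs) + mux * dot (x' - xs) (x' - xs)
    + (Lxx + kappa) ^+ 2 / mux * dot (x' - x) (x' - x)
    - 2 * dot Dx (x - xs) + 2 * tau * dot Dx Dx.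
Proof.
move=> fx gy' x'E.
have fx' : edom f x' by rewrite x'E; exact: prox_edom.
have x'E2 : x' = prox tau f (x + tau *: - (gradx Phi x y' + Dx + kappa *: (x - x0))).
  by rewrite scalerN.
have vi : fine (f xs) <= fine (f x') -
    dot (- (grad_phis f g Phi xs + kappa *: (xs - x0))) (x' - xs).
  by rewrite dotNl opprK; exact: (prox_phi_vi Hstruct Hsmooth Hlambda).
have := prox_step fcc tau0 fxs x'E2 vi.
rewrite -[grad_phis f g Phi xs]/(gradx Phi xs ys).
have Lb : dot (gradx Phi x y' - gradx Phi x' y' + kappa *: (x - x'))
    (gradx Phi x y' - gradx Phi x' y' + kappa *: (x - x')) <=
    (Lxx + kappa) ^+ 2 * dot (x' - x) (x' - x).
  rewrite -!enorm_sqr -exprMn ler_sqr ?nnegrE ?enorm_ge0 //; last first.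
    rewrite mulr_ge0 ?enorm_ge0 // addr_ge0 ?(ltW kappa0) //.
    by case: Hsmooth => -[].
  apply: le_trans (enormD _ _) _; rewrite enormZ (gtr0_norm kappa0).
  rewrite mulrDl (enormB x' x) lerD2r.
  by have := gradx_lip Hsmooth fx fx' gy' gy'; rewrite subrr enorm0 mulr0 addr0.
(* The lagged gradient is paid for with [mux] on [x' - xs], the noise with half of [tau^-1] on
   [x' - x]. *)
have im0 : 0 < mux^-1 by rewrite invr_gt0.
have t2 : 0 < 2 * tau by rewrite mulr_gt0.
move: (gradx Phi x y') (gradx Phi x' y') (gradx Phi xs ys) Lb => G0 G1 Gs Lb.
have -> : - (G0 + Dx + kappa *: (x - x0)) - - (Gs + kappa *: (xs - x0)) =
  - (G1 - Gs) - (G0 - G1 + kappa *: (x - x')) - kappa *: (x' - xs) - Dx.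
  by apply/rowP => i; rewrite !mxE; ring.
move: (G0 - G1 + _) (G1 - Gs) Lb => b a Lb.
have Y := dot_young (- b) (x' - xs) im0.
have N := dot_young (- Dx) (x' - x) t2.
have eD : dot Dx (x' - xs) = dot Dx (x' - x) + dot Dx (x - xs).
  by rewrite -dotDr addrA subrK.
move: Lb; rewrite -(ler_pM2l im0); move: (x' - xs) (x - xs) (x' - x) eD Y N.
move=> e' e u eD Y N Lb; rewrite !dotDl !dotNl dotZl eD.
move: Y N Lb; rewrite !dotNl !dotNr !opprK invfM !invrK.
by move: (tau^-1) (mux^-1) => i k; lra.
Qed.

(** Twice [grad_mono] absorbs the remaining gradient pairings. The balance is
    [- 2 * kappa + mux + 2 * gamma = - mux] for [x] and [muy - 2 * muy = - muy] for [y], which is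
    the contraction gained on the left. *)
Lemma sapd_step x y xp yp (D Dp : 'rV[R]_m) (Dx : 'rV[R]_n) x' y' :
  edom f x -> edom f xp -> edom g y -> edom g yp ->
  y' = prox sigma g (y + sigma *: (grady Phi x y + D + theta *:
         (grady Phi x y + D - (grady Phi xp yp + Dp)))) ->
  x' = prox tau f (x - tau *: (gradx Phi x y' + Dx + kappa *: (x - x0))) ->
  (tau^-1 + mux) * dot (x' - xs) (x' - xs)
  + (sigma^-1 + muy) * dot (y' - ys) (y' - ys)
  + ((2 * tau)^-1 - step_const) * dot (x' - x) (x' - x)
  + ((2 * sigma)^-1 - step_const) * dot (y' - y) (y' - y) <=
    tau^-1 * dot (x - xs) (x - xs) + sigma^-1 * dot (y - ys) (y - ys)
    + step_const * dot (x - xp) (x - xp)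
    + (step_const + (4 * sigma)^-1) * dot (y - yp) (y - yp)
    + 2 * (1 + theta) * dot D (y - ys) - 2 * theta * dot Dp (yp - ys)
    - 2 * dot Dx (x - xs)
    + 16 * sigma * dot D D + 8 * sigma * dot Dp Dp + 2 * tau * dot Dx Dx.
Proof.
move=> fx fxp gy gyp y'E x'E.
have gy' : edom g y' by rewrite y'E; exact: prox_edom.
have fx' : edom f x' by rewrite x'E; exact: prox_edom.
have Sy := step_y fx fxp fx' gy gyp y'E.
have Sx := step_x fx gy' x'E.
have Mo := grad_mono Hstruct fx' fxs gy' gys.
move: Sx; have -> : kappa = mux + gamma by rewrite /mux /mux_of subrK.
rewrite /step_const -/mux -/kappa => Sx.
have kE : kappa = mux + gamma by rewrite /mux /mux_of subrK.
rewrite kE.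
have A1 : 0 <= 4 * Lyx ^+ 2 / muy.
  by rewrite divr_ge0 ?(ltW muy0) // mulr_ge0 ?sqr_ge0.
have A2 : 0 <= 4 * Lyy ^+ 2 / muy.
  by rewrite divr_ge0 ?(ltW muy0) // mulr_ge0 ?sqr_ge0.
have A3 : 0 <= (Lxx + (mux + gamma)) ^+ 2 / mux.
  by rewrite divr_ge0 ?(ltW mux0) ?sqr_ge0.
have B1 := mulr_ge0 (addr_ge0 A2 A3) (dot_ge0 (x' - x)).
have B2 := mulr_ge0 (addr_ge0 A2 A3) (dot_ge0 (x - xp)).
have B3 := mulr_ge0 (addr_ge0 A1 A3) (dot_ge0 (y' - y)).
have B4 := mulr_ge0 (addr_ge0 A1 A3) (dot_ge0 (y - yp)).
have B5 := mulr_ge0 A2 (dot_ge0 (x' - x)).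
have B6 := mulr_ge0 A1 (dot_ge0 (y' - y)).
move: Sx Sy Mo B1 B2 B3 B4 B5 B6.
move: (dot (gradx _ _ _ - _) _) (dot (grady _ _ _ - _) _) => p q.
move: (x' - xs) (x - xs) (x' - x) (x - xp) (y' - ys) (y - ys) (yp - ys) (y' - y) (y - yp)
  => a b c d a' b' e' c' d'.
move: (muy^-1) (mux^-1) => *.
lra.
Qed.

End one_step.

(** * Expectation and conditionally centred noise *)

Section borel_vectors.
Context {R : realType}.

Lemma continuous_borel n k (F : 'rV[R]_n -> 'rV[R]_k) : continuous F ->
  measurable_fun [set: borel n] (F : borel n -> borel k).
Proof.
move=> /continuousP cF; apply: (@measurability _ _ (borel n) (borel k) _ _ (@open 'rV[R]_k)) => //.
by move=> _ [B oB <-]; rewrite setTI; apply: sub_sigma_algebra; exact: cF.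
Qed.

Lemma continuous_borelR n (F : 'rV[R]_n -> R) : continuous F ->
  measurable_fun [set: borel n] (F : borel n -> R).
Proof.
move=> /continuousP cF; apply: (measurability _ (measurable_realfun.RGenOpens.measurableE R)).
move=> _ [_ [a [b ->]] <-]; rewrite setTI; apply: sub_sigma_algebra.
by apply: cF; exact: interval_open.
Qed.

Lemma measurable_coord n (i : 'I_n) :
  measurable_fun [set: borel n] ((fun v => v 0 i) : borel n -> R).
Proof. by apply: continuous_borelR => x; exact: coord_continuous. Qed.

Lemma rat_between (a e : R) : 0 < e -> exists q : rat, `|a - ratr q| < e.
Proof.
move=> e0; have : a - e < a + e by lra.
move=> /rat_in_itvoo[q]; rewrite in_itv /= => /andP[q1 q2]; exists q.
by rewrite ltr_norml; apply/andP; split; lra.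
Qed.

(** [borel n] is generated by open sets rather than by coordinates. An open set is the countable
    union of the boxes with rational centre and radius [1 / (k + 1)] that it contains. *)
Lemma measurable_vector d (T : measurableType d) n (X : T -> 'rV[R]_n) :
  (forall i, measurable_fun setT (fun w => X w 0 i)) ->
  measurable_fun setT (X : T -> borel n).
Proof.
move=> mX; apply: (@measurability _ _ T (borel n) _ _ (@open 'rV[R]_n)) => // _ [U oU <-]; rewrite setTI.
pose c (q : 'rV[rat]_n) : 'rV[R]_n := \row_j ratr (q 0 j).
pose box (p : 'rV[rat]_n * nat) := [set v : 'rV[R]_n | forall i, `|v 0 i - c p.1 0 i| < p.2.+1%:R^-1].
pose A p := if `[< box p `<=` U >] then X @^-1` box p else set0.
have -> : X @^-1` U = \bigcup_p A p.
  apply/seteqP; split => w /=; last first.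
    by move=> [p _]; rewrite /A; case: ifPn => // /asboolP pU /pU.
  move=> Uw; have : nbhs (X w) U by exact: open_nbhs_nbhs.
  move=> /nbhs_ballP[e /= e0 eU].
  (* Two points of one box are less than [2 / (k + 1)] apart in each coordinate, which is below
     [e]. *)
  pose k := Num.truncn (2 / e).
  have ke : 2 / k.+1%:R < e.
    by rewrite ltr_pdivrMr // mulrC -ltr_pdivrMr //; exact: truncnS_gt.
  have ki : (0 : R) < k.+1%:R^-1 by rewrite invr_gt0.
  have /choice[q hq] : forall i, exists q : rat, `|X w 0 i - ratr q| < k.+1%:R^-1.
    by move=> i; exact: rat_between.
  exists (\row_j q j, k) => //; rewrite /A.
  have -> : `[< box (\row_j q j, k) `<=` U >] = true.
    apply/asboolP => v /= vq; apply: eU; rewrite -ball_normE /=.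
    have vX i : `|X w 0 i - v 0 i| < e.
      have := vq i; rewrite /c !mxE distrC => H2.
      have := ler_distD (ratr (q i)) (X w 0 i) (v 0 i); have := hq i.
      by move: ke H2 => /=; move: (k.+1%:R^-1 : R) => z; lra.
    rewrite /Num.norm /= mx_normrE; apply/bigmax_ltP; split => //= -[j i] _ /=.
    by rewrite ord1 !mxE.
  by move=> i; rewrite /c !mxE.
apply: countable_bigcupT_measurable => // p; rewrite /A; case: ifP => // _.
rewrite (_ : _ @^-1` _ =
  \bigcap_(i in [set: 'I_n]) ((fun w => X w 0 i) @^-1` ball (c p.1 0 i) p.2.+1%:R^-1)).
  apply: fin_bigcap_measurable => // i _.
  by rewrite -[X in measurable X]setTI; apply: mX => //; apply: open_measurable; exact: ball_open.
apply/seteqP; split => w /= H i; first by move=> _; rewrite /ball /= distrC; exact: H.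
by have := H i Logic.I; rewrite /ball /= distrC.
Qed.

End borel_vectors.

(** * Variables centred given a sub-sigma-algebra *)

Section expectation.
Context {R : realType} {d} {T : measurableType d} (P : probability T R).
Implicit Types (X Y Z W : T -> R) (F : set (set T)).

Definition rint X := P.-integrable setT (EFin \o X).
Definition rE X : R := \int[P]_w X w.

Lemma rint_meas X : rint X -> measurable_fun setT X.
Proof. by move=> /integrableP[/measurable_EFinP]. Qed.

Lemma rintD X Y : rint X -> rint Y -> rint (fun w => X w + Y w).
Proof. by move=> iX iY; exact: (integrableD measurableT iX iY). Qed.

Lemma rintZ (c : R) X : rint X -> rint (fun w => c * X w).
Proof. by move=> iX; exact: (integrableZl measurableT c iX). Qed.

Lemma rintB X Y : rint X -> rint Y -> rint (fun w => X w - Y w).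
Proof. by move=> iX iY; exact: (integrableB measurableT iX iY). Qed.

Lemma rint_cst (c : R) : rint (fun=> c).
Proof.
by apply: finite_measure_integrable_cst.
Qed.

Lemma rint_le X Y : measurable_fun setT X -> (forall w, `|X w| <= `|Y w|) ->
  rint Y -> rint X.
Proof.
move=> mX XY; apply: le_integrable => //; first exact/measurable_EFinP.
by move=> w _ /=; rewrite lee_fin.
Qed.

Lemma rint_sum n (X : 'I_n -> T -> R) : (forall i, rint (X i)) ->
  rint (fun w => \sum_(i < n) X i w).
Proof.
move=> iX; elim: n X iX => [|n IH] X iX.
  by under eq_fun do rewrite big_ord0; exact: rint_cst.
under eq_fun do rewrite big_ord_recr /=.
by apply: rintD => //; exact: IH.
Qed.

Lemma rED X Y : rint X -> rint Y -> rE (fun w => X w + Y w) = rE X + rE Y.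
Proof. by move=> iX iY; exact: RintegralD. Qed.

Lemma rEB X Y : rint X -> rint Y -> rE (fun w => X w - Y w) = rE X - rE Y.
Proof. by move=> iX iY; exact: RintegralB. Qed.

Lemma rEZ (c : R) X : rint X -> rE (fun w => c * X w) = c * rE X.
Proof. by move=> iX; exact: RintegralZl. Qed.

Lemma rE_le X Y : rint X -> rint Y -> (forall w, X w <= Y w) -> rE X <= rE Y.
Proof. by move=> iX iY XY; apply: le_Rintegral. Qed.

Lemma rE_ge0 X : (forall w, 0 <= X w) -> 0 <= rE X.
Proof. by move=> X0; apply: Rintegral_ge0. Qed.

Lemma rE_cst (c : R) : rE (fun=> c) = c.
Proof. by rewrite /rE Rintegral_cst //= probability_setT mulr1. Qed.

Lemma rE_sum n (X : 'I_n -> T -> R) : (forall i, rint (X i)) ->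
  rE (fun w => \sum_(i < n) X i w) = \sum_(i < n) rE (X i).
Proof.
move=> iX; elim: n X iX => [|n IH] X iX.
  by under eq_fun do rewrite big_ord0; rewrite rE_cst big_ord0.
under eq_fun do rewrite big_ord_recr /=.
by rewrite rED ?IH ?big_ord_recr //; exact: rint_sum.
Qed.

(** Abstracts a variable minus a version of its conditional expectation given [F]. *)
Definition null_on F W := rint W /\
  forall A, F A -> measurable A /\ (\int[P]_(w in A) (W w)%:E = 0)%E.

Definition sub_meas F X := forall B : set R, measurable B -> F (X @^-1` B).

Lemma null_on_indic F W A : null_on F W -> F A ->
  rint (fun w => W w * \1_A w) /\ rE (fun w => W w * \1_A w) = 0.
Proof.
move=> [iW nW] FA; have [mA A0] := nW A FA; split.
  apply: (rint_le _ _ iW).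
    by apply: measurable_funM; [exact: rint_meas|exact: measurable_indic].
  move=> w; rewrite normrM ler_piMr // indicE.
  by case: (w \in A); rewrite ?normr1 ?normr0.
rewrite /rE /Rintegral -[RHS]/(fine 0%E) -A0; congr fine.
rewrite [RHS]integral_mkcond.
apply: eq_integral => w _; rewrite patchE indicE.
by case: (w \in A); rewrite ?mulr1 ?mulr0.
Qed.

(** The dyadic approximations of [X] are combinations of indicators of sets in [F], against which
    [W] integrates to zero. They increase to [X], and [W * X] dominates. *)
Lemma null_on_ge0 F W X : null_on F W -> sub_meas F X -> (forall w, 0 <= X w) ->
  rint (fun w => W w * X w) -> rE (fun w => W w * X w) = 0.
Proof.
move=> nW FX X0 iWX; have [iW _] := nW; have mW := rint_meas iW.
pose a := approx setT (EFin \o X).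
have good n : rint (fun w => W w * a n w) /\ rE (fun w => W w * a n w) = 0.
  have FB : F (integer_approx setT (EFin \o X) n).
    rewrite /integer_approx setTI.
    have := FX `[n%:R, +oo[%classic (measurable_itv _); congr F.
    by apply/seteqP; split => w /=; rewrite in_itv /= andbT lee_fin.
  have FA k : (k < n * 2 ^ n)%N -> F (dyadic_approx setT (EFin \o X) n k).
    move=> kn; rewrite /dyadic_approx kn setTI.
    have := FX [set` dyadic_itv R n k] (measurable_itv _); congr F.
    apply/seteqP; split => w /=; first by move=> H; rewrite inE; exists (X w).
    by rewrite inE /= => -[r rI [<-]].
  have E : (fun w => W w * a n w) = (fun w =>
      \sum_(k < n * 2 ^ n) (k%:R * 2 ^- n) *
          (W w * \1_(dyadic_approx setT (EFin \o X) n k) w)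
      + n%:R * (W w * \1_(integer_approx setT (EFin \o X) n) w)).
    apply/funext => w; rewrite /a /approx mulrDr big_distrr /=; congr (_ + _); last by ring.
    by apply: eq_bigr => k _; ring.
  have iA (k : 'I_(n * 2 ^ n)) := null_on_indic nW (FA _ (ltn_ord k)).
  have [iB eB] := null_on_indic nW FB.
  rewrite E; split.
    apply: rintD; last exact: rintZ.
    by apply: rint_sum => k; apply: rintZ; exact: (iA k).1.
  rewrite rED; last exact: rintZ.
    rewrite rE_sum; last by move=> k; apply: rintZ; exact: (iA k).1.
    rewrite rEZ // eB mulr0 addr0 big1 // => k _.
    by rewrite rEZ ?(iA k).2 ?mulr0 //; exact: (iA k).1.
  by apply: rint_sum => k; apply: rintZ; exact: (iA k).1.
have a0 n w : 0 <= a n w.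
  rewrite /a /approx addr_ge0 ?mulr_ge0 ?indicE //.
  by apply: sumr_ge0 => k _; rewrite mulr_ge0 // mulr_ge0 // invr_ge0.
have aX n w : a n w <= X w.
  by rewrite -lee_fin; apply: (@le_approx _ _ _ setT (EFin \o X) n w) => // x _; rewrite lee_fin.
have [] := @dominated_convergence _ _ _ P setT measurableT
  (fun n w => (W w * a n w)%:E) (fun w => (W w * X w)%:E) (fun w => `|W w * X w|%:E).
- by move=> n; apply/measurable_EFinP; exact: rint_meas (good n).1.
- by apply/measurable_EFinP; exact: rint_meas.
- apply: aeW => w _; apply: cvg_EFin; first by near=> n.
  have /= cX := @cvg_approx _ _ R setT (EFin \o X) w (fun x _ => X0 x) Logic.I (ltry _).
  by apply: cvgM; [exact: cvg_cst|exact: cX].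
- exact: integrable_norm.
- apply: aeW => w n _; rewrite abse_EFin lee_fin !normrM ler_wpM2l //.
  by rewrite !ger0_norm.
move=> _ _ H.
have H0 : (\int[P]_w (W w * a n w)%:E)%E @[n --> \oo] --> 0%E.
  rewrite (_ : (fun _ => _) = fun=> 0%E); first exact: cvg_cst.
  apply/funext => n; have [ig eg] := good n.
  rewrite -[LHS]fineK; last exact: integrable_fin_num.
  by rewrite -[fine _]/(rE (fun w => W w * a n w)) eg.
by rewrite /rE /Rintegral -(cvg_unique _ H0 H).
Unshelve. all: by end_near. Qed.

(** Positive and negative parts of [X] are treated separately; each is bounded by the absolute value
    of [X], so its product with [W] stays integrable. *)
Lemma null_on_prod F W X : null_on F W -> sub_meas F X ->
  rint (fun w => W w * X w) -> rE (fun w => W w * X w) = 0.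
Proof.
move=> nW FX iWX; have [iW _] := nW.
have sub (h : R -> R) : measurable_fun setT h -> sub_meas F (h \o X).
  by move=> mh B mB; rewrite comp_preimage; apply: FX; rewrite -[X in measurable X]setTI; exact: mh.
have mX : measurable_fun setT X.
  by move=> _ B mB; rewrite setTI; have [_ H] := nW; exact: (H _ (FX _ mB)).1.
have part (h : R -> R) : measurable_fun setT h -> (forall r, 0 <= h r <= `|r|) ->
    rint (fun w => W w * h (X w)) /\ rE (fun w => W w * h (X w)) = 0.
  move=> mh hr.
  have ih : rint (fun w => W w * h (X w)).
    apply: (rint_le _ _ iWX).
      by apply: measurable_funM; [exact: rint_meas|exact: measurableT_comp].
    move=> w; rewrite !normrM ler_wpM2l //.
    by have /andP[h0 h1] := hr (X w); rewrite ger0_norm.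
  split=> //; apply: (null_on_ge0 nW (sub h mh)) => // w.
  by have /andP[] := hr (X w).
have [|r|i1 e1] := part (fun r => Num.max r 0).
- by apply: measurable_maxr.
- rewrite le_max lexx orbT /= ge_max normr_ge0 ler_norm //.
have [|r|i2 e2] := part (fun r => Num.max (- r) 0).
- by apply: measurable_maxr => //; exact: measurable_funN.
- by rewrite le_max lexx orbT /= ge_max normr_ge0 -normrN ler_norm.
have -> : (fun w => W w * X w) =
    (fun w => W w * Num.max (X w) 0 - W w * Num.max (- X w) 0).
  apply/funext => w; rewrite -mulrBr; congr (_ * _).
  have [x0|/ltW x0] := leP 0 (X w).
    by rewrite max_r ?oppr_le0 // subr0.
  by rewrite max_l ?oppr_ge0 // sub0r opprK.
by rewrite rEB // e1 e2 subrr.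
Qed.

Lemma cond_exp_null F Z V : (forall A, F A -> measurable A) -> cond_exp P F Z V ->
  null_on F (fun w => Z w - V w).
Proof.
move=> Fm [iZ iV _ ZV]; split; first exact: rintB.
move=> A FA; have mA := Fm A FA; split => //.
have iS Y : rint Y -> P.-integrable A (EFin \o Y).
  by move=> iY; apply: (integrableS measurableT mA _ iY).
under eq_integral do rewrite EFinB.
have iZA := iS _ iZ; have iVA := iS _ iV.
rewrite (@integralB _ _ _ P A mA (EFin \o Z) (EFin \o V)) //.
have -> : (\int[P]_(w in A) (EFin \o Z) w = \int[P]_(w in A) (EFin \o V) w)%E by exact: ZV.
by rewrite subee //; exact: integrable_fin_num.
Qed.

Lemma cond_exp_le_rE F Z (c : R) : F setT -> cond_exp_le P F Z c ->
  rint Z /\ rE Z <= c.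
Proof.
move=> FT [V [iZ iV _ ZV] Vc]; split => //.
have -> : rE Z = rE V by rewrite /rE /Rintegral ZV.
have mV := rint_meas iV.
(* The bound holds almost everywhere only; truncation at [c] makes it pointwise without changing the
   integral. *)
have mm : measurable_fun setT (fun w => Num.min (V w) c) by exact: measurable_minr.
have im : rint (fun w => Num.min (V w) c).
  apply: (rint_le mm _ (rintD (integrable_norm iV) (rint_cst `|c|))) => w /=.
  rewrite [leRHS]ger0_norm ?addr_ge0 //.
  by have [_|_] := leP (V w) c; rewrite ?lerDl ?lerDr.
have -> : rE V = rE (fun w => Num.min (V w) c).
  rewrite /rE /Rintegral; congr fine; apply: ae_eq_integral => //.
  - exact/measurable_EFinP.
  - exact/measurable_EFinP.
  - by apply: filterS Vc => w Vw _; rewrite min_l.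
rewrite -[leRHS](rE_cst c); apply: rE_le => //; first exact: rint_cst.
by move=> w; rewrite ge_min lexx orbT.
Qed.

End expectation.

Section lipschitz.
Context {R : realType}.

Lemma lipschitz_continuous n k (F : 'rV[R]_n -> 'rV[R]_k) (L : R) :
  (forall a b, enorm (F a - F b) <= L * enorm (a - b)) -> continuous F.
Proof.
move=> FL x; apply/(cvgrPdist_lt (FF := nbhs_filter x)) => e e0.
have L0 : 0 < `|L| + 1 by rewrite ltr_wpDl.
have e1 : 0 < e / (`|L| + 1) by rewrite divr_gt0.
apply: (@filterS _ (nbhs x) (nbhs_filter x) _ _ _ (ball_enorm x e1)) => y.
rewrite ltr_pdivlMr // => xy.
apply: le_lt_trans (norm_le_enorm _) _; apply: le_lt_trans (FL _ _) _.
apply: le_lt_trans xy; rewrite mulrC ler_wpM2l ?enorm_ge0 //.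
by rewrite (le_trans (ler_norm L)) // lerDl.
Qed.

End lipschitz.

(** * Square-integrable random vectors and oracle noise *)

Section square_integrable.
Context {R : realType} {d} {T : measurableType d} (P : probability T R).

(** Integrability is bundled with the value so that the expectation of a long linear combination is
    assembled by applying lemmas. *)
Definition is_rE (X : T -> R) (e : R) := rint P X /\ rE P X = e.

Lemma is_rED X Y a b : is_rE X a -> is_rE Y b -> is_rE (fun w => X w + Y w) (a + b).
Proof. by move=> [iX eX] [iY eY]; split; [exact: rintD|rewrite rED // eX eY]. Qed.

Lemma is_rEB X Y a b : is_rE X a -> is_rE Y b -> is_rE (fun w => X w - Y w) (a - b).
Proof. by move=> [iX eX] [iY eY]; split; [exact: rintB|rewrite rEB // eX eY]. Qed.

Lemma is_rEZ X c a : is_rE X a -> is_rE (fun w => c * X w) (c * a).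
Proof. by move=> [iX eX]; split; [exact: rintZ|rewrite rEZ // eX]. Qed.

Lemma is_rE_le X Y a b : is_rE X a -> is_rE Y b -> (forall w, X w <= Y w) -> a <= b.
Proof. by move=> [iX <-] [iY <-]; exact: rE_le. Qed.

Definition vL2 k (Z : T -> 'rV[R]_k) :=
  (forall i, measurable_fun setT (fun w => Z w 0 i)) /\ rint P (fun w => dot (Z w) (Z w)).

Lemma measurable_dot k (Z Y : T -> 'rV[R]_k) :
  (forall i, measurable_fun setT (fun w => Z w 0 i)) ->
  (forall i, measurable_fun setT (fun w => Y w 0 i)) ->
  measurable_fun setT (fun w => dot (Z w) (Y w)).
Proof.
move=> mZ mY; apply: measurable_sum => i; exact: measurable_funM.
Qed.

Lemma vL2_le k (Z : T -> 'rV[R]_k) (X : T -> R) :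
  (forall i, measurable_fun setT (fun w => Z w 0 i)) ->
  (forall w, dot (Z w) (Z w) <= X w) -> rint P X -> vL2 Z.
Proof.
move=> mZ ZX iX; split=> //; apply: rint_le iX; first exact: measurable_dot.
by move=> w; rewrite ger0_norm ?dot_ge0 // (le_trans (ZX w)) // ler_norm.
Qed.

Lemma vL2Z k (c : R) (Z : T -> 'rV[R]_k) : vL2 Z -> vL2 (fun w => c *: Z w).
Proof.
move=> [mZ iZ]; split.
  by move=> i; under eq_fun do rewrite mxE; exact: measurable_funM.
by under eq_fun do rewrite dotZl dotZr; do 2 apply: rintZ.
Qed.

Lemma vL2D k (Z Y : T -> 'rV[R]_k) : vL2 Z -> vL2 Y -> vL2 (fun w => Z w + Y w).
Proof.
move=> [mZ iZ] [mY iY]; apply: (vL2_le (X := fun w => 2 * dot (Z w) (Z w) + 2 * dot (Y w) (Y w))).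
- by move=> i; under eq_fun do rewrite mxE; exact: measurable_funD.
- by move=> w; exact: enormD_sqr.
- by apply: rintD; exact: rintZ.
Qed.

Lemma vL2N k (Z : T -> 'rV[R]_k) : vL2 Z -> vL2 (fun w => - Z w).
Proof. by move=> /(vL2Z (-1)); under eq_fun do rewrite scaleN1r. Qed.

Lemma vL2B k (Z Y : T -> 'rV[R]_k) : vL2 Z -> vL2 Y -> vL2 (fun w => Z w - Y w).
Proof. by move=> iZ /vL2N; exact: vL2D. Qed.

Lemma vL2_cst k (z : 'rV[R]_k) : vL2 (fun=> z).
Proof. by split; [move=> i; exact: measurable_cst|exact: rint_cst]. Qed.

Lemma rint_dot k (Z Y : T -> 'rV[R]_k) : vL2 Z -> vL2 Y ->
  rint P (fun w => dot (Z w) (Y w)).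
Proof.
move=> [mZ iZ] [mY iY]; apply: rint_le (rintD iZ iY); first exact: measurable_dot.
move=> w; rewrite [leRHS]ger0_norm ?addr_ge0 ?dot_ge0 // ler_norml.
have := dot_ge0 (Z w + Y w); have := dot_ge0 (Z w - Y w).
rewrite !dotE (dotC (Y w) (Z w)) => *.
have Z0 := dot_ge0 (Z w); have Y0 := dot_ge0 (Y w).
by apply/andP; split; lra.
Qed.

Lemma vL2_nonexpansive k l (F : 'rV[R]_k -> 'rV[R]_l) (Z : T -> 'rV[R]_k) :
  (forall a b, enorm (F a - F b) <= enorm (a - b)) -> vL2 Z -> vL2 (fun w => F (Z w)).
Proof.
move=> FL vZ; have [mZ _] := vZ.
have cF : continuous F.
  by apply: (@lipschitz_continuous _ _ _ _ 1) => a b; rewrite mul1r.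
have mF : measurable_fun setT (F \o Z : T -> borel l).
  apply: (@measurableT_comp _ _ _ _ (borel k) (borel l)); first exact: continuous_borel.
  exact: measurable_vector.
apply: (vL2_le (X := fun w => 2 * dot (Z w) (Z w) + 2 * dot (F 0) (F 0))).
- by move=> i; exact: (measurableT_comp (measurable_coord i) mF).
- move=> w; have := enormD_sqr (F (Z w) - F 0) (F 0); rewrite subrK => /le_trans; apply.
  rewrite lerD2r ler_pM2l // -!enorm_sqr ler_sqr ?nnegrE ?enorm_ge0 //.
  by have := FL (Z w) 0; rewrite subr0.
- by apply: rintD; [apply: rintZ; exact: vZ.2|exact: rint_cst].
Qed.

Section noise.
Context {n m k : nat}.
Variables (X : T -> 'rV[R]_n) (Y : T -> 'rV[R]_m) (O G : T -> 'rV[R]_k) (delta : R).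
Hypotheses (mX : measurable_fun setT (X : T -> borel n))
  (mY : measurable_fun setT (Y : T -> borel m)).
Hypothesis OG : cond_exp_vec P (sigma2 X Y) O G.
Hypothesis OGd : cond_exp_le P (sigma2 X Y) (fun w => enorm (O w - G w) ^+ 2) (delta ^+ 2).

Lemma sigma2_measurable A : sigma2 X Y A -> measurable A.
Proof.
apply: smallest_sub; first exact: sigma_algebra_measurable.
by move=> _ [[B mB <-]|[B mB <-]]; [exact: mX|exact: mY].
Qed.

Lemma sigma2T : sigma2 X Y setT.
Proof. by apply: sub_sigma_algebra; left; exists setT => //; rewrite setTI. Qed.

Lemma measurable_coordB l (p : 'rV[R]_l) i :
  measurable_fun [set: borel l] ((fun v => (v - p) 0 i) : borel l -> R).
Proof.
rewrite (_ : (fun _ => _) = fun v : borel l => (v : 'rV[R]_l) 0 i - p 0 i).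
  by apply: measurable_funB; [exact: measurable_coord|exact: measurable_cst].
by apply/funext => v; rewrite !mxE.
Qed.

Lemma sigma2_subl (p : 'rV[R]_n) i : sub_meas (sigma2 X Y) (fun w => (X w - p) 0 i).
Proof.
move=> B mB; apply: sub_sigma_algebra; left.
exists ((fun v : borel n => (v - p) 0 i) @^-1` B); last by rewrite setTI.
by have := measurable_coordB p i measurableT mB; rewrite setTI.
Qed.

Lemma sigma2_subr (p : 'rV[R]_m) i : sub_meas (sigma2 X Y) (fun w => (Y w - p) 0 i).
Proof.
move=> B mB; apply: sub_sigma_algebra; right.
exists ((fun v : borel m => (v - p) 0 i) @^-1` B); last by rewrite setTI.
by have := measurable_coordB p i measurableT mB; rewrite setTI.
Qed.

Lemma noise_measurable i : measurable_fun setT (fun w => G w 0 i).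
Proof.
have [_ iG _ _] := OG i; exact: (rint_meas iG).
Qed.

Lemma noise_vL2 : vL2 (fun w => O w - G w).
Proof.
have [i2 _] := cond_exp_le_rE sigma2T OGd; split.
  move=> i; have [iO iG _ _] := OG i; under eq_fun do rewrite !mxE.
  by apply: measurable_funB; [exact: (rint_meas iO)|exact: (rint_meas iG)].
by move: i2; under eq_fun do rewrite enorm_sqr.
Qed.

Lemma noise_variance : rE P (fun w => dot (O w - G w) (O w - G w)) <= delta ^+ 2.
Proof.
have [_] := cond_exp_le_rE sigma2T OGd.
by under eq_fun do rewrite enorm_sqr.
Qed.

(** Applied one coordinate at a time; each product is integrable because it is dominated by the sum
    of the two squared norms. *)
Lemma noise_orthogonal (Z : T -> 'rV[R]_k) : vL2 Z ->
  (forall i, sub_meas (sigma2 X Y) (fun w => Z w 0 i)) ->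
  is_rE (fun w => dot (O w - G w) (Z w)) 0.
Proof.
move=> vZ FZ; split; first exact: rint_dot noise_vL2 vZ.
have iOZ i : rint P (fun w => (O w - G w) 0 i * Z w 0 i).
  have [mD iD] := noise_vL2; have [mZ iZ] := vZ.
  apply: (rint_le _ _ (rintD iD iZ)); first exact: measurable_funM.
  move=> w; rewrite [leRHS]ger0_norm ?addr_ge0 ?dot_ge0 // normrM.
  set D := O w - G w.
  have D2 : `|D 0 i| ^+ 2 <= dot D D.
    by rewrite -enorm_sqr ler_sqr ?nnegrE ?enorm_ge0 // coord_le_enorm.
  have Z2 : `|Z w 0 i| ^+ 2 <= dot (Z w) (Z w).
    by rewrite -enorm_sqr ler_sqr ?nnegrE ?enorm_ge0 // coord_le_enorm.
  have := sqr_ge0 (`|D 0 i| - `|Z w 0 i|).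
  have := sqr_ge0 (`|D 0 i| + `|Z w 0 i|); lra.
rewrite /dot rE_sum // big1 // => i _.
have N := cond_exp_null sigma2_measurable (OG i).
have E : (fun w => (O w - G w) 0 i * Z w 0 i) =
         (fun w => (O w 0 i - G w 0 i) * Z w 0 i).
  by apply/funext => w; rewrite !mxE.
by rewrite E; apply: (null_on_prod N (FZ i)); rewrite -E.
Qed.

End noise.
End square_integrable.

(** * The scalar recursion and the choice of parameters *)

Section scalar_recursion.
Context {R : realType}.

(** [a], [b] are mean squared distances and [u], [v] mean squared increments. The potential [U] is
    [h] times the left-hand side at the same index; each coefficient on the right, times [1 + h], is
    at most the one in [U]. For [u] and [v] this is where the bounds on [h * K] enter: given
    [h <= 1 / 4], the factor [16] is what the [v] term asks for. *)
Lemma contraction_bound (a b u v : nat -> R) (h mux muy K Q : R) :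
  0 < h <= 4^-1 -> 0 < mux -> 0 < muy -> 0 <= K -> 0 <= Q ->
  5 * h * K <= mux -> 16 * h * K <= muy ->
  (forall k, 0 <= a k) -> (forall k, 0 <= b k) ->
  (forall k, 0 <= u k) -> (forall k, 0 <= v k) -> u 0%N = 0 -> v 0%N = 0 ->
  (forall k,
    (mux / h + mux) * a k.+1 + (muy * (1 - h) / h + muy) * b k.+1
    + (mux / (2 * h) - K) * u k.+1 + (muy * (1 - h) / (2 * h) - K) * v k.+1 <=
    mux / h * a k + muy * (1 - h) / h * b k + K * u k
    + (K + muy * (1 - h) / (4 * h)) * v k + h * Q) ->
  forall k, a k <= (1 + h) ^- k * (2 * a 0%N + muy / mux * b 0%N) + 2 * h * Q / mux.
Proof.
move=> /andP[h0 h4] mux0 muy0 K0 Q0 Kx Ky a0 b0 u0 v0 u00 v00 step.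
(* Everything is multiplied by [h] to clear the denominators. *)
pose U k := mux * (1 + h) * a k + muy * b k + (mux / 2 - h * K) * u k
  + (muy * (1 - h) / 2 - h * K) * v k.
have h1 : h <= 1 by rewrite (le_trans h4) // invf_le1 // ler1n.
have hK : 0 <= h * K by rewrite mulr_ge0 // ltW.
have Kx' : 5 * (h * K) <= mux by rewrite mulrA.
have Ky' : 16 * (h * K) <= muy by rewrite mulrA.
have muyh : muy * 3 / 4 <= muy * (1 - h) by rewrite -mulrA ler_pM2l //; lra.
have stepU k : (1 + h) * U k.+1 <= U k + (1 + h) * (h ^+ 2 * Q).
  have := step k; rewrite -(ler_pM2l h0) => S.
  have {}S : U k.+1 <= mux * a k + muy * (1 - h) * b k + h * K * u k
      + (h * K + muy * (1 - h) / 4) * v k + h ^+ 2 * Q.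
    move: S; rewrite /U => S; apply: le_trans (le_trans _ S) _.
      by rewrite le_eqVlt; apply/orP; left; apply/eqP; field; rewrite gt_eqF.
    by rewrite le_eqVlt; apply/orP; left; apply/eqP; field; rewrite gt_eqF.
  have {}S := ler_wpM2l (addr_ge0 ler01 (ltW h0)) S.
  apply: le_trans S _; rewrite mulrDr lerD2r /U !mulrDr; apply: lerD; last first.
    rewrite mulrA; apply: ler_wpM2r => //.
    have : h * (h * K) <= 4^-1 * (h * K) by rewrite ler_wpM2r.
    have : h * (muy * (1 - h)) <= 4^-1 * (muy * (1 - h)).
      by rewrite ler_wpM2r // mulr_ge0 ?(ltW muy0) // subr_ge0.
    lra.
  apply: lerD; last first.
    rewrite mulrA; apply: ler_wpM2r => //.
    have : h * (h * K) <= 4^-1 * (h * K) by rewrite ler_wpM2r.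
    lra.
  apply: lerD; first by rewrite le_eqVlt; apply/orP; left; apply/eqP; ring.
  rewrite mulrA; apply: ler_wpM2r => //.
  have := mulr_ge0 (ltW muy0) (sqr_ge0 h); lra.
have p1 : 0 < 1 + h by rewrite addr_gt0.
(* The fixed point of the recursion is [(1 + h) * h * Q], which is below [2 * h * Q]. *)
have boundU k : U k <= (1 + h) ^- k * U 0%N + 2 * h * Q.
  elim: k => [|k IH].
    by rewrite expr0 invr1 mul1r lerDl mulr_ge0 // mulr_ge0 // ltW.
  rewrite -(ler_pM2l p1) (le_trans (stepU k)) // (le_trans (lerD IH (lexx _))) //.
  have -> : (1 + h) * ((1 + h) ^- k.+1 * U 0%N + 2 * h * Q) =
      (1 + h) ^- k * U 0%N + (1 + h) * (2 * h * Q).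
    have E : (1 + h) * (1 + h) ^- k.+1 = (1 + h) ^- k.
      by rewrite exprS invfM mulrA mulfV ?mul1r // gt_eqF.
    by move: (U 0%N) => U0; rewrite mulrDr -E !mulrA.
  have : 0 <= h ^+ 2 * Q * (1 - h) by rewrite mulr_ge0 ?subr_ge0 // mulr_ge0 // sqr_ge0.
  lra.
move=> k; have := boundU k.
have U0E : U 0%N = mux * (1 + h) * a 0%N + muy * b 0%N.
  by rewrite /U u00 v00 !mulr0 !addr0.
have : mux * a k <= U k.
  rewrite /U.
  have : 0 <= mux * h * a k by rewrite mulr_ge0 // mulr_ge0 // ltW.
  have : 0 <= muy * b k by rewrite mulr_ge0 // ltW.
  have : 0 <= (mux / 2 - h * K) * u k by rewrite mulr_ge0 //; lra.
  have : 0 <= (muy * (1 - h) / 2 - h * K) * v k by rewrite mulr_ge0 //; lra.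
  lra.
rewrite U0E => H1 H2; have {H1 H2}H := le_trans H1 H2.
rewrite -(ler_pM2l mux0); apply: le_trans H _.
have -> : mux * ((1 + h) ^- k * (2 * a 0%N + muy / mux * b 0%N) + 2 * h * Q / mux) =
  (1 + h) ^- k * (mux * 2 * a 0%N + muy * b 0%N) + 2 * h * Q.
  by move: ((1 + h) ^- k) => r; field; rewrite gt_eqF.
rewrite lerD2r ler_wpM2l ?invr_ge0 ?exprn_ge0 ?(ltW p1) // lerD2r.
by rewrite ler_wpM2r // ler_pM2l //; lra.
Qed.

(** The threshold does not involve [eps], so a strict bound makes [theta = 1 - h] admissible for all
    small [h]. The value [beta = 1 / 2] is legitimate whether or not [Lyy] vanishes. *)
Lemma theta_bar_lt1 (gamma muy Lxx Lyx Lyy mux : R) :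
  0 < gamma -> 0 < muy -> 0 <= Lxx -> 0 < Lyx -> 0 < mux ->
  theta_bar gamma muy Lxx Lyx Lyy mux 2^-1 < 1.
Proof.
move=> g0 my0 Lxx0 Lyx0 mx0.
have sqrt_gt (x : R) : 0 < x -> 0 < Num.sqrt (1 + x) - 1.
  by move=> x0; rewrite subr_gt0 -{1}sqrtr1 ltr_sqrt ?ltrDl // addr_gt0.
have L'0 : 0 < Lxx' gamma Lxx mux by rewrite /Lxx' addr_gt0 // ltr_wpDl.
have half0 : (0 : R) < 2^-1 by rewrite invr_gt0.
rewrite /theta_bar gt_max; apply/andP; split.
  rewrite /theta_bar1 gtrBl mulr_gt0 //; first by rewrite !divr_gt0 // !mulr_gt0 // exprn_gt0.
  by apply: sqrt_gt; rewrite divr_gt0 // !mulr_gt0 // exprn_gt0.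
rewrite /theta_bar2; case: ifP => // Lyy0.
have h2 : (0 : R) < 1 - 2^-1 by rewrite subr_gt0 invf_lt1 // ltr1n.
rewrite gtrBl mulr_gt0 //.
  by rewrite mulr_gt0 // divr_gt0 // exprn_gt0.
by apply: sqrt_gt; rewrite divr_gt0 // mulr_gt0 // exprn_gt0.
Qed.

(** By Bernoulli's inequality [m1] steps, about [1 / h], double the power; [m2] doublings reach
    [Z]. *)
Lemma exists_contraction_power (h Z : R) : 0 < h <= 1 -> 1 <= Z ->
  exists M : nat, (1 + h) ^- M <= Z^-1 /\ M%:R <= 2 / h * (ln Z / ln 2 + 1).
Proof.
move=> /andP[h0 h1] Z1.
have Z0 : 0 < Z by exact: lt_le_trans Z1.
have ln2 : 0 < ln (2 : R) by rewrite ln_gt0 // ltr1n.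
have lnZ : 0 <= ln Z by rewrite ln_ge0.
have hi : 1 <= h^-1 by rewrite invf_ge1.
pose m1 := (Num.truncn h^-1).+1; pose m2 := (Num.truncn (ln Z / ln 2)).+1.
have m1_gt : h^-1 < m1%:R by exact: truncnS_gt.
have m2_gt : ln Z / ln 2 < m2%:R by exact: truncnS_gt.
have m1_le : m1%:R <= h^-1 + 1.
  by rewrite /m1 /m2 -natr1 lerD2r truncn_le // invr_ge0 ltW.
have m2_le : m2%:R <= ln Z / ln 2 + 1.
  by rewrite /m1 /m2 -natr1 lerD2r truncn_le // divr_ge0 // ltW.
exists (m1 * m2)%N; split.
  rewrite lef_pV2 ?posrE // ?exprn_gt0 ?addr_gt0 //.
  have two : 2 <= (1 + h) ^+ m1.
    apply: (@le_trans _ _ (1 + m1%:R * h)).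
      by rewrite -[2]/(1 + 1) lerD2l -ler_pdivrMr // mul1r ltW.
    elim: m1 {m1_gt m1_le} => [|k IH]; first by rewrite mul0r addr0 expr0.
    rewrite exprS; apply: le_trans (ler_wpM2l _ IH); last by rewrite addr_ge0 // ltW.
    have : 0 <= k%:R * h * h by rewrite !mulr_ge0 // ltW.
    rewrite -natr1; lra.
  apply: (@le_trans _ _ (2 ^+ m2)); last first.
    by rewrite exprM; apply: lerXn2r; rewrite ?nnegrE // exprn_ge0 // addr_ge0 // ltW.
  rewrite -ler_ln ?posrE // ?exprn_gt0 //.
  have -> : ln ((2 : R) ^+ m2) = m2%:R * ln 2 by rewrite lnXn // mulr_natl.
  by rewrite -ler_pdivrMr // ltW.
rewrite natrM; apply: ler_pM => //; apply: le_trans m1_le _.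
lra.
Qed.

End scalar_recursion.

(** * Moments of the iterates and complexity *)

Section lower_integral.
Import HBNNSimple.
Context {R : realType}.
Local Open Scope ereal_scope.

(* No measurability is needed: the integral of a nonnegative function is a
   supremum over the simple functions below it. *)
Lemma le_lower_integral d (T : measurableType d) (mu : {measure set T -> \bar R})
  (F G : T -> \bar R) : (forall x, 0 <= F x) -> (forall x, F x <= G x) ->
  \int[mu]_x F x <= \int[mu]_x G x.
Proof.
move=> F0 FG; have G0 x : 0 <= G x by exact: le_trans (FG x).
rewrite !ge0_integralE //; apply/ereal_supP => _ /= [s sF <-].
apply: ereal_sup_ubound; exists s => //= x.
by apply: le_trans (sF x) _; rewrite !patchT ?inE.
Qed.

(** Half of Tonelli's theorem for a possibly non-measurable integrand: Tonelli is applied to each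
    simple function below [F]. *)
Lemma lower_integral_prod d1 d2 (T1 : measurableType d1) (T2 : measurableType d2)
  (P1 : probability T1 R) (P2 : probability T2 R)
  (F : T1 * T2 -> \bar R) (B : T1 -> \bar R) : (forall z, 0 <= F z) ->
  (forall x, \int[P2]_y F (x, y) <= B x) ->
  \int[(P1 \x P2)]_z F z <= \int[P1]_x B x.
Proof.
move=> F0 FB; rewrite ge0_integralE //; apply/ereal_supP => _ /= [s sF <-].
rewrite -integralT_nnsfun.
have mS : measurable_fun setT (EFin \o s) by exact/measurable_EFinP.
rewrite fubini_tonelli1 //; last by move=> z; rewrite lee_fin.
apply: le_lower_integral => x.
  by apply: integral_ge0 => y _; rewrite lee_fin.
apply: le_trans (FB x); apply: le_lower_integral => y; first by rewrite lee_fin.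
by have := sF (x, y); rewrite patchT ?inE.
Qed.

End lower_integral.

(** * Mean-square analysis from a fixed starting point *)

Section sapd_moments.
Context {R : realType} {n m : nat}.
Variables (f : 'rV[R]_n -> \bar R) (g : 'rV[R]_m -> \bar R).
Variable Phi : 'rV[R]_n -> 'rV[R]_m -> R.
Variables gamma muy Lxx Lxy Lyx Lyy lambda : R.
Hypothesis Hstruct : structural_assumption f g Phi gamma muy.
Hypothesis Hsmooth : smoothness_assumption f g Phi Lxx Lxy Lyx Lyy.
Hypothesis Hlambda : 0 < lambda < gamma^-1.
Implicit Types (x w z : 'rV[R]_n) (y : 'rV[R]_m).

Let fcc : proper_closed_convex f. Proof. by case: Hstruct => -[]. Qed.
Let gcc : proper_closed_convex g. Proof. by case: Hstruct => -[]. Qed.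
Let muy0 : 0 < muy. Proof. by case: Hstruct => _ []. Qed.
Let lambda0 : 0 < lambda. Proof. by case/andP: Hlambda. Qed.
Context {dS dO : measure_display}.
Context {S : measurableType dS} {Omega : measurableType dO}.
Variable P : probability Omega R.
Variables (oraclex : 'rV[R]_n -> 'rV[R]_m -> S -> 'rV[R]_n).
Variables (oracley : 'rV[R]_n -> 'rV[R]_m -> S -> 'rV[R]_m).
Variables (omegax omegay : nat -> Omega -> S).
Variables (tau sigma theta deltax deltay : R) (x0 : 'rV[R]_n) (y0 : 'rV[R]_m).
Hypotheses (tau0 : 0 < tau) (sigma0 : 0 < sigma) (theta01 : 0 <= theta <= 1).
Hypotheses (fx0 : edom f x0) (gy0 : edom g y0).

Let mux := mux_of gamma lambda.
Let kappa := lambda^-1.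
Let mux0 : 0 < mux. Proof. exact: (mux_of_gt0 Hstruct Hlambda). Qed.
Let kappaE : mux + gamma = kappa. Proof. by rewrite /mux /mux_of subrK. Qed.
Let K := step_const gamma muy Lxx Lyx Lyy lambda.

Let X j (w : Omega) := sapd_x f g oraclex oracley omegax omegay gamma mux tau sigma theta x0 y0 w j.
Let Y j (w : Omega) := sapd_y f g oraclex oracley omegax omegay gamma mux tau sigma theta x0 y0 w j.
Let ox k (w : Omega) := oraclex (X k w) (Y k.+1 w) (omegax k w).
Let oy k (w : Omega) := oracley (X k w) (Y k w) (omegay k w).
Let gx k (w : Omega) := gradx Phi (X k w) (Y k.+1 w).
Let gy k (w : Omega) := grady Phi (X k w) (Y k w).

Hypothesis noise : forall k,
  [/\ cond_exp_vec P (sigma2 (X k) (Y k.+1)) (ox k) (gx k),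
      cond_exp_vec P (sigma2 (X k) (Y k)) (oy k) (gy k),
      cond_exp_le P (sigma2 (X k) (Y k.+1))
        (fun w : Omega => enorm (ox k w - gx k w) ^+ 2) (deltax ^+ 2) &
      cond_exp_le P (sigma2 (X k) (Y k))
        (fun w : Omega => enorm (oy k w - gy k w) ^+ 2) (deltay ^+ 2)].

Let xs := prox lambda (phi f g Phi) x0.
Let ys := ystar f g Phi xs.
Let fxs : edom f xs. Proof. exact: (prox_phi_edom Hstruct Hlambda). Qed.
Let gys : edom g ys. Proof. exact: (ystar_edom Hstruct). Qed.

(** Since [0.-1] is [0], the zero initial momentum is also a difference of oracle values, and the
    first step needs no separate treatment. *)
Lemma sapd_momentum k (w : Omega) :
  (sapd f g oraclex oracley omegax omegay gamma mux tau sigma theta x0 y0 w k).2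
  = oy k w - oy k.-1 w.
Proof.
case: k => [|k]; first by rewrite subrr.
by rewrite /oy /X /Y /sapd_x /sapd_y /=; case: (sapd _ _ _ _ _ _ _ _ _ _ _ _ _ _ k) => -[].
Qed.

Lemma sapd_yS k (w : Omega) : Y k.+1 w =
  prox sigma g (Y k w + sigma *: (oy k w + theta *: (oy k w - oy k.-1 w))).
Proof.
rewrite -sapd_momentum /oy /X /Y /sapd_x /sapd_y /=.
by case: (sapd _ _ _ _ _ _ _ _ _ _ _ _ _ _ k) => -[].
Qed.

Lemma sapd_xS k (w : Omega) : X k.+1 w =
  prox tau f (X k w - tau *: (ox k w + kappa *: (X k w - x0))).
Proof.
rewrite /ox /X /Y /sapd_x /sapd_y /= kappaE.
by case: (sapd _ _ _ _ _ _ _ _ _ _ _ _ _ _ k) => -[].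
Qed.

Lemma sapd_x_edom k (w : Omega) : edom f (X k w).
Proof. by case: k => [//|k]; rewrite sapd_xS; exact: prox_edom. Qed.

Lemma sapd_y_edom k (w : Omega) : edom g (Y k w).
Proof. by case: k => [//|k]; rewrite sapd_yS; exact: prox_edom. Qed.

Let fX := sapd_x_edom.
Let gY := sapd_y_edom.

Lemma oracley_vL2 k : vL2 P (X k) -> vL2 P (Y k) -> vL2 P (oy k).
Proof.
move=> vX vY; have [_ OG _ OGd] := noise k.
have vD := noise_vL2 OG OGd.
have -> : oy k = (fun w : Omega => (oy k w - gy k w) + gy k w).
  by apply/funext => w; rewrite subrK.
apply: vL2D => //.
have vXs := vL2B vX (vL2_cst P xs); have vYs := vL2B vY (vL2_cst P ys).
apply: (@vL2_le _ _ _ _ _ _ (fun w : Omega => 2 * (2 * Lyx ^+ 2 * dot (X k w - xs) (X k w - xs)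
    + 2 * Lyy ^+ 2 * dot (Y k w - ys) (Y k w - ys))
    + 2 * dot (grady Phi xs ys) (grady Phi xs ys))).
- exact: noise_measurable OG.
- move=> w; have := enormD_sqr (gy k w - grady Phi xs ys) (grady Phi xs ys).
  rewrite subrK => /le_trans; apply; rewrite lerD2r ler_pM2l //.
  exact: (grady_lip_sqr Hsmooth).
- apply: rintD; last exact: rint_cst.
  by apply: rintZ; apply: rintD; apply: rintZ; [exact: vXs.2|exact: vYs.2].
Qed.

Lemma oraclex_vL2 k : vL2 P (X k) -> vL2 P (Y k.+1) -> vL2 P (ox k).
Proof.
move=> vX vY; have [OG _ OGd _] := noise k.
have vD := noise_vL2 OG OGd.
have -> : ox k = (fun w : Omega => (ox k w - gx k w) + gx k w).
  by apply/funext => w; rewrite subrK.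
apply: vL2D => //.
have vXs := vL2B vX (vL2_cst P xs); have vYs := vL2B vY (vL2_cst P ys).
apply: (@vL2_le _ _ _ _ _ _ (fun w : Omega => 2 * (2 * Lxx ^+ 2 * dot (X k w - xs) (X k w - xs)
    + 2 * Lxy ^+ 2 * dot (Y k.+1 w - ys) (Y k.+1 w - ys))
    + 2 * dot (gradx Phi xs ys) (gradx Phi xs ys))).
- exact: noise_measurable OG.
- move=> w; have := enormD_sqr (gx k w - gradx Phi xs ys) (gradx Phi xs ys).
  rewrite subrK => /le_trans; apply; rewrite lerD2r ler_pM2l //.
  have := sqr_le_add (enorm_ge0 _) (gradx_lip Hsmooth (fX k w) fxs (gY k.+1 w) gys).
  by rewrite !exprMn !enorm_sqr !mulrA.
- apply: rintD; last exact: rint_cst.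
  by apply: rintZ; apply: rintD; apply: rintZ; [exact: vXs.2|exact: vYs.2].
Qed.

(** The induction also carries the previous oracle value, which enters the next step through the
    momentum. *)
Lemma iterates_vL2 k : vL2 P (X k) /\ vL2 P (Y k).
Proof.
have step j : vL2 P (X j) /\ vL2 P (Y j) -> vL2 P (oy j.-1) ->
    vL2 P (X j.+1) /\ vL2 P (Y j.+1).
  move=> [vX vY] vp; have vo := oracley_vL2 vX vY.
  have vY' : vL2 P (Y j.+1).
    have -> : Y j.+1 = fun w : Omega => prox sigma g (Y j w + sigma *: (oy j w + theta *: (oy j w - oy j.-1 w))).
      by apply/funext => w; exact: sapd_yS.
    apply: vL2_nonexpansive; first exact: prox_nonexpansive.
    by apply: vL2D => //; apply: vL2Z; apply: vL2D => //; apply: vL2Z; exact: vL2B.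
  split=> //; have vox := oraclex_vL2 vX vY'.
  have -> : X j.+1 = fun w : Omega => prox tau f (X j w - tau *: (ox j w + kappa *: (X j w - x0))).
    by apply/funext => w; exact: sapd_xS.
  apply: vL2_nonexpansive; first exact: prox_nonexpansive.
  apply: vL2B => //; apply: vL2Z; apply: vL2D => //; apply: vL2Z.
  by apply: vL2B => //; exact: vL2_cst.
have H : (vL2 P (X k) /\ vL2 P (Y k)) /\ vL2 P (oy k.-1).
  elim: k => [|k [IH1 IH2]].
    have H0 : vL2 P (X 0%N) /\ vL2 P (Y 0%N) by split; exact: vL2_cst.
    by split=> //; case: H0; exact: oracley_vL2.
  split; first exact: step.
  by case: IH1; exact: oracley_vL2.
exact: H.1.
Qed.

Let a k := rE P (fun w : Omega => dot (X k w - xs) (X k w - xs)).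
Let b k := rE P (fun w : Omega => dot (Y k w - ys) (Y k w - ys)).
Let u k := rE P (fun w : Omega => dot (X k w - X k.-1 w) (X k w - X k.-1 w)).
Let v k := rE P (fun w : Omega => dot (Y k w - Y k.-1 w) (Y k w - Y k.-1 w)).

(** Expectation of [sapd_step]. The pairings of [D k] with [Y k], of [D k.-1] with [Y k.-1] and of
    [Dx] with [X k] vanish; the weights [16] and [8] on the dual noise add up to [24]. *)
Lemma moments_step k :
  (tau^-1 + mux) * a k.+1 + (sigma^-1 + muy) * b k.+1
  + ((2 * tau)^-1 - K) * u k.+1 + ((2 * sigma)^-1 - K) * v k.+1 <=
    tau^-1 * a k + sigma^-1 * b k + K * u k + (K + (4 * sigma)^-1) * v k
    + (24 * sigma * deltay ^+ 2 + 2 * tau * deltax ^+ 2).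
Proof.
have vX j := (iterates_vL2 j).1; have vY j := (iterates_vL2 j).2.
have mX j : measurable_fun setT (X j : Omega -> borel n).
  by apply: measurable_vector; exact: (vX j).1.
have mY j : measurable_fun setT (Y j : Omega -> borel m).
  by apply: measurable_vector; exact: (vY j).1.
pose D j (w : Omega) := oy j w - gy j w; pose Dx (w : Omega) := ox k w - gx k w.
have vXs j := vL2B (vX j) (vL2_cst P xs).
have vYs j := vL2B (vY j) (vL2_cst P ys).
have vD j : vL2 P (D j) by have [_ OG _ OGd] := noise j; exact: noise_vL2 OG OGd.
have vDx : vL2 P Dx by have [OG _ OGd _] := noise k; exact: noise_vL2 OG OGd.
have eD j : exists2 r, is_rE P (fun w : Omega => dot (D j w) (D j w)) r & r <= deltay ^+ 2.
  eexists; first by split; [exact: (vD j).2|].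
  by have [_ OG _ OGd] := noise j; exact: noise_variance OGd.
have [r3 eDx r3_le] :
    exists2 r, is_rE P (fun w : Omega => dot (Dx w) (Dx w)) r & r <= deltax ^+ 2.
  eexists; first by split; [exact: vDx.2|].
  by have [OG _ OGd _] := noise k; exact: noise_variance OGd.
have [r1 eD1 r1_le] := eD k; have [r2 eD2 r2_le] := eD k.-1.
have oD j : is_rE P (fun w : Omega => dot (D j w) (Y j w - ys)) 0.
  have [_ OG _ OGd] := noise j.
  apply: (noise_orthogonal (mX j) (mY j) OG OGd (vYs j)) => i.
  exact: sigma2_subr.
have oDx : is_rE P (fun w : Omega => dot (Dx w) (X k w - xs)) 0.
  have [OG _ OGd _] := noise k.
  apply: (noise_orthogonal (mX k) (mY k.+1) OG OGd (vXs k)) => i.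
  exact: sigma2_subl.
have sq l (Z : Omega -> 'rV[R]_l) : vL2 P Z ->
  is_rE P (fun w : Omega => dot (Z w) (Z w)) (rE P (fun w : Omega => dot (Z w) (Z w))).
  by move=> vZ; split => //; exact: vZ.2.
have ea j := sq _ _ (vXs j); have eb j := sq _ _ (vYs j).
have eu j := sq _ _ (vL2B (vX j) (vX j.-1)).
have ev j := sq _ _ (vL2B (vY j) (vY j.-1)).
have eL := is_rED (is_rED (is_rED (is_rEZ (tau^-1 + mux) (ea k.+1))
  (is_rEZ (sigma^-1 + muy) (eb k.+1))) (is_rEZ ((2 * tau)^-1 - K) (eu k.+1)))
  (is_rEZ ((2 * sigma)^-1 - K) (ev k.+1)).
have eR1 := is_rED (is_rED (is_rED (is_rEZ tau^-1 (ea k)) (is_rEZ sigma^-1 (eb k)))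
  (is_rEZ K (eu k))) (is_rEZ (K + (4 * sigma)^-1) (ev k)).
have eR2 := is_rEB (is_rEB (is_rED eR1 (is_rEZ (2 * (1 + theta)) (oD k)))
  (is_rEZ (2 * theta) (oD k.-1))) (is_rEZ 2 oDx).
have eR := is_rED (is_rED (is_rED eR2 (is_rEZ (16 * sigma) eD1)) (is_rEZ (8 * sigma) eD2))
  (is_rEZ (2 * tau) eDx).
apply: le_trans (is_rE_le eL eR _) _.
  move=> w; have := @sapd_step _ _ _ f g Phi gamma muy Lxx Lxy Lyx Lyy lambda
    Hstruct Hsmooth Hlambda x0 tau sigma theta tau0 sigma0 theta01
    (X k w) (Y k w) (X k.-1 w) (Y k.-1 w) (D k w) (D k.-1 w) (Dx w)
    (X k.+1 w) (Y k.+1 w) (fX k w) (fX k.-1 w) (gY k w) (gY k.-1 w).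
  apply.
    rewrite sapd_yS; congr prox; congr (_ + _ *: _).
    by rewrite /D -!/(gy _ w) ![gy _ w + _]addrC !subrK.
  by rewrite sapd_xS; congr prox; congr (_ - _ *: (_ + _)); rewrite /Dx -/(gx k w) addrC subrK.
have s16 : 0 <= 16 * sigma by rewrite mulr_ge0 // ltW.
have s8 : 0 <= 8 * sigma by rewrite mulr_ge0 // ltW.
have t2 : 0 <= 2 * tau by rewrite mulr_ge0 // ltW.
rewrite !mulr0 !subr0 addr0 -/(a k) -/(b k) -/(u k) -/(v k).
have := ler_wpM2l s16 r1_le; have := ler_wpM2l s8 r2_le; have := ler_wpM2l t2 r3_le.
move: (a k) (b k) (u k) (v k) => ak bk uk vk; move: K => K0; lra.
Qed.

(** Makes the noise term at most [h * Q]: the [32] is [24 / (1 - h)] at the largest allowed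
    [h = 1 / 4]. *)
Definition noise_level : R := 32 * deltay ^+ 2 / muy + 2 * deltax ^+ 2 / mux_of gamma lambda.
Let Q := noise_level.

Variable h : R.
Hypotheses (h04 : 0 < h <= 4^-1) (tauE : tau = h / mux) (sigmaE : sigma = h / (muy * (1 - h))).
Hypotheses (hKx : 5 * h * K <= mux) (hKy : 16 * h * K <= muy).

Lemma noise_level_ge0 : 0 <= Q.
Proof.
rewrite /Q /noise_level; apply: addr_ge0; apply: divr_ge0; rewrite ?(ltW muy0) ?(ltW mux0) //.
  by rewrite mulr_ge0 ?sqr_ge0.
by rewrite mulr_ge0 ?sqr_ge0.
Qed.

Lemma step_const_ge0 : 0 <= K.
Proof.
have sq (c L : R) : 0 <= c -> 0 <= c * L ^+ 2 / muy.
  by move=> c0; rewrite divr_ge0 ?(ltW muy0) // mulr_ge0 ?sqr_ge0.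
rewrite /K /step_const; apply: addr_ge0; first by apply: addr_ge0; exact: sq.
by rewrite divr_ge0 ?sqr_ge0 // ltW.
Qed.

Lemma sapd_mean_square k :
  a k <= (1 + h) ^- k * (2 * dot (x0 - xs) (x0 - xs) + muy / mux * dot (y0 - ys) (y0 - ys))
         + 2 * h * Q / mux.
Proof.
have := h04 => /andP[h0 h4].
have h1 : 0 < 1 - h by rewrite subr_gt0 (le_lt_trans h4) // invf_lt1 // ltr1n.
have hn : h != 0 by rewrite gt_eqF.
have mn : mux != 0 by rewrite gt_eqF.
have yn : muy != 0 by rewrite gt_eqF.
have h1n : 1 - h != 0 by rewrite gt_eqF.
have a0E : a 0%N = dot (x0 - xs) (x0 - xs) by rewrite -[RHS](rE_cst P).
have b0E : b 0%N = dot (y0 - ys) (y0 - ys) by rewrite -[RHS](rE_cst P).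
rewrite -a0E -b0E; apply: (@contraction_bound _ a b u v h mux muy K Q) => //.
- exact: step_const_ge0.
- exact: noise_level_ge0.
- by move=> j; apply: rE_ge0 => w; exact: dot_ge0.
- by move=> j; apply: rE_ge0 => w; exact: dot_ge0.
- by move=> j; apply: rE_ge0 => w; exact: dot_ge0.
- by move=> j; apply: rE_ge0 => w; exact: dot_ge0.
- by rewrite -(rE_cst P 0); congr rE; apply/funext => w; rewrite subrr dotr0.
- by rewrite -(rE_cst P 0); congr rE; apply/funext => w; rewrite subrr dotr0.
move=> j; have := moments_step j.
have -> : tau^-1 = mux / h by rewrite tauE invf_div.
have -> : sigma^-1 = muy * (1 - h) / h by rewrite sigmaE invf_div.
have -> : (2 * tau)^-1 = mux / (2 * h) by rewrite tauE; field; rewrite hn.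
have -> : (2 * sigma)^-1 = muy * (1 - h) / (2 * h).
  by rewrite sigmaE; field; rewrite hn yn h1n.
have -> : (4 * sigma)^-1 = muy * (1 - h) / (4 * h).
  by rewrite sigmaE; field; rewrite hn yn h1n.
move=> /le_trans; apply; rewrite lerD2l mulrDr; apply: lerD.
  rewrite sigmaE [leRHS](_ : _ = h / muy * 32 * deltay ^+ 2); last by field.
  apply: ler_wpM2r; first exact: sqr_ge0.
  rewrite [leLHS](_ : _ = h / muy * (24 / (1 - h))); last by field; rewrite yn h1n.
  rewrite ler_pM2l ?divr_gt0 // ler_pdivrMr //; lra.
by rewrite tauE le_eqVlt; apply/orP; left; apply/eqP; rewrite -/mux; field.
Qed.

(** Jensen's inequality in the form [t <= t ^+ 2 / (2 * e) + e / 2]. *)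
Lemma sapd_mean_distance k e : 0 < e ->
  (1 + h) ^- k * (2 * dot (x0 - xs) (x0 - xs) + muy / mux * dot (y0 - ys) (y0 - ys))
     + 2 * h * Q / mux <= e ^+ 2 ->
  rint P (fun w : Omega => enorm (X k w - xs)) /\ rE P (fun w : Omega => enorm (X k w - xs)) <= e.
Proof.
move=> e0 ke; have ak := le_trans (sapd_mean_square k) ke.
have vXs := vL2B (iterates_vL2 k).1 (vL2_cst P xs).
have mE : measurable_fun setT (fun w : Omega => enorm (X k w - xs)).
  have mX : measurable_fun setT ((fun t => X k t - xs) : Omega -> borel n).
    by apply: measurable_vector; exact: vXs.1.
  apply: (measurableT_comp (f := @enorm R n : borel n -> R) _ mX).
  apply: continuous_borelR => z; have := @continuous_dist R n 0 z.
  by rewrite /continuous_at; under eq_fun do rewrite subr0; rewrite subr0.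
have pw (w : Omega) : enorm (X k w - xs) <= (2 * e)^-1 * dot (X k w - xs) (X k w - xs) + e / 2.
  have := sqr_ge0 (enorm (X k w - xs) - e); rewrite -enorm_sqr => H.
  have e2 : 0 < 2 * e by rewrite mulr_gt0.
  rewrite -(ler_pM2l e2) mulrDr mulrA mulfV ?gt_eqF // mul1r; lra.
have iR : rint P (fun w : Omega => (2 * e)^-1 * dot (X k w - xs) (X k w - xs) + e / 2).
  by apply: rintD; [apply: rintZ; exact: vXs.2|exact: rint_cst].
have iL : rint P (fun w : Omega => enorm (X k w - xs)).
  apply: (rint_le mE _ iR) => w; rewrite ger0_norm ?enorm_ge0 //.
  by rewrite (le_trans (pw w)) // ler_norm.
split=> //; apply: le_trans (rE_le iL iR pw) _.
rewrite rED; [|by apply: rintZ; exact: vXs.2|exact: rint_cst].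
rewrite rEZ; last exact: vXs.2.
rewrite rE_cst -/(a k).
have e2 : 0 < 2 * e by rewrite mulr_gt0.
rewrite -(ler_pM2l e2) mulrDr mulrA mulfV ?gt_eqF // mul1r; lra.
Qed.

Lemma sapd_Gmap k e : 0 < e ->
  (1 + h) ^- k * (2 * dot (x0 - xs) (x0 - xs) + muy / mux * dot (y0 - ys) (y0 - ys))
     + 2 * h * Q / mux <= e ^+ 2 ->
  (\int[P]_t (enorm (Gmap f g Phi lambda (X k t)))%:E <=
    (enorm (grad_moreau lambda (phi f g Phi) x0) +
      (2 * kappa + (Lxx + Lxy * (Lyx / muy))) * e)%:E)%E.
Proof.
move=> e0 ke; have [iX eX] := sapd_mean_distance e0 ke.
set L := 2 * kappa + _.
have L0 : 0 <= L.
  have [[Lxx0 _ Lxy0 Lyx0] _] := Hsmooth.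
  rewrite /L; apply: addr_ge0; first by rewrite mulr_ge0 // invr_ge0 ltW.
  by apply: addr_ge0 => //; rewrite mulr_ge0 ?(ltW Lxy0) // divr_ge0 // ltW.
pose c := enorm (grad_moreau lambda (phi f g Phi) x0).
have iG : rint P (fun w : Omega => c + L * enorm (X k w - xs)).
  by apply: rintD; [exact: rint_cst|exact: rintZ].
apply: (@le_trans _ _ (\int[P]_t (c + L * enorm (X k t - xs))%:E)%E).
  apply: le_lower_integral => w; rewrite lee_fin ?enorm_ge0 //.
  apply: le_trans (Gmap_lip Hstruct Hsmooth Hlambda (fX k w) fxs) _.
  rewrite lerD2r; exact: (Gmap_prox_phi Hstruct Hsmooth Hlambda).
rewrite -[leLHS]fineK; last exact: (integrable_fin_num measurableT iG).
rewrite lee_fin -[fine _]/(rE P (fun w : Omega => c + L * enorm (X k w - xs))).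
rewrite rED; [|exact: rint_cst|exact: rintZ].
by rewrite rE_cst rEZ // lerD2l ler_wpM2l.
Qed.

End sapd_moments.

Section measurable_composition.
Context {R : realType}.

Lemma measurable_fun_enorm d (T : measurableType d) k (Z : T -> 'rV[R]_k) :
  measurable_fun setT (Z : T -> borel k) -> measurable_fun setT (fun t => enorm (Z t)).
Proof.
move=> mZ; apply: (measurableT_comp (f := @enorm R k : borel k -> R) _ mZ).
apply: continuous_borelR => z; have := @continuous_dist R k 0 z.
by rewrite /continuous_at; under eq_fun do rewrite subr0; rewrite subr0.
Qed.

Lemma measurable_vectorB d (T : measurableType d) k (Z Y : T -> 'rV[R]_k) :
  measurable_fun setT (Z : T -> borel k) -> measurable_fun setT (Y : T -> borel k) ->
  measurable_fun setT ((fun t => Z t - Y t) : T -> borel k).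
Proof.
move=> mZ mY; apply: measurable_vector => i; under eq_fun do rewrite !mxE.
by apply: measurable_funB; exact: (measurableT_comp (measurable_coord i)).
Qed.

(* [A] need not be measurable: the preimage of an open set under [F] is the
   trace on [A] of an open set. *)
Lemma measurable_lipschitz_comp d (T : measurableType d) n k (A : set 'rV[R]_n)
    (F : 'rV[R]_n -> 'rV[R]_k) (L : R) (X : T -> 'rV[R]_n) :
  (forall a b, A a -> A b -> enorm (F a - F b) <= L * enorm (a - b)) ->
  (forall t, A (X t)) -> measurable_fun setT (X : T -> borel n) ->
  measurable_fun setT ((F \o X) : T -> borel k).
Proof.
move=> FL AX mX.
apply: (@measurability _ _ T (borel k) _ _ (@open 'rV[R]_k)) => // _ [U oU <-].
rewrite setTI.
pose I := [set p : 'rV[R]_n * R | 0 < p.2 /\ forall b, A b -> ball p.1 p.2 b -> U (F b)].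
pose V := \bigcup_(p in I) ball p.1 p.2.
have oV : open V by apply: bigcup_open => p [p0 _]; exact: ball_open.
have -> : (F \o X) @^-1` U = X @^-1` V.
  apply/seteqP; split => t /=; last first.
    by move=> [p [_ pU]] pX; apply: pU => //; exact: AX.
  move=> UFX; have : nbhs (F (X t)) U by exact: open_nbhs_nbhs.
  move=> /nbhs_ballP[e /= e0 eU].
  have L0 : 0 < `|L| + 1 by rewrite ltr_wpDl.
  have nL : 0 < n.+1%:R * (`|L| + 1) by rewrite mulr_gt0.
  have r0 : 0 < e / (n.+1%:R * (`|L| + 1)) by rewrite divr_gt0.
  exists (X t, e / (n.+1%:R * (`|L| + 1))); last exact: ballxx.
  split=> //= b Ab; rewrite -ball_normE /= ltr_pdivlMr // => Xb.
  apply: eU; rewrite -ball_normE /=.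
  apply: le_lt_trans (norm_le_enorm _) _.
  apply: le_lt_trans (FL _ _ (AX t) Ab) _; apply: le_lt_trans Xb.
  apply: (@le_trans _ _ ((`|L| + 1) * enorm (X t - b))).
    by rewrite ler_wpM2r ?enorm_ge0 // (le_trans (ler_norm L)) // lerDl.
  rewrite [leRHS](_ : _ = (`|L| + 1) * (n.+1%:R * `|X t - b|)); last by ring.
  by rewrite ler_pM2l // enorm_le_norm.
have mV : measurable (V : set (borel n)) by apply: sub_sigma_algebra.
by have := mX measurableT _ mV; rewrite setTI.
Qed.

End measurable_composition.

(** * Complexity for fixed, then random, starting points *)

Section complexity.
Context {R : realType} {n m : nat}.
Variables (f : 'rV[R]_n -> \bar R) (g : 'rV[R]_m -> \bar R).
Variable Phi : 'rV[R]_n -> 'rV[R]_m -> R.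
Variables gamma muy Lxx Lxy Lyx Lyy lambda : R.
Hypothesis Hstruct : structural_assumption f g Phi gamma muy.
Hypothesis Hsmooth : smoothness_assumption f g Phi Lxx Lxy Lyx Lyy.
Hypothesis Hlambda : 0 < lambda < gamma^-1.
Implicit Types (x w z : 'rV[R]_n) (y : 'rV[R]_m).

Let muy0 : 0 < muy. Proof. by case: Hstruct => _ []. Qed.
Let lambda0 : 0 < lambda. Proof. by case/andP: Hlambda. Qed.

Context {dS dO : measure_display}.
Context {S : measurableType dS} {Omega : measurableType dO}.
Variable P : probability Omega R.
Variables (oraclex : 'rV[R]_n -> 'rV[R]_m -> S -> 'rV[R]_n).
Variables (oracley : 'rV[R]_n -> 'rV[R]_m -> S -> 'rV[R]_m).
Variables (omegax omegay : nat -> Omega -> S).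

Let mux := mux_of gamma lambda.
Let mux0 : 0 < mux. Proof. exact: (mux_of_gt0 Hstruct Hlambda). Qed.
Let K := step_const gamma muy Lxx Lyx Lyy lambda.
Let LG := 2 * lambda^-1 + (Lxx + Lxy * (Lyx / muy)).
Let Lys := Lyx / muy.
(** [c1] dominates both weights of the initial squared distances. [c3] and [c4] multiply
    [enorm (grad_moreau x0)] and the distance from [y0] to [ystar x0]; [1 + Lys] accounts for
    replacing [ystar xs] by [ystar x0]. *)
Let c1 := 2 + muy / mux.
Let c3 := LG * c1 * lambda * (1 + Lys).
Let c4 := LG * c1.

Variables (deltax deltay h : R).
Let Q := noise_level gamma muy lambda deltax deltay.
Let c5 := LG * (1 + 2 * Q / mux).

Let tau := h / mux.
Let sigma := h / (muy * (1 - h)).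
Let theta : R := 1 - h.

Let LG0 : 0 < LG.
Proof.
have [[Lxx0 _ Lxy0 Lyx0] _] := Hsmooth.
rewrite /LG ltr_pwDl ?mulr_gt0 ?invr_gt0 // addr_ge0 // mulr_ge0 ?(ltW Lxy0) //.
by rewrite divr_ge0 // ltW.
Qed.

Let Lys0 : 0 <= Lys.
Proof. by have [[_ _ _ Lyx0] _] := Hsmooth; rewrite divr_ge0 // ltW. Qed.

Let c1_gt0 : 0 < c1. Proof. by rewrite /c1 addr_gt0 // divr_gt0. Qed.

Let Q0 : 0 <= Q. Proof. exact: (noise_level_ge0 Hstruct Hlambda). Qed.

Hypotheses (h04 : 0 < h <= 4^-1) (hKx : 5 * h * K <= mux) (hKy : 16 * h * K <= muy).

Let h0 : 0 < h. Proof. by case/andP: h04. Qed.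
Let h1 : 0 < 1 - h.
Proof. by case/andP: h04 => _ h4; rewrite subr_gt0 (le_lt_trans h4) // invf_lt1 // ltr1n. Qed.
Let tau0 : 0 < tau. Proof. by rewrite divr_gt0. Qed.
Let sigma0 : 0 < sigma. Proof. by rewrite divr_gt0 // mulr_gt0. Qed.
Let theta01 : 0 <= theta <= 1. Proof. by rewrite /theta (ltW h1) /= gerBl ltW. Qed.

Let xN x0 y0 N (w : Omega) := sapd_x f g oraclex oracley omegax omegay gamma mux tau sigma theta x0 y0 w N.

Hypothesis noise : forall x0 y0, edom f x0 -> edom g y0 -> forall k,
  let x j (w : Omega) := sapd_x f g oraclex oracley omegax omegay gamma mux tau sigma theta x0 y0 w j in
  let y j (w : Omega) := sapd_y f g oraclex oracley omegax omegay gamma mux tau sigma theta x0 y0 w j in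
  let ox (w : Omega) := oraclex (x k w) (y k.+1 w) (omegax k w) in
  let oy (w : Omega) := oracley (x k w) (y k w) (omegay k w) in
  let gx (w : Omega) := gradx Phi (x k w) (y k.+1 w) in
  let gy (w : Omega) := grady Phi (x k w) (y k w) in
  [/\ cond_exp_vec P (sigma2 (x k) (y k.+1)) ox gx,
      cond_exp_vec P (sigma2 (x k) (y k)) oy gy,
      cond_exp_le P (sigma2 (x k) (y k.+1))
        (fun w : Omega => enorm (ox w - gx w) ^+ 2) (deltax ^+ 2) &
      cond_exp_le P (sigma2 (x k) (y k))
        (fun w : Omega => enorm (oy w - gy w) ^+ 2) (deltay ^+ 2)].

(** The bound is affine in the initial distances. It uses [enorm (x0 - xs) = lambda * enorm
    (grad_moreau x0)] and the Lipschitz continuity of [ystar]. *)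
Lemma Gmap_expectation_fixed_start x0 y0 eta M : edom f x0 -> edom g y0 ->
  0 < eta -> eta ^+ 2 = h ->
  (\int[P]_t (enorm (Gmap f g Phi lambda (xN x0 y0 (2 * M) t)))%:E <=
   ((1 + (1 + h) ^- M * c3) * enorm (grad_moreau lambda (phi f g Phi) x0) +
    (1 + h) ^- M * c4 * enorm (y0 - ystar f g Phi x0) + c5 * eta)%:E)%E.
Proof.
move=> fx0 gy0 eta0 etah.
set xs := prox lambda (phi f g Phi) x0; pose ys := ystar f g Phi xs.
have fxs : edom f xs by exact: (prox_phi_edom Hstruct Hlambda).
set rho := (1 + h) ^- M.
have rho0 : 0 < rho by rewrite invr_gt0 exprn_gt0 // addr_gt0.
pose p := enorm (x0 - xs); pose q := enorm (y0 - ys).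
have p0 : 0 <= p by exact: enorm_ge0.
have q0 : 0 <= q by exact: enorm_ge0.
pose B := 1 + 2 * Q / mux.
have B1 : 1 <= B by rewrite lerDl divr_ge0 ?(ltW mux0) // mulr_ge0.
(* The sum of the squares of the two nonnegative terms dominates the mean-square bound, whose noise
   part is of order [eta ^+ 2 = h]. *)
pose e := rho * c1 * (p + q) + B * eta.
have rc0 : 0 <= rho * c1 * (p + q).
  by apply: mulr_ge0; [apply: mulr_ge0; exact: ltW|exact: addr_ge0].
have Be0 : 0 < B * eta by rewrite mulr_gt0 // (lt_le_trans ltr01).
have e0 : 0 < e by exact: ltr_wpDl.
have key : (1 + h) ^- (2 * M) * (2 * dot (x0 - xs) (x0 - xs)
    + muy / mux * dot (y0 - ys) (y0 - ys)) + 2 * h * Q / mux <= e ^+ 2.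
  rewrite -!enorm_sqr -/p -/q mulnC exprM -exprVn -/rho -etah.
  have r0 : 0 <= muy / mux by rewrite divr_ge0 // ltW.
  apply: (@le_trans _ _ ((rho * c1 * (p + q)) ^+ 2 + (B * eta) ^+ 2)); last first.
    by have := mulr_ge0 rc0 (ltW Be0); rewrite /e sqrrD; lra.
  apply: lerD.
    rewrite [leRHS](_ : _ = rho ^+ 2 * (c1 ^+ 2 * (p + q) ^+ 2)); last by ring.
    apply: ler_wpM2l; first exact: sqr_ge0.
    have pq : 0 <= p * q by rewrite mulr_ge0.
    apply: (@le_trans _ _ (c1 * (p + q) ^+ 2)).
      rewrite /c1; have := mulr_ge0 r0 (sqr_ge0 p); have := mulr_ge0 r0 pq.
      have := sqr_ge0 q; lra.
    apply: ler_wpM2r; first exact: sqr_ge0.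
    have : 1 <= c1 by rewrite /c1; lra.
    by move=> c1_ge1; rewrite expr2 ler_peMr // ltW.
  rewrite exprMn [leLHS](_ : _ = 2 * Q / mux * eta ^+ 2); last by ring.
  apply: ler_wpM2r; first exact: sqr_ge0.
  have : 2 * Q / mux <= B by rewrite lerDr.
  by move=> /le_trans; apply; rewrite expr2 ler_peMr // (le_trans ler01).
have := @sapd_Gmap _ _ _ f g Phi gamma muy Lxx Lxy Lyx Lyy lambda Hstruct Hsmooth Hlambda
  _ _ S Omega P oraclex oracley omegax omegay tau sigma theta deltax deltay x0 y0
  tau0 sigma0 theta01 fx0 gy0 (noise fx0 gy0) h h04 erefl erefl hKx hKy (2 * M)%N e e0 key.
move=> /le_trans; apply; rewrite lee_fin -/LG.
have gmE : p = lambda * enorm (grad_moreau lambda (phi f g Phi) x0).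
  rewrite (grad_moreau_phi Hstruct Hlambda) enormZ gtr0_norm ?invr_gt0 //.
  by rewrite mulrA mulfV ?mul1r // gt_eqF.
have qle : q <= enorm (y0 - ystar f g Phi x0) + Lys * p.
  apply: le_trans (enormD3 (ystar f g Phi x0) _ _) _; rewrite lerD2l.
  exact: (ystar_lip Hstruct Hsmooth).
move: qle; rewrite gmE; set A := enorm (grad_moreau _ _ _); set Dd := enorm (y0 - ystar _ _ _ x0).
move=> qle; rewrite /e gmE /c3 /c4 /c5 -/B -/A.
have H : LG * rho * c1 * q <= LG * rho * c1 * (Dd + Lys * (lambda * A)).
  by apply: ler_wpM2l => //; apply: mulr_ge0; [apply: mulr_ge0|]; exact: ltW.
lra.
Qed.

Lemma Gmap_expectation_random_start (d0 : measure_display) (Omega0 : measurableType d0)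
    (P0 : probability Omega0 R) (xeps : Omega0 -> 'rV[R]_n) (y0 : Omega0 -> 'rV[R]_m)
    (eps D eta : R) M :
  0 < eta -> eta ^+ 2 = h ->
  measurable_fun setT (xeps : Omega0 -> borel n) ->
  measurable_fun setT (y0 : Omega0 -> borel m) ->
  (forall t, edom f (xeps t)) -> (forall t, edom g (y0 t)) ->
  (\int[P0]_t (enorm (y0 t - ystar f g Phi (xeps t)))%:E <= D%:E)%E ->
  (\int[P0]_t (enorm (grad_moreau lambda (phi f g Phi) (xeps t)))%:E
     <= (eps / 2)%:E)%E ->
  (\int[(P0 \x P)%E]_z
     (enorm (Gmap f g Phi lambda (xN (xeps z.1) (y0 z.1) (2 * M) z.2)))%:E <=
   ((1 + (1 + h) ^- M * c3) * (eps / 2) + (1 + h) ^- M * c4 * D + c5 * eta)%:E)%E.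
Proof.
move=> eta0 etah mx my fx gy ED EA.
set rho := (1 + h) ^- M.
have rho0 : 0 <= rho by rewrite invr_ge0 exprn_ge0 // addr_ge0 // ltW.
have lc : 0 <= LG * c1 by apply: mulr_ge0; exact: ltW.
have c30 : 0 <= 1 + rho * c3.
  apply: addr_ge0 => //; apply: mulr_ge0 => //; apply: mulr_ge0; last exact: addr_ge0.
  by apply: mulr_ge0 => //; exact: ltW.
have c40 : 0 <= rho * c4 by exact: mulr_ge0.
have c50 : 0 <= c5 * eta.
  apply: mulr_ge0; last exact: ltW.
  apply: mulr_ge0; first exact: ltW.
  by apply: addr_ge0 => //; apply: divr_ge0; [exact: mulr_ge0|exact: ltW].
pose A t := enorm (grad_moreau lambda (phi f g Phi) (xeps t)).
pose E t := enorm (y0 t - ystar f g Phi (xeps t)).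
have mA : measurable_fun setT A.
  apply: measurable_fun_enorm.
  apply: (@measurableT_comp _ _ _ _ (borel n) (borel n)
    (fun x => grad_moreau lambda (phi f g Phi) x)) => //.
  apply: continuous_borel.
  apply: (@lipschitz_continuous _ _ _ _ (lambda^-1 * (1 + lambda^-1 / mux))) => a b.
  rewrite !(grad_moreau_phi Hstruct Hlambda) -scalerBr enormZ gtr0_norm ?invr_gt0 //.
  rewrite -mulrA ler_pM2l ?invr_gt0 // mulrDl mul1r.
  have swap (p q u v : 'rV[R]_n) : p - u - (q - v) = (p - q) - (u - v).
    by apply/rowP => i; rewrite !mxE; ring.
  rewrite swap.
  apply: le_trans (enormD _ _) _; rewrite enormN lerD2l.
  exact: (prox_phi_lip Hstruct Hlambda).
(* [ystar] is known to be Lipschitz only on [dom f], unlike [grad_moreau] above. *)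
have mE : measurable_fun setT E.
  apply: measurable_fun_enorm; apply: measurable_vectorB => //.
  apply: (@measurable_lipschitz_comp _ _ _ _ _ (edom f) _ (Lyx / muy)) => //.
  by move=> a b; exact: (ystar_lip Hstruct Hsmooth).
apply: (@le_trans _ _ (\int[P0]_t
    ((1 + rho * c3) * A t + rho * c4 * E t + c5 * eta)%:E)%E).
  apply: lower_integral_prod => [z|t]; first by rewrite lee_fin enorm_ge0.
  have H := Gmap_expectation_fixed_start M (fx t) (gy t) eta0 etah.
  exact: H.
have mZ (c : R) (X : Omega0 -> R) : measurable_fun setT X ->
    measurable_fun setT (fun t => (c * X t)%:E).
  by move=> mX; apply/measurable_EFinP; exact: measurable_funM.
have iZ (c : R) (X : Omega0 -> R) (B : R) : 0 <= c -> measurable_fun setT X ->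
    (forall t, 0 <= X t) -> (\int[P0]_t (X t)%:E <= B%:E)%E ->
    (\int[P0]_t (c * X t)%:E <= (c * B)%:E)%E.
  move=> cge mX X0 XB.
  under eq_integral do rewrite EFinM.
  rewrite ge0_integralZl_EFin //.
  - by rewrite EFinM; apply: lee_wpmul2l => //; rewrite lee_fin.
  - by move=> t _; rewrite lee_fin.
  - exact/measurable_EFinP.
under eq_integral do rewrite !EFinD.
rewrite !EFinD ge0_integralD //.
- apply: leeD.
    rewrite ge0_integralD //.
    + by apply: leeD; apply: iZ => // t; exact: enorm_ge0.
    + by move=> t _; rewrite lee_fin mulr_ge0 // enorm_ge0.
    + exact: mZ.
    + by move=> t _; rewrite lee_fin mulr_ge0 // enorm_ge0.
    + exact: mZ.
  by rewrite integral_cst //= probability_setT mule1.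
- by move=> t _; rewrite -EFinD lee_fin addr_ge0 // mulr_ge0 // enorm_ge0.
- by apply: emeasurable_funD; exact: mZ.
Qed.

End complexity.

Theorem theorem2 (R : realType) (n m : nat)
  (f : 'rV[R]_n -> \bar R) (g : 'rV[R]_m -> \bar R)
  (Phi : 'rV[R]_n -> 'rV[R]_m -> R)
  (gamma muy Lxx Lxy Lyx Lyy lambda : R)
  (dS dO : measure_display) (S : measurableType dS) (Omega : measurableType dO)
  (P : probability Omega R)
  (oraclex : 'rV[R]_n -> 'rV[R]_m -> S -> 'rV[R]_n)
  (oracley : 'rV[R]_n -> 'rV[R]_m -> S -> 'rV[R]_m)
  (omegax omegay : nat -> Omega -> S)
  (Hstruct : structural_assumption f g Phi gamma muy)
  (Hsmooth : smoothness_assumption f g Phi Lxx Lxy Lyx Lyy)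
  (Hmeas : measurable_oracle oraclex oracley omegax omegay)
  (Hnoise : noise_assumption f g Phi P oraclex oracley omegax omegay gamma)
  (Hlambda : 0 < lambda < gamma^-1) :
  forall D : R, exists (C : R) (p : nat),
  forall (eps : R) (d0 : measure_display) (Omega0 : measurableType d0)
    (P0 : probability Omega0 R)
    (xeps : Omega0 -> 'rV[R]_n) (y0 : Omega0 -> 'rV[R]_m),
  0 < eps <= 1 ->
  measurable_fun setT (xeps : Omega0 -> borel n) ->
  measurable_fun setT (y0 : Omega0 -> borel m) ->
  (forall w, edom f (xeps w)) -> (forall w, edom g (y0 w)) ->
  ('E_P0[fun w => enorm (y0 w - ystar f g Phi (xeps w))%R] <= D%:E)%E ->
  ('E_P0[fun w => enorm (grad_moreau lambda (phi f g Phi) (xeps w))]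
     <= (eps / 2)%:E)%E ->
  exists mux beta tau sigma theta : R,
  [/\ 0 < mux, 0 < beta <= 1, (0 < Lyy -> beta < 1) &
      [/\ tau = (1 - theta) / mux,
          sigma = (1 - theta) / (muy * theta) &
          theta_bar gamma muy Lxx Lyx Lyy mux beta <= theta < 1]] /\
  exists N : nat,
    (sapd_calls N)%:R <= C * eps ^- 2 * (1 + ln eps^-1) ^+ p /\
    (\int[(P0 \x P)%E]_z
       (enorm (Gmap f g Phi lambda
          (sapd_x f g oraclex oracley omegax omegay gamma mux tau sigma theta
             (xeps z.1) (y0 z.1) z.2 N)))%:E <= eps%:E)%E.
Proof.
move=> D.
have gamma0 : 0 < gamma by case: Hstruct => -[].
have muy0 : 0 < muy by case: Hstruct => _ [].
have lambda0 : 0 < lambda by case/andP: Hlambda.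
have [[Lxx0 Lyy0 Lxy0 Lyx0] _] := Hsmooth.
pose mux := mux_of gamma lambda.
have mux0 : 0 < mux by exact: (mux_of_gt0 Hstruct Hlambda).
(* The noise levels depend on [mux] alone, so all constants can be fixed before [eps] and the step
   sizes. *)
have [deltax [deltay [_ _ noise]]] := Hnoise mux mux0.
pose K := step_const gamma muy Lxx Lyx Lyy lambda.
have K0 : 0 <= K by exact: (step_const_ge0 Lxx Lyx Lyy Hstruct Hlambda).
pose Q := noise_level gamma muy lambda deltax deltay.
have Q0 : 0 <= Q by exact: (noise_level_ge0 Hstruct Hlambda).
pose LG := 2 * lambda^-1 + (Lxx + Lxy * (Lyx / muy)).
have LG0 : 0 < LG.
  rewrite /LG ltr_pwDl ?mulr_gt0 ?invr_gt0 // addr_ge0 // mulr_ge0 ?(ltW Lxy0) //.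
  by rewrite divr_ge0 // ltW.
pose c1 := 2 + muy / mux.
have c1_gt0 : 0 < c1 by rewrite /c1 addr_gt0 // divr_gt0.
pose c3 := LG * c1 * lambda * (1 + Lyx / muy).
pose c4 := LG * c1.
pose c5 := LG * (1 + 2 * Q / mux).
have c4_ge0 : 0 <= c4 by apply: mulr_ge0; exact: ltW.
have c3_ge0 : 0 <= c3.
  apply: mulr_ge0; first by apply: mulr_ge0 => //; exact: ltW.
  by apply: addr_ge0 => //; apply: divr_ge0; exact: ltW.
have c5_gt0 : 0 < c5.
  apply: mulr_gt0 => //; apply: ltr_pwDl => //.
  by apply: divr_ge0; [exact: mulr_ge0|exact: ltW].
pose tb := theta_bar gamma muy Lxx Lyx Lyy mux 2^-1.
have tb1 : 0 < 1 - tb by rewrite subr_gt0; exact: theta_bar_lt1.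
have K51 : 0 < 5 * K + 1 by apply: ltr_wpDl => //; exact: mulr_ge0.
have K161 : 0 < 16 * K + 1 by apply: ltr_wpDl => //; exact: mulr_ge0.
(* Collects the constraints on [h]: the contraction range, [theta_bar <= 1 - h], and the two bounds
   on [h * K]. The [+ 1] guards against [K = 0]. *)
pose hmax := Num.min (4^-1) (Num.min (1 - tb)
  (Num.min (mux / (5 * K + 1)) (muy / (16 * K + 1)))).
have hmax0 : 0 < hmax by rewrite !lt_min invr_gt0 ltr0n tb1 !divr_gt0.
(* With [eta = c * eps] this gives [h = eta ^+ 2 <= eta <= hmax] and a noise floor [c5 * eta] of at
   most [eps / 4]. *)
pose c := Num.min 1 (Num.min hmax (4 * c5)^-1).
have c0 : 0 < c by rewrite lt_min ltr01 lt_min hmax0 invr_gt0 mulr_gt0.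
have c_le1 : c <= 1 by rewrite ge_min lexx.
have c_hmax : c <= hmax.
  by rewrite ge_min; apply/orP; right; rewrite ge_min lexx.
have c_c5 : 4 * c5 * c <= 1.
  have c50 : 0 < 4 * c5 by rewrite mulr_gt0.
  have : c <= (4 * c5)^-1 by rewrite ge_min; apply/orP; right; rewrite ge_min lexx orbT.
  by rewrite -(ler_pM2l c50) mulfV // gt_eqF.
(* Reducing the initial error by [Z / eps] brings its contribution below [eps / 4]; the [+ 1]
   ensures [1 <= Z]. *)
pose Z := 4 * (c3 + c4 * `|D| + 1).
have cD : 0 <= c4 * `|D| by exact: mulr_ge0.
have Z1 : 1 <= Z by rewrite /Z; lra.
have Z0 : 0 < Z by exact: lt_le_trans Z1.
have ln2 : 0 < ln (2 : R) by rewrite ln_gt0 // ltr1n.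
pose C0 := ln Z / ln 2 + (ln 2)^-1 + 1.
(* Two calls for each of [2 * M] steps, with [M] at most [2 / h] times a logarithm and
   [h = c ^+ 2 * eps ^+ 2]. [C0] absorbs the constants next to [ln eps^-1]. *)
exists (8 / c ^+ 2 * C0), 1%N.
move=> eps d0 Omega0 P0 xeps y0 /andP[eps0 eps1] mx my fx gy ED EA.
pose eta := c * eps; pose h := eta ^+ 2.
have eta0 : 0 < eta by exact: mulr_gt0.
have eta_c : eta <= c by rewrite /eta ler_piMr // ltW.
have h0 : 0 < h by rewrite exprn_gt0.
have h_hmax : h <= hmax.
  apply: (le_trans _ c_hmax); apply: (le_trans _ eta_c).
  by rewrite /h expr2 ler_piMr ?(ltW eta0) // (le_trans eta_c).
have : h <= hmax by [].
rewrite /hmax !le_min => /andP[h4 /andP[htb /andP[hK5 hK16]]].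
have h04 : 0 < h <= 4^-1 by rewrite h0.
have h1 : h < 1 by rewrite (le_lt_trans h4) // invf_lt1 // ltr1n.
have hKx : 5 * h * K <= mux.
  by move: hK5; rewrite ler_pdivlMr // => /(le_trans _); apply; lra.
have hKy : 16 * h * K <= muy.
  by move: hK16; rewrite ler_pdivlMr // => /(le_trans _); apply; lra.
have Zeps : 1 <= Z / eps.
  by rewrite ler_pdivlMr // mul1r (le_trans eps1).
have h01 : 0 < h <= 1 by rewrite h0 ltW.
have [M [rhoM MM]] := exists_contraction_power h01 Zeps.
exists mux, 2^-1, (h / mux), (h / (muy * (1 - h))), (1 - h); split.
  split.
  - exact: mux0.
  - by rewrite invr_gt0 ltr0n invf_le1 // ler1n.
  - by move=> _; rewrite invf_lt1 // ltr1n.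
  - split.
    + by rewrite subKr.
    + by rewrite subKr.
    + by rewrite gtrBl h0 andbT -/tb lerBrDr addrC -lerBrDr.
exists (2 * M)%N; split.
  have lne : 0 <= ln eps^-1 by rewrite ln_ge0 // invf_ge1.
  have lZ : 0 <= ln Z by rewrite ln_ge0.
  have hE : h^-1 = eps ^- 2 / c ^+ 2 by rewrite /h /eta exprMn invfM mulrC.
  have -> : (sapd_calls (2 * M))%:R = 4 * M%:R :> R.
    by rewrite /sapd_calls mulnA natrM.
  apply: (@le_trans _ _ (4 * (2 / h * (ln (Z / eps) / ln 2 + 1)))).
    by rewrite ler_pM2l.
  rewrite lnM ?posrE ?invr_gt0 // expr1 hE.
  rewrite [leLHS](_ : _ = 8 / c ^+ 2 * eps ^- 2 * ((ln Z + ln eps^-1) / ln 2 + 1)); last by ring.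
  rewrite [leRHS](_ : _ = 8 / c ^+ 2 * eps ^- 2 * (C0 * (1 + ln eps^-1))); last by ring.
  apply: ler_wpM2l; first by rewrite mulr_ge0 // ?divr_ge0 // ?exprn_ge0 ?invr_ge0 ?exprn_ge0 // ltW.
  have i2 : 0 <= (ln (2 : R))^-1 by rewrite invr_ge0 ltW.
  have := mulr_ge0 lZ i2; have := mulr_ge0 (mulr_ge0 lZ i2) lne; have := mulr_ge0 lne i2.
  rewrite /C0; lra.
have rho0 : 0 <= (1 + h) ^- M by rewrite invr_ge0 exprn_ge0 // addr_ge0 // ltW.
have D_le : ('E_P0[fun w => enorm (y0 w - ystar f g Phi (xeps w))%R] <= `|D|%:E)%E.
  by apply: le_trans ED _; rewrite lee_fin ler_norm.
rewrite unlock in D_le; rewrite unlock in EA.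
have s0 : 0 < h / (muy * (1 - h)) by rewrite divr_gt0 // mulr_gt0 // subr_gt0.
have t0 : 0 <= 1 - h by rewrite subr_ge0 ltW.
have := @Gmap_expectation_random_start _ _ _ f g Phi gamma muy Lxx Lxy Lyx Lyy lambda
  Hstruct Hsmooth Hlambda _ _ S Omega P oraclex oracley omegax omegay
  deltax deltay h h04 hKx hKy
  (fun x y fx0 gy0 => noise x y (h / mux) (h / (muy * (1 - h))) (1 - h) fx0 gy0
    (divr_gt0 h0 mux0) s0 t0)
  d0 Omega0 P0 xeps y0 eps `|D| eta M eta0 erefl mx my fx gy D_le EA.
move=> /le_trans; apply; rewrite lee_fin.
have rhoE : Z * (1 + h) ^- M <= eps.
  have := rhoM; rewrite invfM invrK mulrC -(ler_pM2l Z0) => /le_trans; apply.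
  by rewrite mulrCA mulfV ?mulr1 // gt_eqF.
move: rho0 rhoE; rewrite -/mux -/Q -/LG -/c1 -/c3 -/c4 -/c5.
move: ((1 + h) ^- M) => rho rho0 rhoE.
(* Final budget: [eps / 2] from the stationarity of the start, [eps / 4] from the contracted initial
   error, [eps / 4] from the noise. *)
have H1 : rho * c3 * eps <= rho * c3.
  by rewrite ler_piMr // mulr_ge0.
have H2 : c5 * eta <= eps / 4.
  rewrite /eta; have := ler_wpM2r (ltW eps0) c_c5; lra.
have H3 : 4 * rho * (c3 + c4 * `|D|) <= eps.
  by apply: le_trans rhoE; rewrite /Z; lra.
have H4 : 0 <= rho * c3 by rewrite mulr_ge0.
lra.
Qed.
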